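(* Let $0<c\le C<\infty$, let $(\omega_n)_{n\ge0}$ be a sequence of complex numbers with $c\le|\omega_n|\le C$ for all $n\in\mathbb Z_+$, and let \[ F(z)=\sum_{n\ge 0}\omega_n\,\frac{z^n}{n!},\qquad z\in\mathbb C . \] Suppose that at least one of the following two conditions holds: (i) $\displaystyle \limsup_{R\to\infty}\frac{n_F(R)}{\sqrt R}=0$; (ii) for some $\varepsilon>0$, $\displaystyle \liminf_{R\to\infty}\frac{n_F(R)}{R^{\frac12-\varepsilon}}=0$. Then $F$ is an exponential function, that is, $F(z)=\Theta e^{\alpha z}$ for some nonzero $\Theta,\alpha\in\mathbb C$.
   Context: $\mathbb Z_+$ denotes the non-negative integers. For an entire function $F$, $n_F(R)$ denotes the number of zeroes of $F$ in the closed disk $\{|z|\le R\}$, counted with multiplicities. *)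

(* Defs.v *)
From Stdlib Require Export Reals List Factorial.
From Coquelicot Require Export Coquelicot.

Open Scope R_scope.

Definition Cexp (z : C) : C :=
  (RtoC (exp (Re z)) * (cos (Im z), sin (Im z)))%C.

Definition entire (f : C -> C) : Prop :=
  forall z : C, @ex_derive C_AbsRing C_NormedModule f z.

Definition is_zero_of_mult (f : C -> C) (a : C) (m : nat) : Prop :=
  f a = RtoC 0 /\
  exists g : C -> C,
    entire g /\ g a <> RtoC 0 /\
    (forall z : C, f z = ((z - a) ^ m * g z)%C).

(* The number of zeroes in the closed disk, as the supremum of the total
   multiplicities of the finite sets of zeroes it contains; each entry of [l]
   pairs a zero with its multiplicity.  Meant for entire functions that do not
   vanish identically, for which the supremum is the full, finite count. *)
Definition zero_count (f : C -> C) (r : R) : Rbar :=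
  Lub_Rbar (fun x : R =>
    exists l : list (C * nat),
      NoDup (map fst l) /\
      (forall (a : C) (m : nat), In (a, m) l ->
         Cmod a <= r /\ is_zero_of_mult f a m) /\
      x = INR (list_sum (map snd l))).

(* Upper and lower limits as the real argument tends to +oo, the analogues of
   Coquelicot's [LimSup_seq] and [LimInf_seq]. *)
Definition LimSup_infty (u : R -> Rbar) : Rbar :=
  Rbar_glb (fun s : Rbar =>
    exists A : R, s = Rbar_lub (fun y : Rbar => exists x : R, A <= x /\ y = u x)).

Definition LimInf_infty (u : R -> Rbar) : Rbar :=
  Rbar_lub (fun s : Rbar =>
    exists A : R, s = Rbar_glb (fun y : Rbar => exists x : R, A <= x /\ y = u x)).

(* Main.v *)
(** Divide [F] by its zeroes in the disc of radius [R]: [F = P * G 0 * e^h] there, with [P]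
    a polynomial normalized at the origin and [h] holomorphic.  As [|F(z)| <= K e^|z|], the
    Borel-Caratheodory inequality gives [h^(k)(0) = O(R^(1-k))], so that [h] is almost linear
    well inside the disc.  Rotating all zeroes of [P] to the positive ray gives a polynomial
    [P*] with [|P*(r)| <= |P(z)|] for [|z| = r], hence
      [ln |P*(r)| <= C + r - max_{|z|=r} Re h].
    The lower bound for the coefficients makes [max |F|] as large as [e^r] up to a power of
    [r], so the right hand side is at most [C + o(1) sqrt r] on a long interval [0, rho].
    As [P*] has [o(sqrt rho)] growth on [|z| = rho], the Phragmen-Lindelof principle in the
    slit disc yields [P*(-t) <= e^(C + o(1) sqrt t)] with [C] independent of [R] and [t].  Since
    [P*(-t) >= 1 + t/|a|] for every zero [a] of [F], letting first [R] and then [t] tend to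
    infinity shows that [F] has no zeroes, and then [h] is linear.

    Under (i) take [rho = sqrt R]: there [h] is linear up to [O(1)].  Under (ii) one needs
    [rho] close to [R], where the Taylor coefficients of [h] are not negligible.  The defect
    [m(r) = r - max_{|z|=r} Re h] extends to a holomorphic function of [|r| < c R] that is
    [O(R)] there and at most [L = R^(1/2 - eps) ln R], up to a constant, on the real segment.
    The two-constants theorem gives [m = O(L)] on [|r| < c' R / (ln R)^2], and so
    [m(r) = O(L r (ln R)^2 / R)] by Borel-Caratheodory. *)

Require Import Defs.
From Stdlib Require Import Lra Lia ZArith ClassicalEpsilon.

(** * Complex differentiability *)

(** The exponent 1/2 comes from the slit disc: the substitution z = w^2 opens it to a half disc and
    turns growth of order sqrt |z| into growth of order |w|, the critical order for
    Phragmen-Lindelof in a half plane. The lower bound for max |F| comes from Cauchy's inequalities: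
    max |F| / c dominates every term r^n / n! of e^r, and about 4 r of these terms carry the whole
    sum up to a summand 1. The obstacle under (ii) is that a maximum over a circle has no reason to
    be holomorphic in the radius. It is so here because h is nearly linear: the maximizing angle
    solves a contractive fixed point equation. The n-th iterate, started at angle 0, is holomorphic
    in the radius and misses the maximum by O(r 2^-n), so n of size log r suffices. The function
    theory rests on the mean value property of Re f on circles: it yields the maximum principle,
    Cauchy's inequalities and Borel-Caratheodory. Logarithms are built by integrating along rays
    from the origin. Complex estimates are reduced to real ones by testing with Re (c w) for all
    unimodular c. *)

Definition cder (f : C -> C) (z l : C) : Prop :=
  forall eps, 0 < eps -> exists d, 0 < d /\
    forall k, Cmod k < d -> Cmod (f (z + k) - f z - l * k)%C <= eps * Cmod k.

Definition ccont (f : C -> C) (z : C) : Prop :=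
  forall eps, 0 < eps -> exists d, 0 < d /\
    forall k, Cmod k < d -> Cmod (f (z + k) - f z)%C <= eps.

Definition rcder (g : R -> C) (s : R) (l : C) : Prop :=
  forall eps, 0 < eps -> exists d, 0 < d /\
    forall h, Rabs h < d -> Cmod (g (s + h)%R - g s - h * l)%C <= eps * Rabs h.

Lemma C_ext (a b : C) : Re a = Re b -> Im a = Im b -> a = b.
Proof. destruct a, b; simpl; intros -> ->; reflexivity. Qed.

Ltac rring := unfold Re, Im; simpl; unfold Re, Im; ring.
Ltac cring := apply C_ext; rring.

Lemma im_le_Cmod (z : C) : Rabs (Im z) <= Cmod z.
Proof. apply Rle_trans with (2 := Rmax_Cmod z). apply Rmax_r. Qed.

Lemma Re_le_Cmod (z : C) : Re z <= Cmod z.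
Proof. generalize (re_le_Cmod z) (Rle_abs (Re z)); lra. Qed.

Lemma Cmod_le_abs (z : C) : Cmod z <= Rabs (Re z) + Rabs (Im z).
Proof.
  replace z with (RtoC (Re z) + Ci * RtoC (Im z))%C at 1 by cring.
  eapply Rle_trans; [apply Cmod_triangle|].
  rewrite Cmod_mult, Cmod_Ci, !Cmod_R. lra.
Qed.

Lemma Cmod_minus_sym (a b : C) : Cmod (a - b)%C = Cmod (b - a)%C.
Proof. replace (a - b)%C with (- (b - a))%C by ring. apply Cmod_opp. Qed.

Lemma Cmod_triangle_inv (a b : C) : Cmod a - Cmod b <= Cmod (a - b)%C.
Proof.
  generalize (Cmod_triangle (a - b) b). replace (a - b + b)%C with a by ring. lra.
Qed.

Lemma Cmod_minus_le (a b : C) : Cmod (a - b)%C <= Cmod a + Cmod b.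
Proof. unfold Cminus. rewrite <- (Cmod_opp b). apply Cmod_triangle. Qed.

Lemma Cmod_Cexp (z : C) : Cmod (Cexp z)%C = exp (Re z).
Proof.
  unfold Cexp. rewrite Cmod_mult, Cmod_R, Rabs_pos_eq by (left; apply exp_pos).
  set (y := Im z). unfold Cmod; simpl.
  replace (_ * (_ * 1) + _) with (Rsqr (sin y) + Rsqr (cos y)) by (unfold Rsqr; ring).
  rewrite sin2_cos2, sqrt_1. ring.
Qed.

Lemma Cexp_plus (a b : C) : Cexp (a + b)%C = (Cexp a * Cexp b)%C.
Proof.
  unfold Cexp. apply C_ext; simpl; unfold Re, Im; rewrite exp_plus, ?cos_plus, ?sin_plus; ring.
Qed.

Lemma Cexp_0 : Cexp 0%C = 1%C.
Proof. unfold Cexp; simpl. rewrite exp_0, cos_0, sin_0. cring. Qed.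

Lemma Cexp_opp (z : C) : (Cexp z * Cexp (- z))%C = 1%C.
Proof. rewrite <- Cexp_plus. replace (z + - z)%C with (RtoC 0) by (apply C_ext; rring). apply Cexp_0. Qed.

(** Dividing by [x + 1] instead of [x] gives a tolerance that absorbs the factor [x] without a case
    distinction at [x = 0]. *)
Lemma small_quot (eps x : R) : 0 < eps -> 0 <= x -> 0 < eps / (x + 1) /\ eps / (x + 1) * x <= eps.
Proof.
  intros He Hx. split. apply Rdiv_lt_0_compat; lra.
  replace (eps / (x+1) * x) with (eps - eps / (x+1)) by (field; lra).
  assert (0 < eps / (x+1)) by (apply Rdiv_lt_0_compat; lra). lra.
Qed.

(* [C] with the norm [Cmod] as a normed module over itself; Coquelicot's canonical [C_NormedModule]
   has the same norm but the product uniform structure. *)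
Notation CM := (AbsRing_NormedModule C_AbsRing).

Lemma cder_is_derive f z l : cder f z l <-> @is_derive C_AbsRing CM f z l.
Proof.
  split.
  - intros H. split. apply is_linear_scal_l.
    intros x Hx. assert (Ex := is_filter_lim_locally_unique (K := C_AbsRing) (V := CM) z x Hx). subst x.
    intros eps. apply (locally_le_locally_norm (V := CM)).
    destruct (H eps (cond_pos eps)) as (d & Hd & Hk). exists (mkposreal d Hd). intros y Hy. change C in y.
    specialize (Hk (y - z)%C Hy). replace (z + (y - z))%C with y in Hk by ring.
    eapply Rle_trans; [|exact Hk]. right.
    change (Cmod (f y + - f z + - ((y + - z) * l))%C = Cmod (f y - f z - l * (y - z))%C). f_equal. ring.
  - intros [_ H] eps He. specialize (H z (fun P HP => HP) (mkposreal eps He)).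
    destruct (locally_norm_le_locally (V := CM) _ _ H) as (d & Hd).
    exists d. split. apply cond_pos. intros k Hk. specialize (Hd (z + k)%C).
    assert (Hb : @ball_norm C_AbsRing CM z d (z + k)%C).
    { change (Cmod (z + k + - z)%C < d). replace (z + k + - z)%C with k by ring. exact Hk. }
    specialize (Hd Hb).
    change (Cmod (f (z + k) + - f z + - ((z + k + - z) * l))%C <= eps * Cmod (z + k + - z)%C) in Hd.
    replace (z + k + - z)%C with k in Hd by ring. rewrite Cmult_comm in Hd. exact Hd.
Qed.

Lemma ccont_continuous f z : ccont f z <-> @continuous CM CM f z.
Proof.
  split; intros H.
  - apply (filterlim_locally (U := CM)). intros eps.
    destruct (H (eps/2)) as (d & Hd & Hk). generalize (cond_pos eps); lra.
    exists (mkposreal d Hd). intros y Hy. change C in y. specialize (Hk (y - z)%C Hy).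
    replace (z + (y - z))%C with y in Hk by ring.
    apply Rle_lt_trans with (eps/2). exact Hk. generalize (cond_pos eps); lra.
  - intros eps He. destruct (proj1 (filterlim_locally (U := CM) f (f z)) H (mkposreal eps He)) as (d & Hd).
    exists d. split. apply cond_pos. intros k Hk. left. apply (Hd (z + k)%C).
    change (Cmod (z + k + - z)%C < d). replace (z + k + - z)%C with k by ring. exact Hk.
Qed.

Lemma cder_eq (f : C -> C) (z l l' : C) : cder f z l -> l = l' -> cder f z l'.
Proof. intros H <-; exact H. Qed.

Lemma cder_plus (f g : C -> C) (z l m : C) : cder f z l -> cder g z m ->
  cder (fun x => f x + g x)%C z (l + m)%C.
Proof. rewrite !cder_is_derive. apply (is_derive_plus (V := CM)). Qed.

Lemma cder_mult (f g : C -> C) (z l m : C) : cder f z l -> cder g z m ->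
  cder (fun x => f x * g x)%C z (l * g z + f z * m)%C.
Proof. rewrite !cder_is_derive. intros. apply (is_derive_mult (K := C_AbsRing)); auto. apply Cmult_comm. Qed.

Lemma cder_comp (f g : C -> C) (z l m : C) : cder f z l -> cder g (f z) m ->
  cder (fun x => g (f x)) z (m * l)%C.
Proof. rewrite !cder_is_derive. intros. rewrite Cmult_comm. apply (is_derive_comp (V := CM)); assumption. Qed.

Lemma ccont_plus (f g : C -> C) (z : C) : ccont f z -> ccont g z -> ccont (fun x => f x + g x)%C z.
Proof. rewrite !ccont_continuous. exact (continuous_plus (U := CM) (V := CM) f g z). Qed.
Lemma ccont_mult (f g : C -> C) (z : C) : ccont f z -> ccont g z -> ccont (fun x => f x * g x)%C z.
Proof. rewrite !ccont_continuous. exact (continuous_mult (U := CM) (K := C_AbsRing) f g z). Qed.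
Lemma ccont_comp (f g : C -> C) (z : C) : ccont f z -> ccont g (f z) -> ccont (fun x => g (f x)) z.
Proof. rewrite !ccont_continuous. apply (continuous_comp (U := CM) (V := CM) (W := CM)). Qed.
Lemma cder_ccont (f : C -> C) (z l : C) : cder f z l -> ccont f z.
Proof. rewrite cder_is_derive, ccont_continuous. intros H. apply (ex_derive_continuous (K := C_AbsRing) (V := CM)). exists l. exact H. Qed.
Lemma cder_const (a z : C) : cder (fun _ => a) z 0%C.
Proof. apply cder_is_derive, (is_derive_const (V := CM)). Qed.
Lemma cder_id (z : C) : cder (fun z => z) z 1%C.
Proof. apply cder_is_derive, (is_derive_id (K := C_AbsRing)). Qed.

Lemma cder_ext_loc (f g : C -> C) (z l : C) (r : R) : 0 < r ->
  (forall k, Cmod k < r -> f (z + k)%C = g (z + k)%C) -> cder f z l -> cder g z l.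
Proof.
  intros Hr E H eps He. destruct (H eps He) as (d & Hd & Hk).
  exists (Rmin d r). split. apply Rmin_pos; assumption.
  intros k Hkd. assert (Cmod k < d) by (eapply Rlt_le_trans; [apply Hkd|apply Rmin_l]).
  assert (Cmod k < r) by (eapply Rlt_le_trans; [apply Hkd|apply Rmin_r]).
  rewrite <- E by assumption.
  replace (g z) with (f z). apply Hk; assumption.
  specialize (E 0%C). rewrite Cplus_0_r in E. apply E. rewrite Cmod_0; assumption.
Qed.

Lemma cder_ext (f g : C -> C) (z l : C) : (forall x, f x = g x) -> cder f z l -> cder g z l.
Proof. intros E. apply cder_ext_loc with 1. lra. intros; apply E. Qed.

Lemma cder_scal (a : C) (f : C -> C) (z l : C) : cder f z l ->
  cder (fun x => a * f x)%C z (a * l)%C.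
Proof.
  intros H. eapply cder_eq. apply cder_mult. apply cder_const. apply H. cbv beta; ring.
Qed.

Lemma cder_opp (f : C -> C) (z l : C) : cder f z l -> cder (fun x => - f x)%C z (- l)%C.
Proof.
  intros H. apply cder_ext with (fun x => (RtoC (-1)) * f x)%C. intros; cring.
  eapply cder_eq. apply cder_scal, H. cring.
Qed.

Lemma cder_minus (f g : C -> C) (z l m : C) : cder f z l -> cder g z m ->
  cder (fun x => f x - g x)%C z (l - m)%C.
Proof. intros Hf Hg. apply cder_plus. exact Hf. apply cder_opp, Hg. Qed.

Lemma cder_inv (z : C) : z <> 0%C -> cder (fun x => / x)%C z (- / (z * z))%C.
Proof.
  intros Hz eps He.
  assert (Hm : 0 < Cmod z) by (apply Cmod_gt_0; exact Hz).
  set (m := Cmod z) in *.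
  assert (Hq : 0 < eps * m^3 / 2) by (assert (0 < m^3) by (apply pow_lt; lra); nra).
  exists (Rmin (m/2) (eps * m^3 / 2)). split. apply Rmin_pos; lra.
  intros k Hk.
  assert (K1 := Rlt_le_trans _ _ _ Hk (Rmin_l _ _)).
  assert (K2 := Rlt_le_trans _ _ _ Hk (Rmin_r _ _)).
  assert (Hzk : m/2 <= Cmod (z + k)%C).
  { generalize (Cmod_triangle_inv z (- k)). replace (z - - k)%C with (z + k)%C by ring.
    rewrite Cmod_opp. fold m. lra. }
  assert (Hnz : (z + k)%C <> 0%C). { apply Cmod_gt_0. lra. }
  replace (_ - _)%C with (k * k / (z * z * (z + k)))%C by (field; auto).
  rewrite Cmod_div by (repeat apply Cmult_neq_0; assumption). rewrite !Cmod_mult. fold m.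
  assert (0 < m * m * Cmod (z+k)%C) by (repeat apply Rmult_lt_0_compat; lra).
  apply Rmult_le_reg_r with (m * m * Cmod (z+k)%C). assumption.
  unfold Rdiv. rewrite Rmult_assoc, Rinv_l by lra. rewrite Rmult_1_r.
  assert (Cmod k <= eps * (m * m * Cmod (z+k)%C)).
  { apply Rle_trans with (eps * m^3/2). lra.
    replace (eps * m^3/2) with (eps * (m*m*(m/2))) by field.
    apply Rmult_le_compat_l. lra. apply Rmult_le_compat_l. nra. exact Hzk. }
  generalize (Cmod_ge_0 k). nra.
Qed.

Lemma cder_Cexp_0 : cder Cexp 0%C 1%C.
Proof.
  intros eps He.
  (* The real and the imaginary part each cost [4 * e * Cmod k], whence the 8. As [Cmod k < e <= 1],
     the factor [1 + x] stays below 2 and the mixed term [x * y] is at most [e * Cmod k]. *)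
  set (e := Rmin 1 (eps / 8)).
  assert (He1 : 0 < e) by (apply Rmin_pos; lra).
  assert (He2 : e <= 1) by apply Rmin_l.
  assert (He3 : e <= eps/8) by apply Rmin_r. clearbody e.
  assert (D : forall f l, derivable_pt_lim f 0 l -> exists d, 0 < d /\
     forall x, Rabs x < d -> Rabs (f x - f 0 - l * x) <= e * Rabs x).
  { intros f l H. destruct (H e He1) as [d Hd]. exists d. split. apply cond_pos.
    intros x Hx. destruct (Req_dec x 0) as [->|N].
    - replace (f 0 - f 0 - l * 0) with 0 by ring. rewrite Rabs_R0. lra.
    - specialize (Hd x N Hx). rewrite Rplus_0_l in Hd.
      replace (f x - f 0 - l * x) with (((f x - f 0) / x - l) * x) by (field; exact N).
      rewrite Rabs_mult. apply Rmult_le_compat_r. apply Rabs_pos. lra. }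
  destruct (D exp 1) as (d1 & Hd1 & H1).
  { generalize (derivable_pt_lim_exp 0). rewrite exp_0. auto. }
  destruct (D cos 0) as (d2 & Hd2 & H2).
  { generalize (derivable_pt_lim_cos 0). rewrite sin_0, Ropp_0. auto. }
  destruct (D sin 1) as (d3 & Hd3 & H3).
  { generalize (derivable_pt_lim_sin 0). rewrite cos_0. auto. }
  exists (Rmin (Rmin d1 e) (Rmin d2 d3)). split. repeat apply Rmin_pos; assumption.
  intros k Hk.
  assert (K1 := Rlt_le_trans _ _ _ Hk (Rmin_l _ _)).
  assert (K2 := Rlt_le_trans _ _ _ Hk (Rmin_r _ _)).
  generalize (Rmin_l d1 e) (Rmin_r d1 e) (Rmin_l d2 d3) (Rmin_r d2 d3). intros M1 M2 M3 M4.
  assert (R1 := re_le_Cmod k). assert (I1 := im_le_Cmod k).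
  set (x := Re k) in *. set (y := Im k) in *.
  specialize (H1 x ltac:(lra)). specialize (H2 y ltac:(lra)). specialize (H3 y ltac:(lra)).
  rewrite exp_0 in H1. rewrite cos_0 in H2. rewrite sin_0 in H3.
  rewrite Cexp_0, Cplus_0_l.
  eapply Rle_trans; [apply Cmod_le_abs|].
  assert (Ec : Rabs (cos y) <= 1) by (apply Rabs_le, COS_bound).
  assert (Es : Rabs (sin y) <= 1) by (apply Rabs_le, SIN_bound).
  assert (Px := Rabs_pos x). assert (Py := Rabs_pos y). assert (Pk := Cmod_ge_0 k).
  assert (Px1 : Rabs (1 + x) <= 2).
  { eapply Rle_trans; [apply Rabs_triang|]. rewrite Rabs_R1. lra. }
  assert (B1 : Rabs (Re (Cexp k - 1 - 1 * k)%C) <= 4 * (e * Cmod k)).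
  { replace (Re (Cexp k - 1 - 1 * k)%C) with ((exp x - 1 - 1 * x) * cos y + (1 + x) * (cos y - 1 - 0 * y)).
    2: { unfold Cexp, x, y; rring. }
    eapply Rle_trans; [apply Rabs_triang|]. rewrite !Rabs_mult.
    generalize (Rabs_pos (exp x - 1 - 1 * x)) (Rabs_pos (cos y - 1 - 0 * y)). intros. nra. }
  assert (B2 : Rabs (Im (Cexp k - 1 - 1 * k)%C) <= 4 * (e * Cmod k)).
  { replace (Im (Cexp k - 1 - 1 * k)%C) with ((exp x - 1 - 1 * x) * sin y + (1 + x) * (sin y - 0 - 1 * y) + x * y).
    2: { unfold Cexp, x, y; rring. }
    eapply Rle_trans; [apply Rabs_triang|].
    eapply Rle_trans; [apply Rplus_le_compat_r, Rabs_triang|]. rewrite !Rabs_mult.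
    generalize (Rabs_pos (exp x - 1 - 1 * x)) (Rabs_pos (sin y - 0 - 1 * y)). intros. nra. }
  assert (e * Cmod k <= eps/8 * Cmod k) by (apply Rmult_le_compat_r; lra).
  lra.
Qed.

Lemma cder_Cexp (z : C) : cder Cexp z (Cexp z).
Proof.
  apply cder_ext with (fun x => Cexp z * Cexp (x - z))%C.
  { intros x. rewrite <- Cexp_plus. f_equal. ring. }
  eapply cder_eq. apply cder_scal. apply (cder_comp (fun x => x - z)%C Cexp z (1 - 0) 1)%C.
  apply cder_minus. apply cder_id. apply cder_const.
  replace (z - z)%C with (RtoC 0) by ring. apply cder_Cexp_0. ring.
Qed.

Lemma cder_conj (f : C -> C) (z l : C) : cder f (Cconj z) l ->
  cder (fun x => Cconj (f (Cconj x))) z (Cconj l).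
Proof.
  intros H eps He. destruct (H eps He) as (d & Hd & Hk). exists d; split; [exact Hd|].
  intros k Hkd. specialize (Hk (Cconj k)). rewrite Cmod_conj in Hk.
  rewrite <- Cmod_conj. eapply Rle_trans; [|apply Hk, Hkd]. right. f_equal.
  rewrite Cplus_conj.
  apply C_ext; rring.
Qed.

Lemma ccont_const (a z : C) : ccont (fun _ => a) z.
Proof. apply cder_ccont with (RtoC 0), cder_const. Qed.

Lemma ccont_id (z : C) : ccont (fun x => x) z.
Proof. apply cder_ccont with (RtoC 1), cder_id. Qed.

Lemma ccont_opp (f : C -> C) (z : C) : ccont f z -> ccont (fun x => - f x)%C z.
Proof.
  intros H. apply (ccont_comp f (fun x => - x)%C). exact H.
  apply cder_ccont with (- (1))%C. apply cder_opp, cder_id.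
Qed.

Lemma ccont_minus (f g : C -> C) (z : C) : ccont f z -> ccont g z -> ccont (fun x => f x - g x)%C z.
Proof. intros Hf Hg. apply ccont_plus. exact Hf. apply ccont_opp, Hg. Qed.

Lemma ccont_inv (f : C -> C) (z : C) : ccont f z -> f z <> 0%C -> ccont (fun x => / f x)%C z.
Proof.
  intros H Hz. apply (ccont_comp f (fun x => / x)%C). exact H.
  eapply cder_ccont. apply cder_inv, Hz.
Qed.

Lemma ccont_conj (f : C -> C) (z : C) : ccont f (Cconj z) -> ccont (fun x => Cconj (f (Cconj x))) z.
Proof.
  intros H eps He. destruct (H eps He) as (d & Hd & Hk). exists d; split; [exact Hd|].
  intros k Hkd. specialize (Hk (Cconj k)). rewrite Cmod_conj in Hk.
  rewrite <- Cmod_conj. eapply Rle_trans; [|apply Hk, Hkd]. right. f_equal.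
  rewrite Cplus_conj. apply C_ext; rring.
Qed.

Lemma cder_pow (n : nat) (z : C) : cder (fun x => x ^ n)%C z (INR n * z ^ (pred n))%C.
Proof.
  induction n as [|n IH].
  - simpl. eapply cder_eq. apply cder_const. ring.
  - apply cder_ext with (fun x => x * x ^ n)%C. reflexivity.
    eapply cder_eq. apply cder_mult. apply cder_id. apply IH.
    rewrite S_INR, RtoC_plus. destruct n as [|n]. rring.
    simpl pred. rring.
Qed.


Lemma rcder_eq (g : R -> C) s l l' : rcder g s l -> l = l' -> rcder g s l'.
Proof. intros H <-; exact H. Qed.

Lemma derivable_pt_lim_eps (f : R -> R) (x l : R) :
  (forall eps, 0 < eps -> exists d, 0 < d /\
    forall h, Rabs h < d -> Rabs (f (x + h) - f x - h * l) <= eps * Rabs h) <->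
  derivable_pt_lim f x l.
Proof.
  split.
  - intros H eps He. destruct (H (eps/2)) as (d & Hd & Hh). lra. exists (mkposreal d Hd).
    intros h Hn Hhd. specialize (Hh h Hhd). simpl in Hhd.
    replace ((f (x+h) - f x)/h - l) with ((f (x+h) - f x - h*l)/h) by (field; exact Hn).
    unfold Rdiv. rewrite Rabs_mult, Rabs_inv.
    assert (0 < Rabs h) by (apply Rabs_pos_lt, Hn).
    apply Rmult_lt_reg_r with (Rabs h). assumption. rewrite Rmult_assoc, Rinv_l by lra. nra.
  - intros H eps He. destruct (H eps He) as [d Hd]. exists d. split. apply cond_pos.
    intros h Hh. destruct (Req_dec h 0) as [->|N].
    + rewrite Rplus_0_r. replace (f x - f x - 0 * l) with 0 by ring. rewrite Rabs_R0. lra.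
    + specialize (Hd h N Hh).
      replace (f (x+h) - f x - h * l) with (((f (x+h) - f x) / h - l) * h) by (field; exact N).
      rewrite Rabs_mult. apply Rmult_le_compat_r. apply Rabs_pos. lra.
Qed.

Lemma rcder_pair (g : R -> C) (s : R) (d1 d2 : R) :
  is_derive (fun s => Re (g s)) s d1 -> is_derive (fun s => Im (g s)) s d2 ->
  rcder g s (d1, d2).
Proof.
  intros H1%is_derive_Reals H2%is_derive_Reals eps He.
  rewrite <- derivable_pt_lim_eps in H1, H2.
  destruct (H1 (eps/2)) as (e1 & He1 & K1); [lra|].
  destruct (H2 (eps/2)) as (e2 & He2 & K2); [lra|].
  exists (Rmin e1 e2). split. apply Rmin_pos; assumption.
  intros h Hh. specialize (K1 h (Rlt_le_trans _ _ _ Hh (Rmin_l _ _))).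
  specialize (K2 h (Rlt_le_trans _ _ _ Hh (Rmin_r _ _))).
  eapply Rle_trans; [apply Cmod_le_abs|].
  replace (Re (g (s + h)%R - g s - h * (d1, d2))%C) with (Re (g (s+h)%R) - Re (g s) - h * d1) by (rring).
  replace (Im (g (s + h)%R - g s - h * (d1, d2))%C) with (Im (g (s+h)%R) - Im (g s) - h * d2) by (rring).
  lra.
Qed.

Lemma rcder_Re (g : R -> C) (s : R) (l : C) : rcder g s l -> is_derive (fun s => Re (g s)) s (Re l).
Proof.
  intros H. apply is_derive_Reals, derivable_pt_lim_eps. intros eps He.
  destruct (H eps He) as (d & Hd & Hk). exists d; split; [exact Hd|].
  intros h Hh. eapply Rle_trans; [|apply Hk, Hh]. eapply Rle_trans; [|apply re_le_Cmod].
  right. f_equal. rring.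
Qed.

Lemma rcder_Im (g : R -> C) (s : R) (l : C) : rcder g s l -> is_derive (fun s => Im (g s)) s (Im l).
Proof.
  intros H. apply is_derive_Reals, derivable_pt_lim_eps. intros eps He.
  destruct (H eps He) as (d & Hd & Hk). exists d; split; [exact Hd|].
  intros h Hh. eapply Rle_trans; [|apply Hk, Hh]. eapply Rle_trans; [|apply im_le_Cmod].
  right. f_equal. rring.
Qed.

Lemma rcder_comp (f : C -> C) (g : R -> C) (s : R) (l m : C) :
  rcder g s m -> cder f (g s) l -> rcder (fun s => f (g s)) s (l * m)%C.
Proof.
  intros Hg Hf eps He.
  destruct (small_quot (eps/2) (Cmod l)) as [A1 B1]; [lra|apply Cmod_ge_0|].
  destruct (small_quot (eps/2) (Cmod m + 1)) as [A2 B2]; [lra|generalize (Cmod_ge_0 m); lra|].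
  destruct (Hf _ A2) as (d1 & Hd1 & H1).
  destruct (Hg _ A1) as (d2 & Hd2 & H2).
  destruct (Hg 1) as (d3 & Hd3 & H3); [lra|].
  set (q1 := eps / 2 / (Cmod l + 1)) in *.
  set (q2 := eps / 2 / (Cmod m + 1 + 1)) in *.
  assert (Pm := Cmod_ge_0 m).
  assert (Hq : 0 < d1 / (Cmod m + 1)) by (apply Rdiv_lt_0_compat; lra).
  exists (Rmin d2 (Rmin d3 (d1 / (Cmod m + 1)))). split. repeat apply Rmin_pos; assumption.
  intros h Hh.
  assert (K2 := Rlt_le_trans _ _ _ Hh (Rmin_r _ _)).
  specialize (H2 h (Rlt_le_trans _ _ _ Hh (Rmin_l _ _))).
  specialize (H3 h (Rlt_le_trans _ _ _ K2 (Rmin_l _ _))).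
  assert (K3 := Rlt_le_trans _ _ _ K2 (Rmin_r _ _)).
  assert (H4 : Cmod (g (s+h)%R - g s)%C <= (Cmod m + 1) * Rabs h).
  { replace (g (s+h)%R - g s)%C with ((g (s+h)%R - g s - h * m) + h * m)%C by ring.
    eapply Rle_trans; [apply Cmod_triangle|]. rewrite Cmod_mult, Cmod_R. lra. }
  assert (H5 : (Cmod m + 1) * Rabs h < d1).
  { apply Rmult_lt_compat_l with (r := Cmod m + 1) in K3; [|lra].
    replace ((Cmod m + 1) * (d1 / (Cmod m + 1))) with d1 in K3 by (field; lra). exact K3. }
  specialize (H1 (g (s+h)%R - g s)%C ltac:(lra)).
  replace (g s + (g (s+h)%R - g s))%C with (g (s+h)%R) in H1 by ring.
  replace (_ - _)%C with ((f (g (s+h)%R) - f (g s) - l * (g (s+h)%R - g s)) + l * (g (s+h)%R - g s - h * m))%C by ring.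
  eapply Rle_trans; [apply Cmod_triangle|]. rewrite Cmod_mult.
  assert (Ph := Rabs_pos h). assert (Pl := Cmod_ge_0 l).
  assert (Cmod l * Cmod (g (s + h)%R - g s - h * m)%C <= eps/2 * Rabs h).
  { eapply Rle_trans. apply Rmult_le_compat_l. exact Pl. apply H2. nra. }
  assert (q2 * Cmod (g (s + h)%R - g s)%C <= eps/2 * Rabs h).
  { eapply Rle_trans. apply Rmult_le_compat_l. lra. apply H4. nra. }
  lra.
Qed.

Lemma rcder_line (z k : C) (s : R) : rcder (fun s => z + s * k)%C s k.
Proof.
  intros eps He. exists 1. split. lra. intros h _.
  replace (_ - _)%C with (RtoC 0). rewrite Cmod_0. generalize (Rabs_pos h); nra.
  rewrite RtoC_plus. ring.
Qed.

Lemma C_eq_small (a : C) : (forall eps, 0 < eps -> Cmod a <= eps) -> a = 0%C.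
Proof.
  intros H. apply Cmod_eq_0. apply Rle_antisym; [|apply Cmod_ge_0].
  apply le_epsilon. intros e He. rewrite Rplus_0_l. apply H, He.
Qed.

(** Take for [c] the conjugate phase of [a]. This is the passage from real tools (mean value
    theorem, Riemann integral, real series) to bounds on complex moduli. *)
Lemma Cmod_le_Re (a : C) (M : R) : 0 <= M ->
  (forall c, Cmod c = 1 -> Re (c * a)%C <= M) -> Cmod a <= M.
Proof.
  intros HM H. destruct (Req_dec (Cmod a) 0) as [->|N]. exact HM.
  assert (0 < Cmod a) by (generalize (Cmod_ge_0 a); lra).
  assert (Na : RtoC (Cmod a) <> 0%C). { intros E. apply RtoC_inj in E. lra. }
  specialize (H (Cconj a / Cmod a)%C).
  replace (Cconj a / Cmod a * a)%C with (RtoC (Cmod a)) in H.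
  - apply H. rewrite Cmod_div, Cmod_conj, Cmod_R, Rabs_pos_eq by (assumption || lra). field; lra.
  - replace (Cconj a / Cmod a * a)%C with ((a * Cconj a) / Cmod a)%C by (field; exact Na).
    rewrite <- Cmod2_conj. rewrite RtoC_pow. field. exact Na.
Qed.

Lemma MVT_derive (f f' : R -> R) (a b : R) : a <= b -> (forall x, a <= x <= b -> is_derive f x (f' x)) ->
  exists x, a <= x <= b /\ f b - f a = f' x * (b - a).
Proof.
  intros Hab H. destruct (MVT_gen f a b f') as (x & Hx & E); rewrite ?Rmin_left, ?Rmax_right in * by exact Hab.
  - intros x Hx. apply H. lra.
  - intros x Hx. apply derivable_continuous_pt. eexists. apply is_derive_Reals, H, Hx.
  - exists x. auto.
Qed.

(** The mean value theorem fails for complex values, but it holds for [Re (c * f)] along the segment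
    for each unimodular [c]. *)
Lemma mean_value_ineq (f f' : C -> C) (a b : C) (M : R) : 0 <= M ->
  (forall t, 0 <= t <= 1 -> cder f (a + t * (b - a))%C (f' (a + t * (b - a))%C)) ->
  (forall t, 0 <= t <= 1 -> Cmod (f' (a + t * (b - a))%C)%C <= M) ->
  Cmod (f b - f a)%C <= M * Cmod (b - a)%C.
Proof.
  intros HM Hd Hb. apply Cmod_le_Re. apply Rmult_le_pos; [exact HM|apply Cmod_ge_0].
  intros c Hc.
  destruct (MVT_derive (fun s => Re (c * f (a + s * (b - a)))%C)
     (fun t => Re ((c * f' (a + t * (b - a))) * (b - a))%C) 0 1 Rle_0_1) as (x & Hx & E).
  - intros x Hx. apply (rcder_Re (fun s => c * f (a + s * (b - a)))%C).
    apply (rcder_comp (fun z => c * f z)%C). apply rcder_line. apply cder_scal, Hd, Hx.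
  - replace (a + 1 * (b - a))%C with b in E by ring.
    replace (a + 0 * (b - a))%C with a in E by ring.
    replace (Re (c * (f b - f a))%C) with (Re (c * f b)%C - Re (c * f a)%C) by (rring).
    rewrite E. rewrite Rminus_0_r, Rmult_1_r. eapply Rle_trans; [apply Re_le_Cmod|].
    rewrite !Cmod_mult, Hc. rewrite Rmult_1_l. apply Rmult_le_compat_r. apply Cmod_ge_0. apply Hb, Hx.
Qed.

(** Continuity of the derivative is built in because circle means are differentiated under the
    integral sign. [D] is an arbitrary set, but at its points the derivative is taken in a full
    neighbourhood. *)
Definition holo (D : C -> Prop) (f : C -> C) : Prop :=
  exists f', forall z, D z -> cder f z (f' z) /\ ccont f' z.

Lemma holo_const D a : holo D (fun _ => a).
Proof. exists (fun _ => 0%C). intros z _. split. apply cder_const. apply ccont_const. Qed.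

Lemma holo_id D : holo D (fun z => z).
Proof. exists (fun _ => 1%C). intros z _. split. apply cder_id. apply ccont_const. Qed.

Lemma holo_plus D f g : holo D f -> holo D g -> holo D (fun z => f z + g z)%C.
Proof.
  intros (f' & Hf) (g' & Hg). exists (fun z => f' z + g' z)%C. intros z Hz.
  destruct (Hf z Hz), (Hg z Hz). split. apply cder_plus; assumption. apply ccont_plus; assumption.
Qed.

Lemma holo_mult D f g : holo D f -> holo D g -> holo D (fun z => f z * g z)%C.
Proof.
  intros (f' & Hf) (g' & Hg). exists (fun z => f' z * g z + f z * g' z)%C. intros z Hz.
  destruct (Hf z Hz) as [F1 F2], (Hg z Hz) as [G1 G2]. split. apply cder_mult; assumption.
  apply ccont_plus; apply ccont_mult; try assumption; eapply cder_ccont; eassumption.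
Qed.

Lemma holo_comp D E f g : holo D f -> holo E g -> (forall z, D z -> E (f z)) -> holo D (fun z => g (f z)).
Proof.
  intros (f' & Hf) (g' & Hg) HD. exists (fun z => g' (f z) * f' z)%C. intros z Hz.
  destruct (Hf z Hz) as [F1 F2], (Hg (f z) (HD z Hz)) as [G1 G2]. split. apply cder_comp; assumption.
  apply ccont_mult. apply ccont_comp. eapply cder_ccont, F1. exact G2. exact F2.
Qed.

Lemma holo_ext D f g : (forall z, f z = g z) -> holo D f -> holo D g.
Proof.
  intros E (f' & Hf). exists f'. intros z Hz. destruct (Hf z Hz) as [F1 F2]. split. 2: exact F2.
  exact (cder_ext _ _ _ _ E F1).
Qed.

Lemma holo_minus D f g : holo D f -> holo D g -> holo D (fun z => f z - g z)%C.
Proof.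
  intros Hf Hg. apply holo_ext with (fun z => f z + (-1)%R * g z)%C. intros; cring.
  apply holo_plus. exact Hf. apply holo_mult. apply holo_const. exact Hg.
Qed.

Lemma holo_inv D f : holo D f -> (forall z, D z -> f z <> RtoC 0) -> holo D (fun z => / f z)%C.
Proof.
  intros Hf Hz. apply (holo_comp D (fun z => z <> RtoC 0) f (fun z => / z)%C); [exact Hf| |exact Hz].
  exists (fun z => - / (z * z))%C. intros z Nz. split. apply cder_inv, Nz.
  apply ccont_opp, ccont_inv. apply ccont_mult; apply ccont_id. apply Cmult_neq_0; exact Nz.
Qed.

Lemma holo_conj (D : C -> Prop) f : (forall z, D z -> D (Cconj z)) -> holo D f -> holo D (fun z => Cconj (f (Cconj z))).
Proof.
  intros HD (f' & Hf). exists (fun z => Cconj (f' (Cconj z))). intros z Hz.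
  destruct (Hf _ (HD z Hz)). split. apply cder_conj; assumption. apply ccont_conj; assumption.
Qed.

Lemma holo_Cexp D f : holo D f -> holo D (fun z => Cexp (f z)).
Proof.
  intros Hf. apply (holo_comp D (fun _ => True)); [exact Hf| |auto].
  exists Cexp. intros z _. split. apply cder_Cexp. eapply cder_ccont, cder_Cexp.
Qed.

Lemma holo_pow D n : holo D (fun z => z ^ n)%C.
Proof.
  exists (fun z => INR n * z ^ pred n)%C. intros z _. split. apply cder_pow.
  apply ccont_mult. apply ccont_const. eapply cder_ccont, cder_pow.
Qed.

Lemma holo_sub (D E : C -> Prop) f : (forall z, D z -> E z) -> holo E f -> holo D f.
Proof. intros H (f' & Hf). exists f'. auto. Qed.

Lemma holo_ccont D f z : holo D f -> D z -> ccont f z.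
Proof. intros (f' & Hf) Hz. exact (cder_ccont _ _ _ (proj1 (Hf z Hz))). Qed.

Ltac holo := repeat first [assumption | apply holo_const | apply holo_id | apply holo_Cexp | apply holo_pow
  | apply holo_minus | apply holo_plus | apply holo_mult].

(** * Mean value property and maximum principle *)

Definition cis (t : R) : C := (cos t, sin t).

Lemma Cmod_cis (t : R) : Cmod (cis t) = 1.
Proof.
  unfold cis, Cmod; simpl.
  replace (_ * (_ * 1) + _) with (Rsqr (sin t) + Rsqr (cos t)) by (unfold Rsqr; ring).
  rewrite sin2_cos2. apply sqrt_1.
Qed.

Lemma cis_nz (t : R) : cis t <> 0%C.
Proof. apply Cmod_gt_0. rewrite Cmod_cis. lra. Qed.

Lemma cis_conj (t : R) : (cis t * Cconj (cis t))%C = 1%C.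
Proof. rewrite <- Cmod2_conj, Cmod_cis. apply C_ext; simpl; ring. Qed.

Lemma rcder_circle (z0 : C) (t th : R) : rcder (fun th => z0 + t * cis th)%C th (t * (Ci * cis th))%C.
Proof.
  eapply rcder_eq. apply rcder_pair with (d1 := - t * sin th) (d2 := t * cos th).
  - apply is_derive_ext with (fun th => Re z0 + t * cos th). intros; rring.
    auto_derive; auto. ring.
  - apply is_derive_ext with (fun th => Im z0 + t * sin th). intros; rring.
    auto_derive; auto. ring.
  - cring.
Qed.

Lemma continuity_2d_comp (f : C -> C) (g : R -> R -> C) (x y : R) :
  continuity_2d_pt (fun u v => Re (g u v)) x y -> continuity_2d_pt (fun u v => Im (g u v)) x y ->
  ccont f (g x y) ->
  continuity_2d_pt (fun u v => Re (f (g u v))) x y /\ continuity_2d_pt (fun u v => Im (f (g u v))) x y.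
Proof.
  intros H1 H2 Hf.
  assert (H : forall eps : posreal, exists d : posreal, forall u v, Rabs (u - x) < d -> Rabs (v - y) < d ->
    Cmod (f (g u v) - f (g x y))%C < eps).
  { intros eps. destruct (Hf (eps/2)) as (d & Hd & Hk). generalize (cond_pos eps); lra.
    assert (Hd2 : 0 < d/2) by lra.
    destruct (H1 (mkposreal _ Hd2)) as [d1 K1]. destruct (H2 (mkposreal _ Hd2)) as [d2 K2].
    assert (Hm : 0 < Rmin d1 d2) by (apply Rmin_pos; apply cond_pos).
    exists (mkposreal _ Hm). intros u v Hu Hv. simpl in Hu, Hv, K1, K2.
    specialize (K1 u v (Rlt_le_trans _ _ _ Hu (Rmin_l _ _)) (Rlt_le_trans _ _ _ Hv (Rmin_l _ _))).
    specialize (K2 u v (Rlt_le_trans _ _ _ Hu (Rmin_r _ _)) (Rlt_le_trans _ _ _ Hv (Rmin_r _ _))).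
    specialize (Hk (g u v - g x y)%C).
    replace (g x y + (g u v - g x y))%C with (g u v) in Hk by ring.
    apply Rle_lt_trans with (eps/2). 2: generalize (cond_pos eps); lra.
    apply Hk. eapply Rle_lt_trans; [apply Cmod_le_abs|].
    replace (Re (g u v - g x y)%C) with (Re (g u v) - Re (g x y)) by rring.
    replace (Im (g u v - g x y)%C) with (Im (g u v) - Im (g x y)) by rring.
    lra. }
  split; intros eps; destruct (H eps) as [d Hd]; exists d; intros u v Hu Hv.
  - eapply Rle_lt_trans; [|apply (Hd u v Hu Hv)]. eapply Rle_trans; [|apply re_le_Cmod].
    right; f_equal; rring.
  - eapply Rle_lt_trans; [|apply (Hd u v Hu Hv)]. eapply Rle_trans; [|apply im_le_Cmod].
    right; f_equal; rring.
Qed.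

Lemma continuity_2d_slice (g : R -> R -> R) (x y : R) :
  continuity_2d_pt g x y -> continuous (fun v => g x v) y.
Proof.
  intros H. apply continuity_pt_filterlim. intros eps He.
  destruct (H (mkposreal eps He)) as [d Hd]. exists d. split. apply cond_pos.
  intros v [_ Hv]. apply Hd. replace (x - x) with 0 by ring. rewrite Rabs_R0. apply cond_pos. exact Hv.
Qed.

Lemma continuity_2d_circle (f : C -> C) (z0 : C) (t th : R) : ccont f (z0 + t * cis th)%C ->
  continuity_2d_pt (fun u v => Re (f (z0 + u * cis v))%C) t th /\
  continuity_2d_pt (fun u v => Im (f (z0 + u * cis v))%C) t th.
Proof.
  intros H. apply (continuity_2d_comp f (fun u v => z0 + u * cis v)%C); [| |exact H].
  - apply continuity_2d_pt_ext with (fun u v => Re z0 + u * cos v). intros; rring.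
    apply continuity_2d_pt_plus. apply continuity_2d_pt_const.
    apply continuity_2d_pt_mult. apply continuity_2d_pt_id1.
    apply (continuity_1d_2d_pt_comp cos (fun _ v => v)). apply continuity_cos. apply continuity_2d_pt_id2.
  - apply continuity_2d_pt_ext with (fun u v => Im z0 + u * sin v). intros; rring.
    apply continuity_2d_pt_plus. apply continuity_2d_pt_const.
    apply continuity_2d_pt_mult. apply continuity_2d_pt_id1.
    apply (continuity_1d_2d_pt_comp sin (fun _ v => v)). apply continuity_sin. apply continuity_2d_pt_id2.
Qed.

Lemma continuity_2d_circle' (f : C -> C) (z0 : C) (t th : R) : ccont f (z0 + t * cis th)%C ->
  continuity_2d_pt (fun u v => Re (f (z0 + u * cis v) * cis v)%C) t th.
Proof.
  intros H. destruct (continuity_2d_circle f z0 t th H) as [H1 H2].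
  apply continuity_2d_pt_ext with
   (fun u v => Re (f (z0 + u * cis v)%C) * cos v - Im (f (z0 + u * cis v)%C) * sin v).
  intros; rring.
  apply continuity_2d_pt_minus; apply continuity_2d_pt_mult; try assumption.
  apply (continuity_1d_2d_pt_comp cos (fun _ v => v)). apply continuity_cos. apply continuity_2d_pt_id2.
  apply (continuity_1d_2d_pt_comp sin (fun _ v => v)). apply continuity_sin. apply continuity_2d_pt_id2.
Qed.

Lemma cont_circle (f : C -> C) (z0 : C) (t th : R) : ccont f (z0 + t * cis th)%C ->
  continuous (fun v => Re (f (z0 + t * cis v)%C)) th.
Proof.
  intros H. apply (continuity_2d_slice (fun u v => Re (f (z0 + u * cis v)%C))).
  apply continuity_2d_circle, H.
Qed.

Lemma Cmod_circle (z0 : C) (t th : R) : 0 <= t -> Cmod (z0 + t * cis th - z0)%C = t.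
Proof.
  intros Ht. replace (z0 + t * cis th - z0)%C with (t * cis th)%C by ring.
  rewrite Cmod_mult, Cmod_cis, Cmod_R, Rabs_pos_eq; lra.
Qed.

Section Mean.

Variables (f f' : C -> C) (z0 : C) (rho : R).
Hypothesis Hf : forall z, 0 < Cmod (z - z0)%C < rho -> cder f z (f' z) /\ ccont f' z.
Hypothesis H0 : ccont f z0.

Let phi (t : R) : R := RInt (fun th => Re (f (z0 + t * cis th)%C)) 0 (2 * PI).

Lemma circle_ex_RInt t : 0 < t < rho -> ex_RInt (fun th => Re (f (z0 + t * cis th)%C)) 0 (2 * PI).
Proof.
  intros Ht. apply (ex_RInt_continuous (V := R_CompleteNormedModule)). intros th _. apply cont_circle.
  eapply cder_ccont. apply Hf. rewrite Cmod_circle; lra.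
Qed.

(* By the Cauchy-Riemann equations the radial derivative of [Re f] is [1/t] times the angular
   derivative of [Im f], so its integral over the circle vanishes. *)
Lemma circle_RInt_der t : 0 < t < rho ->
  is_RInt (fun th => Re (f' (z0 + t * cis th) * cis th)%C) 0 (2 * PI) 0.
Proof.
  intros Ht.
  replace 0 with (minus (/ t * Im (f (z0 + t * cis (2 * PI))%C)) (/ t * Im (f (z0 + t * cis 0)%C))) at 2.
  2:{ unfold cis. rewrite cos_2PI, sin_2PI, cos_0, sin_0. unfold minus, plus, opp; simpl; ring. }
  apply (is_RInt_derive (fun th => / t * Im (f (z0 + t * cis th)%C))).
  - intros th _.
    replace (Re (f' (z0 + t * cis th) * cis th)%C) with
      (/ t * Im (f' (z0 + t * cis th) * (t * (Ci * cis th)))%C).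
    2:{ unfold Ci. unfold Re, Im; simpl; unfold Re, Im; field. lra. }
    apply (is_derive_scal (fun th => Im (f (z0 + t * cis th)%C)) th (/ t)).
    apply (rcder_Im (fun th => f (z0 + t * cis th)%C)).
    apply (rcder_comp f). apply rcder_circle. apply Hf. rewrite Cmod_circle; lra.
  - intros th _. apply (continuity_2d_slice (fun u v => Re (f' (z0 + u * cis v) * cis v)%C)).
    apply continuity_2d_circle'. apply Hf. rewrite Cmod_circle; lra.
Qed.

Lemma circle_der t : 0 < t < rho -> is_derive phi t 0.
Proof.
  intros Ht. unfold phi.
  assert (D : forall u v : R, 0 < u < rho ->
     is_derive (fun u : R => Re (f (z0 + u * cis v)%C)) u (Re (f' (z0 + u * cis v) * cis v)%C)).
  { intros u v Hu. apply (rcder_Re (fun u : R => f (z0 + u * cis v)%C)).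
    apply (rcder_comp f). apply rcder_line. apply Hf. rewrite Cmod_circle; lra. }
  assert (Hd : 0 < Rmin t (rho - t)) by (apply Rmin_pos; lra).
  assert (L : forall u : R, Rabs (u - t) < Rmin t (rho - t) -> 0 < u < rho).
  { intros u Hu. generalize (Rmin_l t (rho - t)) (Rmin_r t (rho - t)).
    apply Rabs_def2 in Hu. lra. }
  assert (E : RInt (fun th => Derive (fun u : R => Re (f (z0 + u * cis th)%C)) t) 0 (2 * PI) = 0).
  { apply is_RInt_unique. eapply is_RInt_ext; [|apply circle_RInt_der, Ht].
    intros th _. symmetry. apply is_derive_unique, D, Ht. }
  (* The derivative 0 is traded for the integral of the partial derivative, the form in which
     differentiation under the integral sign delivers it. *)
  refine (eq_ind _ (fun l => is_derive _ t l) _ _ E). clear E.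
  apply (is_derive_RInt_param (fun u th : R => Re (f (z0 + u * cis th)%C))).
    + exists (mkposreal _ Hd). intros u Hu th _. eexists. apply D, L, Hu.
    + intros th _. apply continuity_2d_pt_ext_loc with (fun u v : R => Re (f' (z0 + u * cis v) * cis v)%C).
      * exists (mkposreal _ Hd). intros u v Hu _. symmetry. apply is_derive_unique, D, L, Hu.
      * apply continuity_2d_circle'. apply Hf. rewrite Cmod_circle; lra.
    + exists (mkposreal _ Hd). intros u Hu. apply circle_ex_RInt, L, Hu.
Qed.

Lemma circle_const t s : 0 < t -> t <= s -> s < rho -> phi t = phi s.
Proof.
  intros H1 H2 H3. destruct (MVT_derive phi (fun _ => 0) t s H2) as (c & _ & E); [|lra].
  intros x Hx. apply circle_der; lra.
Qed.

(** The circle integral does not depend on the radius and tends to [2 * PI * Re (f z0)] as the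
    radius shrinks. The center is assumed a point of continuity only, so that difference quotients,
    completed at the center, are covered. *)
Lemma mean_value_property t : 0 < t < rho ->
  is_RInt (fun th => Re (f (z0 + t * cis th)%C)) 0 (2 * PI) (2 * PI * Re (f z0)).
Proof.
  intros Ht. assert (Hpi := PI_RGT_0).
  replace (2 * PI * Re (f z0)) with (phi t). apply (RInt_correct (V := R_CompleteNormedModule)), circle_ex_RInt, Ht.
  apply Rminus_diag_uniq. apply cond_eq. intros eps He.
  destruct (H0 (eps / (4 * PI))) as (d & Hd & Hk). apply Rdiv_lt_0_compat; lra.
  set (s := Rmin t (d/2)).
  assert (Hs : 0 < s) by (apply Rmin_pos; lra).
  assert (Hst : s <= t) by apply Rmin_l. assert (Hsd : s <= d/2) by apply Rmin_r.
  rewrite <- (circle_const s t) by lra.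
  assert (E : phi s - 2 * PI * Re (f z0) = RInt (fun th => Re (f (z0 + s * cis th)%C) - Re (f z0)) 0 (2 * PI)).
  { symmetry. apply (is_RInt_unique (V := R_CompleteNormedModule)). apply (is_RInt_minus (V := R_NormedModule)).
    apply (RInt_correct (V := R_CompleteNormedModule)), circle_ex_RInt; lra.
    replace (2 * PI * Re (f z0)) with (scal (2 * PI - 0) (Re (f z0))).
    apply (is_RInt_const (V := R_NormedModule)). unfold scal; simpl; unfold mult; simpl; ring. }
  rewrite E, Rminus_0_r.
  apply Rle_lt_trans with ((2 * PI - 0) * (eps / (4 * PI))).
  2:{ replace ((2 * PI - 0) * (eps / (4 * PI))) with (eps/2) by (field; lra). lra. }
  apply abs_RInt_le_const. lra.
  - apply (ex_RInt_minus (V := R_NormedModule)). apply circle_ex_RInt; lra. apply ex_RInt_const.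
  - intros th _. replace (Re (f (z0 + s * cis th)%C) - Re (f z0)) with (Re (f (z0 + s * cis th) - f z0)%C) by rring.
    eapply Rle_trans; [apply re_le_Cmod|]. apply Hk.
    rewrite Cmod_mult, Cmod_cis, Cmod_R, Rabs_pos_eq; lra.
Qed.

End Mean.

Lemma mean_value (f : C -> C) (z0 : C) (rho t : R) : holo (fun z => 0 < Cmod (z - z0)%C < rho) f -> ccont f z0 ->
  0 < t < rho -> is_RInt (fun th => Re (f (z0 + t * cis th)%C)) 0 (2 * PI) (2 * PI * Re (f z0)).
Proof. intros (f' & Hf) H0 Ht. exact (mean_value_property f f' z0 rho Hf H0 t Ht). Qed.

Lemma is_RInt_le_const (g : R -> R) (I M : R) : is_RInt g 0 (2 * PI) I ->
  (forall th, g th <= M) -> I <= 2 * PI * M.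
Proof.
  intros H Hg. assert (Hpi := PI_RGT_0).
  apply (is_RInt_le g (fun _ => M) 0 (2 * PI)). lra. exact H.
  replace (2 * PI * M) with (scal (2 * PI - 0) M). apply (is_RInt_const (V := R_NormedModule)).
  unfold scal; simpl; unfold mult; simpl; ring.
  intros; apply Hg.
Qed.

(** On the circle [A - Re f] is nonnegative, and so is the kernel [1 + kap], where [kap] is the
    cosine of the angle between the point and the direction [c]. The mean of their product contains
    [Re (c * f' z0)] as a first Fourier coefficient. *)
Lemma borel_caratheodory (f f' : C -> C) (z0 : C) (rho A : R) : 0 < rho ->
  (forall z, Cmod (z - z0)%C < rho -> cder f z (f' z) /\ ccont f' z) ->
  (forall z, Cmod (z - z0)%C < rho -> Re (f z) <= A) ->
  Cmod (f' z0) <= 2 * (A - Re (f z0)) / rho.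
Proof.
  intros Hrho Hf HA. assert (Hpi := PI_RGT_0).
  assert (Hz0 : Cmod (z0 - z0)%C < rho). { replace (z0 - z0)%C with (RtoC 0) by ring. rewrite Cmod_0; exact Hrho. }
  assert (HB : Re (f z0) <= A) by (apply HA, Hz0).
  apply Cmod_le_Re.
  { apply Rmult_le_pos. lra. left; apply Rinv_0_lt_compat, Hrho. }
  intros c Hc.
  (* The mean value property needs radii below [rho]. If the bound failed at [rho], it would already
     fail at the midpoint of [b / x] and [rho]. *)
  assert (Key : forall t, 0 < t < rho -> t * Re (c * f' z0)%C <= 2 * (A - Re (f z0))).
  2:{ apply Rmult_le_reg_r with rho. exact Hrho.
      replace (2 * (A - Re (f z0)) / rho * rho) with (2 * (A - Re (f z0))) by (field; lra).
      apply Rnot_lt_le. intros Hlt. set (x := Re (c * f' z0)%C) in *.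
      assert (0 < x). { apply Rnot_le_lt. intros Hx. nra. }
      set (b := 2 * (A - Re (f z0))) in *.
      assert (Hb : b / x < rho). { apply Rmult_lt_reg_r with x. assumption. unfold Rdiv.
        rewrite Rmult_assoc, Rinv_l by lra. lra. }
      assert (Hb0 : 0 <= b / x). { apply Rmult_le_pos. unfold b; lra. left; apply Rinv_0_lt_compat; assumption. }
      specialize (Key ((b/x + rho) / 2) ltac:(lra)).
      assert (b = b / x * x) by (field; lra). nra. }
  intros t Ht.
  assert (HdF : forall z, 0 < Cmod (z - z0)%C < rho -> z <> z0 /\ (z - z0)%C <> 0%C).
  { intros z Hz. split. intros ->. replace (z0 - z0)%C with (RtoC 0) in Hz by ring. rewrite Cmod_0 in Hz. lra.
    apply Cmod_gt_0, Hz. }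
  set (U := fun z => 0 < Cmod (z - z0)%C < rho).
  assert (HfU : holo U f) by (exists f'; intros z Hz; apply Hf, Hz).
  assert (Cf : ccont f z0) by exact (cder_ccont _ _ _ (proj1 (Hf z0 Hz0))).
  assert (Cid : ccont (fun z => z - z0)%C z0) by (apply ccont_minus; [apply ccont_id|apply ccont_const]).
  assert (M1 : is_RInt (fun th => Re (c * ((f (z0 + t * cis th) - f z0) / (z0 + t * cis th - z0)))%C) 0 (2 * PI)
     (2 * PI * Re (c * f' z0)%C)).
  (* The difference quotient completed by the derivative: holomorphic off [z0], and continuous at
     [z0] by the very definition of the derivative. *)
  { set (F := fun z : C => if excluded_middle_informative (z = z0) then (c * f' z0)%C
                           else (c * ((f z - f z0) / (z - z0)))%C).
    assert (E : forall z, z <> z0 -> F z = (c * ((f z - f z0) / (z - z0)))%C).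
    { intros z Hz. unfold F. destruct (excluded_middle_informative (z = z0)); [contradiction|reflexivity]. }
    assert (E0 : F z0 = (c * f' z0)%C).
    { unfold F. destruct (excluded_middle_informative (z0 = z0)); [reflexivity|contradiction]. }
    rewrite <- E0.
    apply (is_RInt_ext (fun th => Re (F (z0 + t * cis th)%C))).
    { intros th _. rewrite E. reflexivity. apply HdF. rewrite Cmod_circle; lra. }
    apply (mean_value F z0 rho); [| |exact Ht].
    - assert (HQ : holo U (fun z => c * ((f z - f z0) * / (z - z0)))%C).
      { holo. apply holo_inv. holo. intros z Hz. apply HdF, Hz. }
      destruct HQ as (F' & HF'). exists F'. intros z Hz. split; [|apply HF', Hz].
      apply (cder_ext_loc (fun z => c * ((f z - f z0) * / (z - z0)))%C _ _ _ (Cmod (z - z0)%C)); [apply Hz| |apply HF', Hz].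
      intros k Hk. symmetry. apply E. intros E1.
      assert (k = (- (z - z0))%C) by (rewrite <- E1; ring). subst k. rewrite Cmod_opp in Hk. lra.
    - intros eps He. destruct (proj1 (Hf z0 Hz0) eps He) as (d & Hd & Hk).
      exists d. split. exact Hd. intros k Hkd. specialize (Hk k Hkd).
      rewrite E0. destruct (Ceq_dec k 0%C) as [->|Nk].
      + rewrite Cplus_0_r, E0. replace (_ - _)%C with (RtoC 0) by ring. rewrite Cmod_0; lra.
      + rewrite E. 2:{ intros E1. apply Nk. replace k with (z0 + k - z0)%C by ring. rewrite E1. ring. }
        replace (_ - _)%C with (c * ((f (z0 + k) - f z0 - f' z0 * k) / k))%C.
        2:{ replace (z0 + k - z0)%C with k by ring. field. exact Nk. }
        rewrite Cmod_mult, Hc, Cmod_div by exact Nk.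
        assert (0 < Cmod k) by (apply Cmod_gt_0; exact Nk).
        apply Rmult_le_reg_r with (Cmod k). assumption.
        replace (1 * (Cmod (f (z0 + k) - f z0 - f' z0 * k)%C / Cmod k) * Cmod k)
          with (Cmod (f (z0 + k) - f z0 - f' z0 * k)%C) by (field; lra). exact Hk. }
  assert (M2 := mean_value (fun z => Cconj c * ((z - z0) * (f z - f z0)))%C z0 rho t ltac:(fold U; holo)
    ltac:(apply ccont_mult; [apply ccont_const|apply ccont_mult; [exact Cid|apply ccont_minus; [exact Cf|apply ccont_const]]]) Ht).
  assert (M3 := mean_value (fun z => Cconj c * (z - z0))%C z0 rho t ltac:(holo)
    ltac:(apply ccont_mult; [apply ccont_const|exact Cid]) Ht).
  assert (M4 := mean_value f z0 rho t HfU Cf Ht). cbv beta in M2, M3.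
  set (B := A - Re (f z0)) in *.
  (* On the circle the first two terms add up to [2 * kap * (Re w - Re (f z0))], so that [G] equals
     [2 * kap * (Re w - A) + 2 * Re w], which is at most [2 * A] because [kap >= -1]. The second and
     third terms have mean zero. *)
  set (G := fun th => t * Re (c * ((f (z0 + t * cis th) - f z0) / (z0 + t * cis th - z0)))%C
    + / t * Re (Cconj c * ((z0 + t * cis th - z0) * (f (z0 + t * cis th) - f z0)))%C
    - 2 * B / t * Re (Cconj c * (z0 + t * cis th - z0))%C + 2 * Re (f (z0 + t * cis th)%C)).
  assert (HG : is_RInt G 0 (2 * PI) (t * (2 * PI * Re (c * f' z0)%C) +
     / t * (2 * PI * Re (Cconj c * ((z0 - z0) * (f z0 - f z0)))%C)
     - 2 * B / t * (2 * PI * Re (Cconj c * (z0 - z0))%C) + 2 * (2 * PI * Re (f z0)))).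
  { unfold G.
    apply (is_RInt_plus (V := R_NormedModule)).
    apply (is_RInt_minus (V := R_NormedModule)).
    apply (is_RInt_plus (V := R_NormedModule)).
    apply (is_RInt_scal (V := R_NormedModule)). exact M1.
    apply (is_RInt_scal (V := R_NormedModule)). exact M2.
    apply (is_RInt_scal (V := R_NormedModule)). exact M3.
    apply (is_RInt_scal (V := R_NormedModule)). exact M4. }
  assert (HGle : forall th, G th <= 2 * B + 2 * Re (f z0)).
  { intros th. unfold G.
    replace (z0 + t * cis th - z0)%C with (t * cis th)%C by ring.
    set (w := f (z0 + t * cis th)%C).
    assert (Hw : Re w <= A). { apply HA. rewrite Cmod_circle; lra. }
    set (kap := Re (c * Cconj (cis th))%C).
    assert (Hkap : Rabs kap <= 1).
    { eapply Rle_trans; [apply re_le_Cmod|]. rewrite Cmod_mult, Cmod_conj, Cmod_cis, Hc. lra. }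
    apply Rabs_def2b in Hkap || apply Rabs_le_between in Hkap.
    assert (E1 : t * Re (c * ((w - f z0) / (t * cis th)))%C = Re (c * Cconj (cis th) * (w - f z0))%C).
    { rewrite <- re_scal_l. f_equal.
      replace (t * (c * ((w - f z0) / (t * cis th))))%C with (c * (w - f z0) / cis th)%C.
      2:{ field. split. apply cis_nz. intros E. apply RtoC_inj in E. lra. }
      replace (/ cis th)%C with (Cconj (cis th)).
      2:{ rewrite <- (Cmult_1_l (/ cis th)%C), <- (cis_conj th). field. apply cis_nz. }
      unfold Cdiv.
      replace (/ cis th)%C with (Cconj (cis th)).
      2:{ rewrite <- (Cmult_1_l (/ cis th)%C), <- (cis_conj th). field. apply cis_nz. }
      ring. }
    rewrite E1.
    replace (/ t * Re (Cconj c * (t * cis th * (w - f z0)))%C) with (Re (Cconj c * cis th * (w - f z0))%C).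
    2:{ replace (Cconj c * (t * cis th * (w - f z0)))%C with (t * (Cconj c * cis th * (w - f z0)))%C by ring.
        rewrite re_scal_l. field. lra. }
    replace (2 * B / t * Re (Cconj c * (t * cis th))%C) with (2 * B * kap).
    2:{ replace (Cconj c * (t * cis th))%C with (t * (Cconj c * cis th))%C by ring.
        rewrite re_scal_l. unfold kap. replace (Re (Cconj c * cis th)%C) with (Re (c * Cconj (cis th))%C) by rring.
        field; lra. }
    replace (Re (c * Cconj (cis th) * (w - f z0))%C + Re (Cconj c * cis th * (w - f z0))%C)
      with (2 * kap * (Re w - Re (f z0))) by (unfold kap; rring).
    unfold B. nra. }
  assert (Fin := is_RInt_le_const _ _ _ HG HGle).
  replace (z0 - z0)%C with (RtoC 0) in Fin by ring.
  replace (Re (Cconj c * (0 * (f z0 - f z0)))%C) with 0 in Fin by rring.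
  replace (Re (Cconj c * 0)%C) with 0 in Fin by rring.
  apply Rmult_le_reg_l with (2 * PI). lra. lra.
Qed.

(** Without a maximum, each point of [D] has a ball on which [g] stays below a value taken elsewhere
    in [D], and each point outside [D] a ball missing [D]. Among the finitely many such values of a
    finite cover the largest one would be exceeded by another. Upper semicontinuity of [g] is what
    this takes. *)
Lemma extreme_value (D : C -> Prop) (g : C -> R) (Rb : R) (z1 : C) :
  D z1 -> (forall z, D z -> Cmod z <= Rb) ->
  (forall z, ~ D z -> exists d, 0 < d /\ forall k, Cmod k < d -> ~ D (z + k)%C) ->
  (forall z, D z -> forall eps, 0 < eps -> exists d, 0 < d /\
     forall k, Cmod k < d -> D (z + k)%C -> g (z + k)%C <= g z + eps) ->
  exists z0, D z0 /\ forall z, D z -> g z <= g z0.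
Proof.
  intros H1 Hb Hc Hg. apply NNPP. intros Hno.
  assert (Hex : forall z, D z -> exists z', D z' /\ g z < g z').
  { intros z Hz. apply NNPP. intros Hn. apply Hno. exists z. split. exact Hz.
    intros z' Hz'. apply Rnot_lt_le. intros Hlt. apply Hn. exists z'. auto. }
  assert (Hloc : forall t : C, exists p : C * R, 0 < snd p /\
     (D t -> D (fst p) /\ forall k, Cmod k < snd p -> D (t + k)%C -> g (t + k)%C < g (fst p)) /\
     (~ D t -> forall k, Cmod k < snd p -> ~ D (t + k)%C)).
  { intros t. destruct (classic (D t)) as [Ht|Ht].
    - destruct (Hex t Ht) as (z' & Hz' & Hlt).
      destruct (Hg t Ht ((g z' - g t)/2)) as (d & Hd & Hk). lra.
      exists (z', d). simpl. split. exact Hd. split. 2: intros N; contradiction.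
      intros _. split. exact Hz'. intros k Hkd HD. specialize (Hk k Hkd HD). lra.
    - destruct (Hc t Ht) as (d & Hd & Hk). exists (t, d). simpl. split. exact Hd. split. intros N; contradiction.
      intros _. exact Hk. }
  set (w := fun t => proj1_sig (constructive_indefinite_description _ (Hloc t))).
  assert (Hw : forall t : C, 0 < snd (w t) /\
     (D t -> D (fst (w t)) /\ forall k, Cmod k < snd (w t) -> D (t + k)%C -> g (t + k)%C < g (fst (w t))) /\
     (~ D t -> forall k, Cmod k < snd (w t) -> ~ D (t + k)%C)).
  { intros t. unfold w. exact (proj2_sig (constructive_indefinite_description _ (Hloc t))). }
  set (toC := fun t : Compactness.Tn 2 R => let '(x, (y, _)) := t in (x, y) : C).
  (* The compactness lemma works with squares; half the radius in each coordinate keeps the modulus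
     below the radius. *)
  assert (Hpos : forall t, 0 < snd (w (toC t)) / 2) by (intros t; generalize (proj1 (Hw (toC t))); lra).
  apply (compactness_list 2 (- Rb, (- Rb, tt)) (Rb, (Rb, tt)) (fun t => mkposreal _ (Hpos t))).
  intros (l & Hl).
  assert (Cover : forall z, D z -> exists t, In t l /\ Cmod (z - toC t)%C < snd (w (toC t))).
  { intros z Hz. assert (Hzb := Hb z Hz).
    generalize (re_le_Cmod z) (im_le_Cmod z). intros A1 A2.
    destruct (Hl (Re z, (Im z, tt))) as (t & Ht & _ & Hcl).
    { simpl. apply Rabs_le_between in A1. apply Rabs_le_between in A2. repeat split; try lra. }
    exists t. split. exact Ht. destruct t as (x & (y & [])). simpl in Hcl |- *.
    destruct Hcl as (B1 & B2 & _). unfold Re, Im in B1, B2.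
    eapply Rle_lt_trans; [apply Cmod_le_abs|]. unfold Re, Im. simpl in *. unfold Rminus in B1, B2. lra. }
  assert (HmaxL : forall l, (exists t, In t l /\ D (toC t)) -> exists t, In t l /\ D (toC t) /\
     forall t', In t' l -> D (toC t') -> g (fst (w (toC t'))) <= g (fst (w (toC t)))).
  { clear. induction l as [|a l IH]; intros (t & Ht & HD). destruct Ht.
    destruct (classic (exists t, In t l /\ D (toC t))) as [Hl|Hl].
    - destruct (IH Hl) as (t0 & I0 & D0 & M0).
      destruct (classic (D (toC a))) as [Ha|Ha].
      + destruct (Rle_dec (g (fst (w (toC a)))) (g (fst (w (toC t0))))) as [L|L].
        * exists t0. repeat split. right; exact I0. exact D0.
          intros t' [<-|It'] D'. exact L. apply M0; assumption.
        * exists a. repeat split. left; reflexivity. exact Ha.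
          intros t' [<-|It'] D'. lra. specialize (M0 t' It' D'). lra.
      + exists t0. repeat split. right; exact I0. exact D0.
        intros t' [<-|It'] D'. contradiction. apply M0; assumption.
    - assert (t = a) as -> . { destruct Ht as [->|Ht]. reflexivity. elim Hl. exists t; auto. }
      exists a. repeat split. left; reflexivity. exact HD.
      intros t' [<-|It'] D'. lra. elim Hl. exists t'; auto. }
  assert (InD : forall z t, D z -> Cmod (z - toC t)%C < snd (w (toC t)) -> D (toC t)).
  { intros z t Hz Hd. apply NNPP. intros N. apply (proj2 (proj2 (Hw (toC t))) N _ Hd).
    replace (toC t + (z - toC t))%C with z by ring. exact Hz. }
  destruct (Cover z1 H1) as (t1 & It1 & Hd1).
  destruct (HmaxL l) as (t0 & It0 & D0 & M0). { exists t1. split. exact It1. apply (InD z1); assumption. }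
  destruct (Hw (toC t0)) as (_ & Hw1 & _). destruct (Hw1 D0) as [Dw _].
  destruct (Cover _ Dw) as (t & It & Hd).
  assert (Dt := InD _ _ Dw Hd).
  specialize (M0 t It Dt). destruct (Hw (toC t)) as (_ & Hw2 & _). destruct (Hw2 Dt) as [_ Hlt].
  specialize (Hlt _ Hd). replace (toC t + (fst (w (toC t0)) - toC t))%C with (fst (w (toC t0))) in Hlt by ring.
  specialize (Hlt Dw). lra.
Qed.

(** The perturbation [e * Cmod z ^ 2] makes the squared modulus strictly subharmonic, so that its
    maximum cannot sit at an interior point. This works on any compact [D], with no connectedness
    involved. *)
Lemma max_principle (D : C -> Prop) (f : C -> C) (M Rb : R) : 0 <= M ->
  (forall z, D z -> Cmod z <= Rb) ->
  (forall z, ~ D z -> exists d, 0 < d /\ forall k, Cmod k < d -> ~ D (z + k)%C) ->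
  (forall z, D z -> ccont f z) ->
  (forall z, D z -> Cmod (f z) <= M \/ exists d, 0 < d /\ (forall k, Cmod k < d -> D (z + k)%C) /\
     holo (fun y => Cmod (y - z)%C < d) f) ->
  forall z, D z -> Cmod (f z) <= M.
Proof.
  intros HM Hb Hc Hf Hd z1 H1. apply Rnot_lt_le. intros Hlt. assert (Hpi := PI_RGT_0).
  (* Small enough that the perturbation, at most [e * Rb ^ 2], cannot lift a point with
     [Cmod (f z) <= M] above [z1]. *)
  set (e := (Cmod (f z1) ^ 2 - M ^ 2) / (2 * (Rb ^ 2 + 1))).
  assert (Hd0 : 0 < Cmod (f z1) ^ 2 - M ^ 2) by nra.
  assert (Hr0 : 0 <= Rb ^ 2) by apply pow2_ge_0.
  assert (He : 0 < e) by (apply Rdiv_lt_0_compat; lra).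
  assert (HeR : e * Rb ^ 2 < Cmod (f z1) ^ 2 - M ^ 2).
  { assert (e * (2 * (Rb ^ 2 + 1)) = Cmod (f z1) ^ 2 - M ^ 2) by (unfold e; field; lra). nra. }
  set (g := fun z => Cmod (f z) ^ 2 + e * Cmod z ^ 2).
  destruct (extreme_value D g Rb z1 H1 Hb Hc) as (z0 & D0 & Hmax).
  { intros z Hz eps Heps.
    assert (Sq : forall a b x : R, 0 <= a -> 0 <= b -> 0 <= x <= 1 -> a - b <= x -> a ^ 2 <= b ^ 2 + x * (2 * b + 1)).
    { intros a b x Ha Hb' Hx Hab. assert (a <= b + x) by lra. assert (a^2 <= (b+x)^2) by (apply pow_incr; lra). nra. }
    destruct (small_quot (eps/2) (2 * Cmod (f z) + 1)) as [A1 B1]. lra. generalize (Cmod_ge_0 (f z)); lra.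
    destruct (small_quot (eps/2) (e * (2 * Cmod z + 1))) as [A2 B2]. lra. generalize (Cmod_ge_0 z); nra.
    set (q1 := eps / 2 / (2 * Cmod (f z) + 1 + 1)) in *. set (q2 := eps / 2 / (e * (2 * Cmod z + 1) + 1)) in *.
    destruct (Hf z Hz (Rmin 1 q1)) as (d & Hdp & Hk). apply Rmin_pos; lra.
    exists (Rmin d (Rmin 1 q2)). split. repeat apply Rmin_pos; lra.
    intros k Hkd _. specialize (Hk k (Rlt_le_trans _ _ _ Hkd (Rmin_l _ _))).
    assert (Hk2 := Rlt_le_trans _ _ _ Hkd (Rmin_r _ _)).
    unfold g.
    assert (Cmod (f (z + k)%C) ^ 2 <= Cmod (f z) ^ 2 + Rmin 1 q1 * (2 * Cmod (f z) + 1)).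
    { apply Sq; try apply Cmod_ge_0. split. left; apply Rmin_pos; lra. apply Rmin_l.
      eapply Rle_trans; [apply Cmod_triangle_inv|exact Hk]. }
    assert (Cmod (z + k)%C ^ 2 <= Cmod z ^ 2 + Rmin 1 q2 * (2 * Cmod z + 1)).
    { apply Sq; try apply Cmod_ge_0. split. left; apply Rmin_pos; lra. apply Rmin_l.
      generalize (Cmod_triangle z k). lra. }
    generalize (Rmin_r 1 q1) (Rmin_r 1 q2) (Cmod_ge_0 z) (Cmod_ge_0 (f z)). intros.
    assert (e * (Rmin 1 q2 * (2 * Cmod z + 1)) <= eps/2).
    { apply Rle_trans with (q2 * (e * (2 * Cmod z + 1))); [|lra].
      replace (e * (Rmin 1 q2 * (2 * Cmod z + 1))) with (Rmin 1 q2 * (e * (2 * Cmod z + 1))) by ring.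
      apply Rmult_le_compat_r; nra. }
    nra. }
  assert (Hz1 := Hmax z1 H1).
  destruct (Hd z0 D0) as [Hle|(d & Hdp & Hk & Hh)].
  { unfold g in Hz1. assert (Cmod z0 ^ 2 <= Rb ^ 2) by (apply pow_incr; split; [apply Cmod_ge_0|apply Hb, D0]).
    assert (Cmod (f z0) ^ 2 <= M ^ 2) by (apply pow_incr; split; [apply Cmod_ge_0|exact Hle]).
    generalize (pow2_ge_0 (Cmod z1)). nra. }
  set (c := f z0).
  (* Linearization of the perturbed squared modulus at [z0]. Its mean is [Cmod c ^ 2], while
     maximality of [z0] keeps it below that by [e * (d/2) ^ 2 / 2] on the whole circle. *)
  assert (MV : is_RInt (fun th => Re (Cconj c * f (z0 + (d/2)%R * cis th) + e * Cconj z0 * (z0 + (d/2)%R * cis th - z0))%C)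
     0 (2 * PI) (2 * PI * Re (Cconj c * f z0 + e * Cconj z0 * (z0 - z0))%C)).
  { apply (mean_value (fun z => Cconj c * f z + e * Cconj z0 * (z - z0))%C z0 d); [| |lra].
    - assert (Hh' : holo (fun z => 0 < Cmod (z - z0)%C < d) f).
      { refine (holo_sub _ _ _ _ Hh). intros z Hz; apply Hz. } holo.
    - apply ccont_plus; (apply ccont_mult; [apply ccont_const|]). apply Hf, D0.
      apply ccont_minus. apply ccont_id. apply ccont_const. }
  assert (Fin := is_RInt_le_const _ _ (Cmod c ^ 2 - e * (d/2) ^ 2 / 2) MV).
  assert (Hc2 : Re (Cconj c * f z0 + e * Cconj z0 * (z0 - z0))%C = Cmod c ^ 2).
  { fold c. rewrite Cmod2_alt. rring. }
  rewrite Hc2 in Fin.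
  assert (Hcontra : Cmod c ^ 2 <= Cmod c ^ 2 - e * (d/2) ^ 2 / 2).
  { apply Rmult_le_reg_l with (2 * PI). lra. apply Fin. intros th.
    assert (K0 : D (z0 + (d/2)%R * cis th)%C).
    { apply Hk. rewrite Cmod_mult, Cmod_cis, Cmod_R, Rabs_pos_eq; lra. }
    specialize (Hmax _ K0). set (zeta := (z0 + (d/2)%R * cis th)%C) in *.
    assert (Ez : Cmod zeta ^ 2 = Cmod z0 ^ 2 + 2 * Re (Cconj z0 * (zeta - z0))%C + (d/2)^2).
    { replace ((d/2)^2) with (Cmod (zeta - z0)%C ^ 2).
      2:{ unfold zeta. rewrite Cmod_circle; lra. }
      rewrite !Cmod2_alt. rring. }
    unfold g in Hmax. fold c in Hmax.
    assert (2 * Re (Cconj c * f zeta)%C <= Cmod c ^ 2 + Cmod (f zeta) ^ 2).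
    { rewrite !Cmod2_alt. assert (0 <= (Re c - Re (f zeta))^2 + (Im c - Im (f zeta))^2).
      { generalize (pow2_ge_0 (Re c - Re (f zeta))) (pow2_ge_0 (Im c - Im (f zeta))). lra. }
      replace (Re (Cconj c * f zeta)%C) with (Re c * Re (f zeta) + Im c * Im (f zeta)) by rring. lra. }
    replace (Re (Cconj c * f zeta + e * Cconj z0 * (zeta - z0))%C)
      with (Re (Cconj c * f zeta)%C + e * Re (Cconj z0 * (zeta - z0))%C) by rring.
    rewrite Ez in Hmax. nra. }
  assert (0 < e * (d/2)^2) by (apply Rmult_lt_0_compat; [exact He|apply pow_lt; lra]). lra.
Qed.

(** * Entire power series and their zeroes *)

(** A total function whose value means something only for convergent series, which is why the
    algebraic laws below carry [abs_summable]. *)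
Definition csum (u : nat -> C) : C := (Series (fun n => Re (u n)), Series (fun n => Im (u n))).
Definition abs_summable (u : nat -> C) : Prop := ex_series (fun n => Cmod (u n)).

Lemma abs_summable_Re u : abs_summable u -> ex_series (fun n => Re (u n)).
Proof.
  intros H. apply (ex_series_le (V := R_CompleteNormedModule) _ _ (fun n => re_le_Cmod (u n)) H).
Qed.

Lemma abs_summable_Im u : abs_summable u -> ex_series (fun n => Im (u n)).
Proof.
  intros H. apply (ex_series_le (V := R_CompleteNormedModule) _ _ (fun n => im_le_Cmod (u n)) H).
Qed.

Lemma abs_summable_le u (v : nat -> R) : (forall n, Cmod (u n) <= v n) -> ex_series v -> abs_summable u.
Proof.
  intros H Hv. unfold abs_summable. refine (ex_series_le (V := R_CompleteNormedModule) _ v _ Hv).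
  intros n. unfold norm; simpl; unfold abs; simpl. rewrite Rabs_pos_eq by apply Cmod_ge_0. apply H.
Qed.

Lemma ex_series_mult_l (c : R) (v : nat -> R) : ex_series v -> ex_series (fun n => c * v n).
Proof. apply (ex_series_scal (V := R_NormedModule) c v). Qed.

Lemma csum_ext u v : (forall n, u n = v n) -> csum u = csum v.
Proof. intros H. unfold csum. f_equal; apply Series_ext; intros; rewrite H; reflexivity. Qed.

Lemma csum_plus u v : abs_summable u -> abs_summable v ->
  csum (fun n => u n + v n)%C = (csum u + csum v)%C.
Proof.
  intros Hu Hv. apply C_ext; simpl.
  - rewrite <- Series_plus by (apply abs_summable_Re; assumption). apply Series_ext. intros; rring.
  - rewrite <- Series_plus by (apply abs_summable_Im; assumption). apply Series_ext. intros; rring.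
Qed.

Lemma csum_scal c u : abs_summable u -> csum (fun n => c * u n)%C = (c * csum u)%C.
Proof.
  intros Hu. assert (H1 := abs_summable_Re u Hu). assert (H2 := abs_summable_Im u Hu).
  apply C_ext; simpl; fold (Re c) (Im c).
  - rewrite <- !Series_scal_l.
    rewrite <- Series_minus by (apply ex_series_mult_l; assumption).
    apply Series_ext. intros; rring.
  - rewrite <- !Series_scal_l.
    rewrite <- Series_plus by (apply ex_series_mult_l; assumption).
    apply Series_ext. intros; rring.
Qed.

Lemma csum_shift u : abs_summable u -> csum u = (u O + csum (fun n => u (S n)))%C.
Proof.
  intros Hu. apply C_ext; simpl.
  - rewrite Series_incr_1 by (apply abs_summable_Re; assumption). reflexivity.
  - rewrite Series_incr_1 by (apply abs_summable_Im; assumption). reflexivity.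
Qed.

Lemma abs_summable_scal c u : abs_summable u -> abs_summable (fun n => c * u n)%C.
Proof.
  intros H. apply abs_summable_le with (fun n => Cmod c * Cmod (u n)).
  intros n; rewrite Cmod_mult; lra. apply ex_series_mult_l, H.
Qed.

Lemma abs_summable_plus u v : abs_summable u -> abs_summable v -> abs_summable (fun n => u n + v n)%C.
Proof.
  intros Hu Hv. apply abs_summable_le with (fun n => Cmod (u n) + Cmod (v n)).
  intros n; apply Cmod_triangle. apply (ex_series_plus (V := R_NormedModule)); assumption.
Qed.

Lemma csum_le u (v : nat -> R) : (forall n, Cmod (u n) <= v n) -> ex_series v -> Cmod (csum u) <= Series v.
Proof.
  intros H Hv. assert (Hu := abs_summable_le u v H Hv).
  apply Cmod_le_Re.
  - rewrite <- (Rmult_0_l (Series v)), <- Series_scal_l. apply Series_le; [|exact Hv].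
    intros n. rewrite Rmult_0_l. generalize (Cmod_ge_0 (u n)) (H n). lra.
  - intros c Hc. rewrite <- csum_scal by exact Hu. simpl.
    eapply Rle_trans; [apply Rle_abs|].
    assert (K : forall n, Rabs (Re (c * u n)%C) <= v n).
    { intros n. eapply Rle_trans; [apply re_le_Cmod|]. rewrite Cmod_mult, Hc, Rmult_1_l. apply H. }
    eapply Rle_trans; [apply Series_Rabs|].
    + apply (abs_summable_Re (fun n => RtoC (Rabs (Re (c * u n)%C)))).
      apply abs_summable_le with v; [|exact Hv]. intros n. rewrite Cmod_R, Rabs_Rabsolu. apply K.
    + apply Series_le; [|exact Hv]. intros n. split. apply Rabs_pos. apply K.
Qed.

Lemma is_series_csum (u : nat -> C) (l : C) :
  @is_series C_AbsRing C_NormedModule u l -> l = csum u.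
Proof.
  intros H.
  assert (S1 : forall n, Re (@sum_n C_NormedModule u n) = sum_n (fun k => Re (u k)) n).
  { induction n. rewrite !sum_O; reflexivity. rewrite !sum_Sn, <- IHn. reflexivity. }
  assert (S2 : forall n, Im (@sum_n C_NormedModule u n) = sum_n (fun k => Im (u k)) n).
  { induction n. rewrite !sum_O; reflexivity. rewrite !sum_Sn, <- IHn. reflexivity. }
  unfold is_series in H.
  apply C_ext; unfold csum; simpl; symmetry; apply is_series_unique.
  - unfold is_series. eapply filterlim_ext; [intros n; apply S1|].
    eapply filterlim_comp. exact H. apply (continuous_fst (U := R_UniformSpace) (V := R_UniformSpace)).
  - unfold is_series. eapply filterlim_ext; [intros n; apply S2|].
    eapply filterlim_comp. exact H. apply (continuous_snd (U := R_UniformSpace) (V := R_UniformSpace)).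
Qed.

(** Equivalently, [sum a_n z^n] has infinite radius of convergence. *)
Definition fast (a : nat -> C) : Prop :=
  forall s, 0 < s -> exists M, forall n, Cmod (a n) * s ^ n <= M.

Definition ps (a : nat -> C) (z : C) : C := csum (fun n => a n * z ^ n)%C.

Lemma ex_series_half (M : R) : ex_series (fun n => M * (1/2) ^ n).
Proof. apply ex_series_mult_l. apply ex_series_geom. rewrite Rabs_pos_eq; lra. Qed.

Lemma Series_half (M : R) : Series (fun n => M * (1/2) ^ n) = 2 * M.
Proof.
  rewrite Series_scal_l, Series_geom. field. rewrite Rabs_pos_eq; lra.
Qed.

Lemma fast_term a s M z n : 0 < s -> Cmod (a n) * s ^ n <= M -> Cmod z <= s / 2 ->
  Cmod (a n * z ^ n)%C <= M * (1/2) ^ n.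
Proof.
  intros Hs HM Hz. rewrite Cmod_mult, Cmod_pow.
  assert (Cmod z ^ n <= (s * (1/2)) ^ n) by (apply pow_incr; split; [apply Cmod_ge_0|lra]).
  rewrite Rpow_mult_distr in H. assert (0 < (1/2)^n) by (apply pow_lt; lra).
  generalize (Cmod_ge_0 (a n)). nra.
Qed.

Lemma ps_summable a z : fast a -> abs_summable (fun n => a n * z ^ n)%C.
Proof.
  intros H. assert (Hz := Cmod_ge_0 z). destruct (H (2 * Cmod z + 1)) as (M & HM). lra.
  apply abs_summable_le with (fun n => M * (1/2) ^ n).
  intros n. apply fast_term with (2 * Cmod z + 1); [lra|apply HM|lra].
  apply ex_series_half.
Qed.

Lemma ps_bound a s M z : 0 < s -> (forall n, Cmod (a n) * s ^ n <= M) -> Cmod z <= s / 2 ->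
  Cmod (ps a z) <= 2 * M.
Proof.
  intros Hs HM Hz. rewrite <- Series_half. apply csum_le.
  intros n. apply fast_term with s; auto. apply ex_series_half.
Qed.

Lemma ps_0 a : ps a 0%C = a O.
Proof.
  assert (E : forall n, (a n * 0 ^ n)%C = if Nat.eq_dec n 0 then a O else 0%C).
  { intros [|n]; simpl; ring. }
  unfold ps. rewrite (csum_ext _ _ E).
  assert (Hs : abs_summable (fun n => if Nat.eq_dec n 0 then a O else 0%C)).
  { apply abs_summable_le with (fun n => Cmod (a O) * (1/2) ^ n); [|apply ex_series_half].
    intros [|n]; simpl. lra. rewrite Cmod_0. apply Rmult_le_pos. apply Cmod_ge_0.
    assert (0 < (1/2)^n) by (apply pow_lt; lra). lra. }
  rewrite csum_shift by exact Hs. simpl.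
  replace (csum (fun _ => RtoC 0)) with (RtoC 0). ring.
  symmetry. apply Cmod_eq_0, Rle_antisym; [|apply Cmod_ge_0].
  eapply Rle_trans. apply (csum_le (fun _ => RtoC 0) (fun n => 0 * (1/2)^n)).
  intros n. rewrite Cmod_0; lra. apply ex_series_half. rewrite Series_half; lra.
Qed.

Definition shift (a : nat -> C) (n : nat) : C := a (S n).

Lemma fast_shift a : fast a -> fast (shift a).
Proof.
  intros H s Hs. destruct (H s Hs) as (M & HM). exists (M / s). intros n.
  specialize (HM (S n)). simpl in HM. apply Rmult_le_reg_r with s. exact Hs.
  unfold shift. replace (M / s * s) with M by (field; lra). lra.
Qed.

Lemma fast_scal c a : fast a -> fast (fun n => c * a n)%C.
Proof.
  intros H s Hs. destruct (H s Hs) as (M & HM). exists (Cmod c * M). intros n.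
  rewrite Cmod_mult, Rmult_assoc. apply Rmult_le_compat_l. apply Cmod_ge_0. apply HM.
Qed.

Lemma ps_scal c a z : fast a -> ps (fun n => c * a n)%C z = (c * ps a z)%C.
Proof.
  intros H. unfold ps. rewrite <- csum_scal by (apply ps_summable; exact H).
  apply csum_ext. intros; ring.
Qed.

Lemma ps_shift a z : fast a -> ps a z = (a O + z * ps (shift a) z)%C.
Proof.
  intros H. unfold ps. rewrite csum_shift by (apply ps_summable; exact H).
  rewrite <- csum_scal by (apply ps_summable, fast_shift, H).
  simpl. f_equal. ring. apply csum_ext. intros n. unfold shift. simpl. ring.
Qed.

(** Synthetic division: the coefficients of the difference quotient of [ps a] at [b], obtained by
    expanding (z^m - b^m) / (z - b) in every term. *)
Definition quot (a : nat -> C) (b : C) (n : nat) : C := ps (fun j => a (n + 1 + j)%nat) b.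

Lemma fast_tail a n : fast a -> fast (fun j => a (n + j)%nat).
Proof.
  intros H s Hs. destruct (H s Hs) as (M & HM). exists (M / s ^ n). intros j.
  specialize (HM (n + j)%nat). rewrite pow_add in HM.
  assert (0 < s ^ n) by (apply pow_lt, Hs).
  apply Rmult_le_reg_r with (s ^ n). assumption.
  replace (M / s ^ n * s ^ n) with M by (field; lra). lra.
Qed.

Lemma fast_quot a b : fast a -> fast (quot a b).
Proof.
  intros H s Hs. assert (Hb := Cmod_ge_0 b).
  (* A radius at least [s] with [Cmod b <= t / 2], so that [ps_bound] applies at [b] to each tail of
     the coefficients. *)
  set (t := s + 2 * Cmod b). assert (Ht : 0 < t) by (unfold t; lra).
  destruct (H t Ht) as (M & HM). exists (2 * (M / t)). intros n.
  assert (Hp : 0 < t ^ n) by (apply pow_lt, Ht).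
  assert (B : Cmod (quot a b n) <= 2 * (M / t ^ (n + 1))).
  { unfold quot. apply ps_bound with t. exact Ht. 2: unfold t; lra.
    intros j. specialize (HM (n + 1 + j)%nat). rewrite pow_add in HM.
    assert (0 < t ^ (n + 1)) by (apply pow_lt, Ht).
    apply Rmult_le_reg_r with (t ^ (n + 1)). assumption.
    replace (M / t ^ (n+1) * t ^ (n+1)) with M by (field; lra). lra. }
  apply Rle_trans with (Cmod (quot a b n) * t ^ n).
  { apply Rmult_le_compat_l. apply Cmod_ge_0. apply pow_incr. unfold t. lra. }
  apply Rle_trans with (2 * (M / t ^ (n+1)) * t ^ n).
  { apply Rmult_le_compat_r; lra. }
  rewrite pow_add, pow_1. right. field. lra.
Qed.

Lemma quot_rec a b n : fast a -> quot a b n = (a (S n) + b * quot a b (S n))%C.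
Proof.
  intros H. unfold quot. rewrite ps_shift by (apply (fast_tail a (n+1)), H).
  f_equal. f_equal; lia. f_equal. unfold ps. apply csum_ext. intros j. unfold shift. f_equal. f_equal. lia.
Qed.

(** Continuity and differentiability of [ps a], as well as division by a zero, are all read off from
    this identity. It follows by summing the recursion [quot_rec]. *)
Lemma ps_quot a b z : fast a -> ps a z = (ps a b + (z - b) * ps (quot a b) z)%C.
Proof.
  intros H. assert (Hq := fast_quot a b H). assert (Hsq := fast_shift _ Hq). assert (Hs := fast_shift _ H).
  assert (E0 : ps a b = (a O + b * quot a b O)%C).
  { rewrite ps_shift by exact H. f_equal. }
  assert (E1 : ps (quot a b) z = (ps (shift a) z + b * ps (shift (quot a b)) z)%C).
  { unfold ps at 2 3. rewrite <- csum_scal by (apply ps_summable; exact Hsq).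
    rewrite <- csum_plus. 2: apply ps_summable; exact Hs. 2: apply abs_summable_scal, ps_summable, Hsq.
    apply csum_ext. intros n. rewrite quot_rec by exact H. unfold shift. ring. }
  assert (E2 := ps_shift (quot a b) z Hq).
  rewrite (ps_shift a z H), E0.
  replace ((z - b) * ps (quot a b) z)%C with (z * ps (quot a b) z - b * ps (quot a b) z)%C by ring.
  rewrite E1 at 1. rewrite E2. ring.
Qed.

Lemma ps_ccont a z : fast a -> ccont (ps a) z.
Proof.
  intros H eps He. assert (Hq := fast_quot a z H). assert (Hz := Cmod_ge_0 z).
  destruct (Hq (2 * (Cmod z + 1))) as (M & HM). lra.
  assert (M0 : 0 <= M). { eapply Rle_trans; [|apply (HM O)]. simpl. rewrite Rmult_1_r. apply Cmod_ge_0. }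
  destruct (small_quot eps (2 * M)) as [A B]; try lra.
  set (q := eps / (2 * M + 1)) in *.
  exists (Rmin 1 q). split. apply Rmin_pos; lra. intros k Hk.
  rewrite (ps_quot a z (z + k)%C H).
  replace (_ - _)%C with (k * ps (quot a z) (z + k)%C)%C by ring.
  rewrite Cmod_mult. generalize (Rmin_l 1 q) (Rmin_r 1 q) (Cmod_triangle z k) (Cmod_ge_0 k). intros.
  assert (Cmod (ps (quot a z) (z + k)%C) <= 2 * M). { apply ps_bound with (2 * (Cmod z + 1)); try lra. exact HM. }
  generalize (Cmod_ge_0 (ps (quot a z) (z + k)%C)). intros. nra.
Qed.

Lemma INR_le_pow2 n : INR n <= 2 ^ n.
Proof. induction n. simpl; lra. rewrite S_INR. simpl pow. assert (1 <= 2 ^ n) by (apply pow_R1_Rle; lra). lra. Qed.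

Definition dcoef (a : nat -> C) (n : nat) : C := (INR (S n) * a (S n))%C.

Lemma fast_dcoef a : fast a -> fast (dcoef a).
Proof.
  intros H s Hs. destruct (H (2 * s)) as (M & HM). lra. exists (M / s). intros n.
  specialize (HM (S n)). rewrite Rpow_mult_distr in HM. simpl in HM.
  unfold dcoef. rewrite Cmod_mult, Cmod_R, Rabs_pos_eq by apply pos_INR.
  assert (INR (S n) <= 2 * 2 ^ n) by apply (INR_le_pow2 (S n)).
  assert (0 < s ^ n) by (apply pow_lt, Hs).
  apply Rmult_le_reg_r with s. exact Hs. replace (M / s * s) with M by (field; lra).
  generalize (Cmod_ge_0 (a (S n))). intros.
  apply Rle_trans with (2 * 2 ^ n * (Cmod (a (S n)) * (s ^ n * s))).
  2: lra.
  replace (INR (S n) * Cmod (a (S n)) * s ^ n * s) with (INR (S n) * (Cmod (a (S n)) * (s ^ n * s))) by ring.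
  apply Rmult_le_compat_r. apply Rmult_le_pos. assumption. nra. assumption.
Qed.

(** Summation by parts in place of a double series: the sum of [n * quot a b n * b ^ n] is evaluated
    once by [ps_shift] and once by inserting [quot_rec], and the two results differ by exactly the
    two sides of the claim. *)
Lemma ps_dcoef a b : fast a -> ps (quot a b) b = ps (dcoef a) b.
Proof.
  intros H. assert (Hq := fast_quot a b H).
  assert (Hn : fast (fun n => INR n * quot a b n)%C).
  { intros s Hs. destruct (Hq (2 * s)) as (M & HM). lra. exists M. intros n. specialize (HM n).
    rewrite Rpow_mult_distr in HM. rewrite Cmod_mult, Cmod_R, Rabs_pos_eq by apply pos_INR.
    assert (H2 := INR_le_pow2 n).
    assert (0 < s ^ n) by (apply pow_lt, Hs). generalize (Cmod_ge_0 (quot a b n)). intros.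
    eapply Rle_trans; [|apply HM].
    replace (INR n * Cmod (quot a b n) * s ^ n) with (INR n * (Cmod (quot a b n) * s ^ n)) by ring.
    replace (Cmod (quot a b n) * (2 ^ n * s ^ n)) with (2 ^ n * (Cmod (quot a b n) * s ^ n)) by ring.
    apply Rmult_le_compat_r. nra. assumption. }
  assert (E := ps_shift _ b Hn). change (INR 0) with 0 in E.
  assert (E2 : ps (fun n => INR n * quot a b n)%C b =
     (ps (dcoef a) b + (b * ps (shift (fun n => INR n * quot a b n)%C) b + (-1)%R * ps (quot a b) b))%C).
  { assert (S1 := ps_summable _ b (fast_dcoef _ H)).
    assert (S2 := ps_summable _ b (fast_shift _ Hn)). assert (S3 := ps_summable _ b Hq).
    assert (S2' := abs_summable_scal b _ S2). assert (S3' := abs_summable_scal (-1)%R _ S3).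
    unfold ps. rewrite <- (csum_scal b _ S2), <- (csum_scal (-1)%R _ S3), <- (csum_plus _ _ S2' S3').
    rewrite <- (csum_plus _ _ S1 (abs_summable_plus _ _ S2' S3')).
    apply csum_ext; intros n; unfold shift, dcoef; rewrite (quot_rec a b n H), S_INR, RtoC_plus; cring. }
  rewrite E in E2. clear E. cbv beta in E2. change (INR 0) with 0 in E2.
  set (X := ps (shift _) b) in E2. set (Y := ps (quot a b) b) in *. set (Z := ps (dcoef a) b) in *.
  replace Y with (Z + ((0 * quot a b O + b * X) - (Z + (b * X + (-1)%R * Y))))%C by cring.
  rewrite E2. ring.
Qed.

Lemma ps_cder a b : fast a -> cder (ps a) b (ps (dcoef a) b).
Proof.
  intros H eps He. rewrite <- ps_dcoef by exact H.
  destruct (ps_ccont (quot a b) b (fast_quot a b H) eps He) as (d & Hd & Hk).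
  exists d. split. exact Hd. intros k Hkd. specialize (Hk k Hkd).
  rewrite (ps_quot a b (b + k)%C H).
  replace (_ - _)%C with (k * (ps (quot a b) (b + k) - ps (quot a b) b))%C by ring.
  rewrite Cmod_mult. generalize (Cmod_ge_0 k). nra.
Qed.

Lemma holo_ps D a : fast a -> holo D (ps a).
Proof.
  intros H. exists (ps (dcoef a)). intros z _. split. apply ps_cder, H. apply ps_ccont, fast_dcoef, H.
Qed.

Lemma Cconj_pow z n : Cconj (z ^ n)%C = (Cconj z ^ n)%C.
Proof. induction n; simpl. cring. rewrite Cmult_conj, IHn. reflexivity. Qed.

Lemma circle_monomial c n : is_RInt (fun th => Re (c * Cconj (cis th) ^ S n)%C) 0 (2 * PI) 0.
Proof.
  assert (H : is_RInt (fun th => Re (Cconj c * (0 + 1%R * cis th) ^ S n)%C) 0 (2 * PI)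
     (2 * PI * Re (Cconj c * 0 ^ S n)%C)).
  { apply (mean_value (fun z => Cconj c * z ^ S n)%C 0%C 2); [holo| |lra].
    apply (holo_ccont (fun _ => True)). holo. exact I. }
  replace (2 * PI * Re (Cconj c * 0 ^ S n)%C) with 0 in H.
  2:{ simpl. replace (Cconj c * (0 * 0 ^ n))%C with (RtoC 0) by ring. rring. }
  eapply is_RInt_ext; [|exact H]. intros th _. cbv beta.
  replace (0 + 1%R * cis th)%C with (cis th) by ring.
  rewrite <- (re_conj (c * _)%C), Cmult_conj, Cconj_pow, Cconj_conj. reflexivity.
Qed.

(** Induction on [n] by splitting off the constant term: on the circle one factor [r * cis th]
    cancels against one conjugate of [cis th] and leaves [r], which moves into [c]; the constant
    term integrates to zero. This is why [c] is quantified after [n]. *)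
Lemma cauchy_coefficient a n : fast a -> forall c r, 0 < r ->
  is_RInt (fun th => Re (c * ps a (r * cis th) * Cconj (cis th) ^ n)%C) 0 (2 * PI)
    (2 * PI * (Re (c * a n)%C * r ^ n)).
Proof.
  revert a. induction n as [|n IH]; intros a H c r Hr.
  - assert (M : is_RInt (fun th => Re (c * ps a (0 + r * cis th))%C) 0 (2 * PI) (2 * PI * Re (c * ps a 0)%C)).
    { assert (Hp := fun D => holo_ps D a H).
      apply (mean_value (fun z => c * ps a z)%C 0%C (r + 1)); [| |lra]. holo; apply Hp.
      apply (holo_ccont (fun _ => True)); [holo; apply Hp|exact I]. }
    rewrite ps_0 in M. change (r ^ 0) with 1. rewrite Rmult_1_r.
    eapply is_RInt_ext; [|exact M]. intros th _. cbv beta. rewrite Cplus_0_l.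
    replace (Cconj (cis th) ^ 0)%C with (RtoC 1) by reflexivity. rewrite Cmult_1_r. reflexivity.
  - assert (M1 := circle_monomial (c * a O)%C n).
    assert (M2 := IH (shift a) (fast_shift a H) (c * r)%C r Hr).
    assert (M := is_RInt_plus (V := R_NormedModule) _ _ _ _ _ _ M1 M2).
    replace (2 * PI * (Re (c * a (S n))%C * r ^ S n)) with
      (plus 0 (2 * PI * (Re (c * r * shift a n)%C * r ^ n))).
    2:{ unfold plus; simpl. unfold shift.
        replace (Re (c * r * a (S n))%C) with (r * Re (c * a (S n))%C) by rring. rring. }
    eapply is_RInt_ext; [|exact M]. intros th _.     change (Re (c * a O * Cconj (cis th) ^ S n)%C +
      Re (c * r * ps (shift a) (r * cis th) * Cconj (cis th) ^ n)%C =
      Re (c * ps a (r * cis th) * Cconj (cis th) ^ S n)%C).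
    rewrite <- re_plus. f_equal. rewrite (ps_shift a (r * cis th)%C H).
    replace (c * r * ps (shift a) (r * cis th) * Cconj (cis th) ^ n)%C with
      (c * r * ps (shift a) (r * cis th) * (cis th * Cconj (cis th)) * Cconj (cis th) ^ n)%C
      by (rewrite cis_conj; ring).
    rewrite Cpow_S. ring.
Qed.

Lemma cauchy_estimate a r B : fast a -> 0 < r ->
  (forall z, Cmod z = r -> Cmod (ps a z) <= B) -> forall n, Cmod (a n) * r ^ n <= B.
Proof.
  intros H Hr HB n. assert (Hpi := PI_RGT_0).
  assert (Hrn : 0 < r ^ n) by (apply pow_lt, Hr).
  assert (HB0 : 0 <= B).
  { eapply Rle_trans; [|apply (HB (RtoC r)); rewrite Cmod_R, Rabs_pos_eq; lra]. apply Cmod_ge_0. }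
  replace (Cmod (a n) * r ^ n) with (Cmod (a n * (r ^ n)%R)%C).
  2:{ rewrite Cmod_mult, Cmod_R, Rabs_pos_eq; lra. }
  apply Cmod_le_Re. exact HB0.
  intros c Hc. assert (M := is_RInt_le_const _ _ B (cauchy_coefficient a n H c r Hr)).
  replace (Re (c * (a n * (r ^ n)%R))%C) with (Re (c * a n)%C * r ^ n) by rring.
  apply Rmult_le_reg_l with (2 * PI). lra. apply M. intros th.
  eapply Rle_trans; [apply Re_le_Cmod|].
  rewrite !Cmod_mult, Cmod_pow, Cmod_conj, Cmod_cis, pow1, Hc.
  rewrite Rmult_1_l, Rmult_1_r. apply HB. rewrite Cmod_mult, Cmod_cis, Cmod_R, Rabs_pos_eq; lra.
Qed.

Lemma ps_sup a r : fast a -> 0 <= r -> exists M, 0 <= M /\ forall z, Cmod z <= r -> Cmod (ps a z) <= M.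
Proof.
  intros H Hr. destruct (H (2 * r + 1)) as (M & HM). lra.
  exists (2 * M). split.
  - assert (0 <= M); [|lra]. eapply Rle_trans; [|apply (HM O)]. simpl. rewrite Rmult_1_r. apply Cmod_ge_0.
  - intros z Hz. apply ps_bound with (2 * r + 1). lra. exact HM. lra.
Qed.

(** * Division by the zeroes in a disc *)

Fixpoint canonical (l : list C) (z : C) : C :=
  match l with nil => 1%C | b :: l => ((1 - z / b) * canonical l z)%C end.

(** The list repeats a zero according to multiplicity but may be incomplete: [g] may still vanish in
    the disc. That it does not is a separate statement, supplied by [factorization]. *)
Definition factors (a : nat -> C) (r : R) (l : list C) (g : nat -> C) : Prop :=
  fast g /\ (forall b, In b l -> b <> 0%C /\ Cmod b <= r) /\ (forall z, ps a z = (canonical l z * ps g z)%C).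

Lemma canonical_0 l : canonical l 0%C = 1%C.
Proof.
  induction l; simpl. reflexivity. rewrite IHl. unfold Cdiv.
  replace (0 * / a)%C with (RtoC 0) by ring. ring.
Qed.

Lemma factors_0 a r l g : factors a r l g -> g O = a O.
Proof.
  intros (_ & _ & E). specialize (E 0%C). rewrite canonical_0, !ps_0 in E. rewrite E. ring.
Qed.

Lemma canonical_outer (l : list C) (r : R) : (forall b, In b l -> b <> 0%C /\ Cmod b <= r) -> 0 < r ->
  forall z, Cmod z = 3 * r -> 2 ^ length l <= Cmod (canonical l z).
Proof.
  intros H Hr z Hz. induction l as [|b l IH]; simpl. rewrite Cmod_1; lra.
  rewrite Cmod_mult. destruct (H b (or_introl eq_refl)) as [Nb Hb].
  assert (Hb0 : 0 < Cmod b) by (apply Cmod_gt_0; exact Nb).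
  apply Rmult_le_compat. lra. apply pow_le; lra. 2: apply IH; intros; apply H; right; assumption.
  rewrite Cmod_minus_sym. eapply Rle_trans; [|apply Cmod_triangle_inv].
  rewrite Cmod_1, Cmod_div, Hz by exact Nb.
  assert (3 <= 3 * r / Cmod b); [|lra]. apply Rmult_le_reg_r with (Cmod b). exact Hb0.
  unfold Rdiv. rewrite Rmult_assoc, Rinv_l by lra. lra.
Qed.

(** A Jensen type bound: the cofactor is at most [M / 2 ^ length l] on the circle of radius [3 * r],
    hence also at the origin, where it agrees with [ps a]. *)
Lemma factors_length a r l g M : factors a r l g -> fast a -> 0 < r ->
  (forall z, Cmod z <= 3 * r -> Cmod (ps a z) <= M) -> 2 ^ length l * Cmod (a O) <= M.
Proof.
  intros Hf Ha Hr HM. rewrite <- (factors_0 _ _ _ _ Hf). destruct Hf as (Hg & Hl & E).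
  assert (Hp : 0 < 2 ^ length l) by (apply pow_lt; lra).
  assert (C1 := cauchy_estimate g (3 * r) (M / 2 ^ length l) Hg ltac:(lra)).
  assert (Cmod (g O) * (3 * r) ^ 0 <= M / 2 ^ length l).
  { apply C1. intros z Hz. assert (B := canonical_outer l r Hl Hr z Hz).
    specialize (HM z ltac:(lra)). rewrite E, Cmod_mult in HM.
    apply Rmult_le_reg_r with (2 ^ length l). exact Hp. unfold Rdiv. rewrite Rmult_assoc, Rinv_l by lra.
    generalize (Cmod_ge_0 (ps g z)). nra. }
  simpl in H. rewrite Rmult_1_r in H. apply Rmult_le_compat_l with (r := 2 ^ length l) in H; [|lra].
  replace (2 ^ length l * (M / 2 ^ length l)) with M in H by (field; lra). exact H.
Qed.

(* Each zero of the disc contributes a factor 2 to the maximum modulus on [|z| = 3 r], so the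
   number of factors is bounded and a longest factorization has a zero free cofactor. *)
Lemma factorization a r : fast a -> a O <> 0%C -> 0 < r ->
  exists l g, factors a r l g /\ forall z, Cmod z <= r -> ps g z <> 0%C.
Proof.
  intros Ha Ha0 Hr. apply NNPP. intros Hno.
  assert (Hall : forall n, exists l g, factors a r l g /\ length l = n).
  { induction n as [|n (l & g & Hf & Hl)].
    - exists nil, a. split; [|reflexivity]. split. exact Ha. split. intros b []. intros z; simpl. ring.
    - apply NNPP. intros Hn. apply Hno. exists l, g. split. exact Hf. intros z Hz Hzero.
      apply Hn. assert (E0 := factors_0 _ _ _ _ Hf). destruct Hf as (Hg & Hb & E).
      assert (Nz : z <> 0%C). { intros ->. rewrite ps_0 in Hzero. congruence. }
      exists (z :: l), (fun n => (- z) * quot g z n)%C. split. 2: simpl; congruence.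
      split. apply fast_scal, fast_quot, Hg. split.
      + intros b [<-|Hb1]. auto. apply Hb, Hb1.
      + intros w. rewrite E. simpl. rewrite ps_scal by (apply fast_quot, Hg).
        rewrite (ps_quot g z w Hg), Hzero. field. exact Nz. }
  destruct (ps_sup a (3 * r) Ha) as (M & HM0 & HM). lra.
  assert (Hpos : 0 < Cmod (a O)) by (apply Cmod_gt_0; exact Ha0).
  destruct (Pow_x_infinity 2) with (b := M / Cmod (a O) + 1) as (N & HN). rewrite Rabs_pos_eq; lra.
  destruct (Hall N) as (l & g & Hf & Hl).
  assert (B := factors_length a r l g M Hf Ha Hr HM). rewrite Hl in B.
  specialize (HN N (le_n N)). rewrite Rabs_pos_eq in HN by (apply pow_le; lra).
  apply Rge_le in HN. apply Rmult_le_compat_r with (r := Cmod (a O)) in HN; [|lra].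
  replace ((M / Cmod (a O) + 1) * Cmod (a O)) with (M + Cmod (a O)) in HN by (field; lra). lra.
Qed.

Lemma count_remove_length (l : list C) b : length l = (count_occ Ceq_dec l b + length (remove Ceq_dec b l))%nat.
Proof.
  induction l as [|x l IH]; simpl. reflexivity.
  destruct (Ceq_dec x b) as [E|N]; destruct (Ceq_dec b x) as [E'|N']; simpl; try congruence; lia.
Qed.

Lemma count_occ_remove_neq (l : list C) a b : a <> b ->
  count_occ Ceq_dec (remove Ceq_dec b l) a = count_occ Ceq_dec l a.
Proof.
  intros Hab. induction l as [|x l IH]; simpl. reflexivity.
  destruct (Ceq_dec b x) as [E|N]; simpl; destruct (Ceq_dec x a) as [E'|N']; simpl; congruence.
Qed.

Lemma multiplicity_list (l : list C) : exists L : list (C * nat),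
  NoDup (map fst L) /\ list_sum (map snd L) = length l /\ forall a m, In (a, m) L -> In a l /\ m = count_occ Ceq_dec l a.
Proof.
  remember (length l) as n eqn:Hn. revert l Hn.
  induction n as [n IH] using (well_founded_induction Wf_nat.lt_wf). intros l Hn.
  destruct l as [|b l].
  - exists nil. simpl. subst n. repeat split. constructor. elim H. elim H.
  - set (l0 := b :: l) in *. assert (E := count_remove_length l0 b).
    assert (Hc : (0 < count_occ Ceq_dec l0 b)%nat). { apply count_occ_In. left; reflexivity. }
    destruct (IH (length (remove Ceq_dec b l0)) ltac:(lia) _ eq_refl) as (L & H1 & H2 & H3).
    exists ((b, count_occ Ceq_dec l0 b) :: L). simpl map. simpl list_sum. repeat split.
    + constructor; [|exact H1]. intros Hin. apply in_map_iff in Hin. destruct Hin as ([a m] & Ea & Hin).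
      simpl in Ea. subst a. destruct (H3 b m Hin) as [K _]. apply in_remove in K. apply (proj2 K); reflexivity.
    + rewrite <- Hn in E. rewrite E. change (count_occ Ceq_dec l0 b + list_sum (map snd L) = count_occ Ceq_dec l0 b + length (remove Ceq_dec b l0))%nat. lia.
    + destruct H as [H|H]. injection H as <- _. left; reflexivity.
      destruct (H3 _ _ H) as [K _]. apply in_remove in K. apply K.
    + destruct H as [H|H]. injection H as <- <-. reflexivity.
      destruct (H3 _ _ H) as [K ->]. apply in_remove in K. apply count_occ_remove_neq, K.
Qed.

Lemma cder_ex_derive (f : C -> C) z l : cder f z l -> @ex_derive C_AbsRing C_NormedModule f z.
Proof. intros H. apply cder_is_derive in H. exists l. split. apply is_linear_scal_l. exact (proj2 H). Qed.

Lemma holo_canonical D l : holo D (canonical l).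
Proof. induction l as [|b l IH]; simpl. apply (holo_const D 1%C). unfold Cdiv. holo. Qed.

Lemma canonical_remove l (a z : C) : a <> 0%C ->
  canonical l z = ((z - a) ^ count_occ Ceq_dec l a * ((- / a) ^ count_occ Ceq_dec l a * canonical (remove Ceq_dec a l) z))%C.
Proof.
  intros Ha. induction l as [|x l IH]; simpl. ring.
  destruct (Ceq_dec x a) as [E|N]; destruct (Ceq_dec a x) as [E'|N']; try congruence.
  - subst x. rewrite IH. rewrite !Cpow_S. field. exact Ha.
  - rewrite IH. simpl. ring.
Qed.

Lemma canonical_nz (l : list C) (z : C) : (forall b, In b l -> b <> 0%C) -> ~ In z l -> canonical l z <> 0%C.
Proof.
  intros Hl Hz. induction l as [|b l IH]; simpl. intros E; apply RtoC_inj in E; lra.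
  apply Cmult_neq_0.
  - intros E. apply Hz. left. assert (Nb := Hl b (or_introl eq_refl)).
    replace z with (b * (1 - (1 - z / b)))%C by (field; exact Nb). rewrite E. ring.
  - apply IH. intros; apply Hl; right; assumption. intros H; apply Hz; right; assumption.
Qed.

Definition in_disc (t : R) (b : C) : bool := if Rle_dec (Cmod b) t then true else false.

(** Transfers an upper bound for [zero_count] to the list of factors. The number of occurrences of
    [b] is its exact multiplicity, since nothing else vanishes there: the other copies are removed,
    [l2] lies outside the disc of radius [t], and [g] has no zero in the disc of radius [r]. *)
Lemma zero_count_ge a r l g t : factors a r l g -> (forall z, Cmod z <= r -> ps g z <> 0%C) -> t <= r ->
  forall F, (forall z, F z = ps a z) -> Rbar_le (INR (length (filter (in_disc t) l))) (zero_count F t).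
Proof.
  intros (Hg & Hl & E) Hnz Htr F HF.
  set (l1 := filter (in_disc t) l). set (l2 := filter (fun b => negb (in_disc t b)) l).
  assert (Hl1 : forall b, In b l1 -> In b l /\ Cmod b <= t).
  { intros b Hb. apply filter_In in Hb. destruct Hb as [H1 H2]. split. exact H1.
    unfold in_disc in H2. destruct (Rle_dec (Cmod b) t). assumption. discriminate. }
  assert (Hl2 : forall b, In b l2 -> In b l /\ t < Cmod b).
  { intros b Hb. apply filter_In in Hb. destruct Hb as [H1 H2]. split. exact H1.
    unfold in_disc in H2. destruct (Rle_dec (Cmod b) t). discriminate. apply Rnot_le_lt; assumption. }
  assert (Hsplit : forall z, canonical l z = (canonical l1 z * canonical l2 z)%C).
  { intros z. unfold l1, l2. clear. induction l as [|b l IH]; simpl. ring.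
    destruct (in_disc t b); simpl; rewrite IH; ring. }
  destruct (multiplicity_list l1) as (L & HL1 & HL2 & HL3).
  unfold zero_count. destruct (Lub_Rbar_correct (fun x : R =>
    exists l : list (C * nat), NoDup (map fst l) /\ (forall (a : C) (m : nat), In (a, m) l -> Cmod a <= t /\ is_zero_of_mult F a m) /\ x = INR (list_sum (map snd l)))) as [Hub _].
  apply Hub. exists L. split. exact HL1. split. 2: rewrite HL2; reflexivity.
  intros b m Hin. destruct (HL3 b m Hin) as [Hb Hm]. destruct (Hl1 b Hb) as [Hbl Hbt]. split. exact Hbt.
  destruct (Hl b Hbl) as [Nb Hbr].
  assert (Hpos : (0 < m)%nat). { rewrite Hm. apply count_occ_In. exact Hb. }
  assert (Eq : forall z, F z = ((z - b) ^ m * ((- / b) ^ m * canonical (remove Ceq_dec b l1) z * canonical l2 z * ps g z))%C).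
  { intros z. rewrite HF, E, Hsplit, (canonical_remove l1 b z Nb), <- Hm. ring. }
  split.
  - rewrite Eq. destruct m as [|m]. lia. simpl. ring.
  - exists (fun z => (- / b) ^ m * canonical (remove Ceq_dec b l1) z * canonical l2 z * ps g z)%C.
    split; [|split]; [| |exact Eq].
    + intros z.
      assert (Hh : holo (fun _ => True) (fun z => (- / b) ^ m * canonical (remove Ceq_dec b l1) z * canonical l2 z * ps g z)%C)
        by (holo; (apply holo_canonical || apply holo_ps, Hg)).
      destruct Hh as (f' & Hf'). exact (cder_ex_derive _ _ _ (proj1 (Hf' z I))).
    + repeat apply Cmult_neq_0.
      * assert (Nz : (- / b)%C <> 0%C).
        { intros E1. apply Nb. replace b with (- (- / b) * (b * b))%C by (field; exact Nb). rewrite E1. ring. }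
        clear - Nz. induction m; simpl. intros E1; apply RtoC_inj in E1; lra. apply Cmult_neq_0; assumption.
      * apply canonical_nz. intros x Hx. apply in_remove in Hx. apply Hl, Hl1, Hx. apply remove_In.
      * apply canonical_nz. intros x Hx. apply Hl, Hl2, Hx. intros Hx. destruct (Hl2 b Hx). lra.
      * apply Hnz, Hbr.
Qed.

(** * Primitives and a Phragmen-Lindelof bound *)

Definition continuity_2d_C (g : R -> R -> C) (x y : R) : Prop :=
  continuity_2d_pt (fun u v => Re (g u v)) x y /\ continuity_2d_pt (fun u v => Im (g u v)) x y.

Lemma c2d_const a x y : continuity_2d_C (fun _ _ => a) x y.
Proof. split; apply continuity_2d_pt_const. Qed.

Lemma c2d_fst x y : continuity_2d_C (fun u _ => RtoC u) x y.
Proof. split; simpl. apply continuity_2d_pt_id1. apply continuity_2d_pt_const. Qed.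

Lemma c2d_snd x y : continuity_2d_C (fun _ v => RtoC v) x y.
Proof. split; simpl. apply continuity_2d_pt_id2. apply continuity_2d_pt_const. Qed.

Lemma c2d_plus g h x y : continuity_2d_C g x y -> continuity_2d_C h x y ->
  continuity_2d_C (fun u v => g u v + h u v)%C x y.
Proof.
  intros [A B] [A' B']. split.
  - apply (continuity_2d_pt_plus _ _ x y A A').
  - apply (continuity_2d_pt_plus _ _ x y B B').
Qed.

Lemma c2d_mult g h x y : continuity_2d_C g x y -> continuity_2d_C h x y ->
  continuity_2d_C (fun u v => g u v * h u v)%C x y.
Proof.
  intros [A B] [A' B']. split.
  - apply continuity_2d_pt_ext with (fun u v => Re (g u v) * Re (h u v) - Im (g u v) * Im (h u v)).
    intros; rring. apply continuity_2d_pt_minus; apply continuity_2d_pt_mult; assumption.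
  - apply continuity_2d_pt_ext with (fun u v => Re (g u v) * Im (h u v) + Im (g u v) * Re (h u v)).
    intros; rring. apply continuity_2d_pt_plus; apply continuity_2d_pt_mult; assumption.
Qed.

Lemma c2d_comp f g x y : continuity_2d_C g x y -> ccont f (g x y) ->
  continuity_2d_C (fun u v => f (g u v)) x y.
Proof. intros [A B] Hf. apply continuity_2d_comp; assumption. Qed.

Lemma rcder_fst (s : R) : rcder RtoC s 1%C.
Proof.
  intros eps He. exists 1. split. lra. intros h _.
  replace (_ - _)%C with (RtoC 0). rewrite Cmod_0. generalize (Rabs_pos h); nra.
  rewrite RtoC_plus. ring.
Qed.

Lemma Cmod_scal_le (t : R) (z : C) (rho : R) : 0 <= t <= 1 -> Cmod z < rho -> Cmod (t * z)%C < rho.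
Proof.
  intros Ht Hz. rewrite Cmod_mult, Cmod_R, Rabs_pos_eq by lra. generalize (Cmod_ge_0 z). nra.
Qed.

(** With [w = z + s * k], the derivative in [s] of [w * f (t * w)] is also the derivative in [t] of
    [t * f (t * w) * k]. Hence the differentiated integral over [t] telescopes to [f w * k]. *)
Lemma ray_integral_der (f f' : C -> C) (rho : R) (c z k : C) (s : R) :
  (forall z, Cmod z < rho -> cder f z (f' z) /\ ccont f' z) ->
  Cmod (z + s * k)%C < rho ->
  is_derive (fun s : R => RInt (fun t : R => Re (c * ((z + s * k) * f (t * (z + s * k))))%C) 0 1) s
    (Re (c * (f (z + s * k) * k))%C).
Proof.
  intros Hf Hs.
  assert (H01 : Rmin 0 1 = 0 /\ Rmax 0 1 = 1). { rewrite Rmin_left, Rmax_right; lra. }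
  destruct H01 as [Em EM].
  assert (Hd : 0 < (rho - Cmod (z + s * k)%C) / (Cmod k + 1)).
  { apply Rdiv_lt_0_compat. lra. generalize (Cmod_ge_0 k); lra. }
  assert (L : forall u : R, Rabs (u - s) < (rho - Cmod (z + s * k)%C) / (Cmod k + 1) -> Cmod (z + u * k)%C < rho).
  { intros u Hu. replace (z + u * k)%C with ((z + s * k) + (u - s)%R * k)%C by (rewrite RtoC_minus; ring).
    eapply Rle_lt_trans; [apply Cmod_triangle|]. rewrite Cmod_mult, Cmod_R.
    generalize (Cmod_ge_0 k) (Rabs_pos (u - s)). intros.
    assert (Rabs (u - s) * (Cmod k + 1) < rho - Cmod (z + s * k)%C).
    { apply Rmult_lt_compat_r with (r := Cmod k + 1) in Hu; [|lra].
      replace ((rho - Cmod (z + s * k)%C) / (Cmod k + 1) * (Cmod k + 1)) with (rho - Cmod (z + s * k)%C) in Hu by (field; lra).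
      exact Hu. }
    nra. }
  set (P := fun (u t : R) => (c * (f (t * (z + u * k)) * k + t * ((z + u * k) * (f' (t * (z + u * k)) * k))))%C).
  assert (D : forall u t : R, Cmod (t * (z + u * k))%C < rho ->
     is_derive (fun u : R => Re (c * ((z + u * k) * f (t * (z + u * k))))%C) u (Re (P u t))).
  { intros u t Hut. apply (rcder_Re (fun u : R => c * ((z + u * k) * f (t * (z + u * k))))%C).
    eapply rcder_eq.
    apply (rcder_comp (fun w => c * (w * f (t * w)))%C (fun u : R => z + u * k)%C). apply rcder_line.
    apply cder_scal. apply (cder_mult (fun w => w)). apply cder_id.
    apply (cder_comp (fun w => t * w)%C). apply cder_scal, cder_id.
    apply Hf, Hut. unfold P. ring. }
  assert (Cz : forall u t, continuity_2d_C (fun u _ : R => z + u * k)%C u t).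
  { intros u t. apply c2d_plus. apply c2d_const. apply c2d_mult. apply c2d_fst. apply c2d_const. }
  assert (Ctz : forall u t, continuity_2d_C (fun u t : R => t * (z + u * k))%C u t).
  { intros u t. apply c2d_mult. apply c2d_snd. apply Cz. }
  assert (CP : forall u t : R, Cmod (z + u * k)%C < rho -> 0 <= t <= 1 -> continuity_2d_C P u t).
  { intros u t Hu Ht. unfold P. destruct (Hf (t * (z + u * k))%C) as [F1 F2]. apply Cmod_scal_le; assumption.
    apply c2d_mult. apply c2d_const. apply c2d_plus. apply c2d_mult.
    apply (c2d_comp f (fun u t : R => t * (z + u * k))%C). apply Ctz. eapply cder_ccont, F1.
    apply c2d_const. apply c2d_mult. apply c2d_snd. apply c2d_mult. apply Cz. apply c2d_mult.
    apply (c2d_comp f' (fun u t : R => t * (z + u * k))%C). apply Ctz. exact F2. apply c2d_const. }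
  assert (E : RInt (fun t : R => Derive (fun u : R => Re (c * ((z + u * k) * f (t * (z + u * k))))%C) s) 0 1 =
     Re (c * (f (z + s * k) * k))%C).
  { apply is_RInt_unique. apply is_RInt_ext with (fun t => Re (P s t)).
    { intros t Ht. rewrite Em, EM in Ht. symmetry. apply is_derive_unique, D, Cmod_scal_le. lra. exact Hs. }
    replace (Re (c * (f (z + s * k) * k))%C) with
      (minus (Re (c * (1%R * (f (1%R * (z + s * k)) * k)))%C) (Re (c * (0%R * (f (0%R * (z + s * k)) * k)))%C)).
    2:{ unfold minus, plus, opp; simpl AbelianGroup.sort. 
        replace (1%R * (z + s * k))%C with (z + s * k)%C by ring. simpl; unfold Re, Im; ring. }
    apply (is_RInt_derive (fun t : R => Re (c * (t * (f (t * (z + s * k)) * k)))%C)).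
    - intros t Ht. rewrite Em, EM in Ht.
      apply (rcder_Re (fun t : R => c * (t * (f (t * (z + s * k)) * k)))%C).
      eapply rcder_eq.
      apply (rcder_comp (fun w => c * (w * (f (w * (z + s * k)) * k)))%C RtoC). apply rcder_fst.
      apply cder_scal. apply (cder_mult (fun w => w)). apply cder_id.
      apply (cder_mult (fun w => f (w * (z + s * k)))%C (fun _ => k)).
      apply (cder_comp (fun w => w * (z + s * k))%C). apply (cder_mult (fun w => w)). apply cder_id. apply cder_const.
      apply Hf. apply Cmod_scal_le; assumption. apply cder_const. unfold P. ring.
    - intros t Ht. rewrite Em, EM in Ht. apply (continuity_2d_slice (fun u v => Re (P u v))).
      apply CP; assumption. }
  refine (eq_ind _ (fun l => is_derive _ s l) _ _ E). clear E.
  apply (is_derive_RInt_param (fun u t : R => Re (c * ((z + u * k) * f (t * (z + u * k))))%C)).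
  - exists (mkposreal _ Hd). intros u Hu t Ht. rewrite Em, EM in Ht. eexists. apply D, Cmod_scal_le. exact Ht. apply L, Hu.
  - intros t Ht. rewrite Em, EM in Ht.
    destruct (CP s t Hs Ht) as [C1 _].
    apply continuity_2d_pt_ext_loc with (fun u v : R => Re (P u v)); [|exact C1].
    assert (Ct : continuity_2d_C (fun u t : R => t * (z + u * k))%C s t) by apply Ctz.
    destruct Ct as [Ct1 Ct2].
    assert (Hlt : Cmod (t * (z + s * k))%C < rho) by (apply Cmod_scal_le; assumption).
    assert (Hq : 0 < (rho - Cmod (t * (z + s * k))%C) / 2) by lra.
    destruct (Ct1 (mkposreal _ Hq)) as [d1 K1]. destruct (Ct2 (mkposreal _ Hq)) as [d2 K2]. cbn [pos] in K1, K2.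
    assert (Hm : 0 < Rmin d1 d2) by (apply Rmin_pos; apply cond_pos).
    exists (mkposreal _ Hm). cbn [pos]. intros u v Hu Hv. symmetry. apply is_derive_unique.
    specialize (K1 u v (Rlt_le_trans _ _ _ Hu (Rmin_l _ _)) (Rlt_le_trans _ _ _ Hv (Rmin_l _ _))).
    specialize (K2 u v (Rlt_le_trans _ _ _ Hu (Rmin_r _ _)) (Rlt_le_trans _ _ _ Hv (Rmin_r _ _))).
    assert (Huv : Cmod (v * (z + u * k))%C < rho).
    { replace (v * (z + u * k))%C with ((t * (z + s * k)) + (v * (z + u * k) - t * (z + s * k)))%C by ring.
      eapply Rle_lt_trans; [apply Cmod_triangle|].
      assert (Cmod (v * (z + u * k) - t * (z + s * k))%C < rho - Cmod (t * (z + s * k))%C); [|lra].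
      eapply Rle_lt_trans; [apply Cmod_le_abs|].
      replace (Re (v * (z + u * k) - t * (z + s * k))%C) with (Re (v * (z + u * k))%C - Re (t * (z + s * k))%C) by rring.
      replace (Im (v * (z + u * k) - t * (z + s * k))%C) with (Im (v * (z + u * k))%C - Im (t * (z + s * k))%C) by rring.
      lra. }
    apply D, Huv.
  - exists (mkposreal _ Hd). intros u Hu. apply (ex_RInt_continuous (V := R_CompleteNormedModule)).
    intros t Ht. rewrite Em, EM in Ht.
    apply (continuity_2d_slice (fun u t : R => Re (c * ((z + u * k) * f (t * (z + u * k))))%C)).
    apply c2d_mult. apply c2d_const. apply c2d_mult. apply Cz.
    apply (c2d_comp f (fun u t : R => t * (z + u * k))%C). apply Ctz.
    eapply cder_ccont, Hf. apply Cmod_scal_le. exact Ht. apply L, Hu.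
Qed.

(** The candidate is the integral of [f] along the ray from 0. Its derivative along every line is
    known from the previous lemma; the mean value theorem and continuity of [f] turn these into a
    complex derivative. *)
Lemma primitive (f f' : C -> C) (rho : R) :
  (forall z, Cmod z < rho -> cder f z (f' z) /\ ccont f' z) ->
  exists h : C -> C, h 0%C = 0%C /\ forall z, Cmod z < rho -> cder h z (f z).
Proof.
  intros Hf.
  set (H := fun (c z : C) => RInt (fun t : R => Re (c * (z * f (t * z)))%C) 0 1).
  (* Real integrals suffice: [Re (- Ci * w)] is the imaginary part of [w]. *)
  set (h := fun z => (H 1%C z, H (- Ci)%C z) : C).
  exists h. split.
  { assert (E : forall c, H c 0%C = 0).
    { intros c. unfold H. rewrite (RInt_ext _ (fun _ => 0)). rewrite RInt_const. unfold scal; simpl; unfold mult; simpl; ring.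
      intros t _. replace (c * (0 * f (t * 0)))%C with (RtoC 0) by ring. reflexivity. }
    unfold h. rewrite !E. reflexivity. }
  assert (D : forall (z k : C) (s : R), Cmod (z + s * k)%C < rho ->
     rcder (fun s : R => h (z + s * k)%C) s (f (z + s * k) * k)%C).
  { intros z k s Hs. eapply rcder_eq. apply rcder_pair.
    - apply (ray_integral_der f f' rho 1 z k s Hf Hs).
    - apply (ray_integral_der f f' rho (- Ci) z k s Hf Hs).
    - cring. }
  intros z Hz eps He.
  destruct (Hf z Hz) as [F1 _]. destruct (cder_ccont _ _ _ F1 eps He) as (d & Hd & Hk).
  exists (Rmin d (rho - Cmod z)). split. apply Rmin_pos; lra. intros k Hkd.
  assert (Hk1 := Rlt_le_trans _ _ _ Hkd (Rmin_l _ _)). assert (Hk2 := Rlt_le_trans _ _ _ Hkd (Rmin_r _ _)).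
  assert (Hin : forall s : R, 0 <= s <= 1 -> Cmod (s * k)%C <= Cmod k /\ Cmod (z + s * k)%C < rho).
  { intros s Hs. assert (Cmod (s * k)%C <= Cmod k).
    { rewrite Cmod_mult, Cmod_R, Rabs_pos_eq by lra. generalize (Cmod_ge_0 k); nra. }
    split. assumption. generalize (Cmod_triangle z (s * k)%C). lra. }
  apply Cmod_le_Re. apply Rmult_le_pos; [lra|apply Cmod_ge_0].
  intros c Hc.
  assert (Dc : forall s : R, 0 <= s <= 1 -> is_derive (fun s : R => Re (c * h (z + s * k))%C) s (Re (c * (f (z + s * k) * k))%C)).
  { intros s Hs. apply (rcder_Re (fun s : R => c * h (z + s * k))%C).
    eapply rcder_eq. apply (rcder_comp (fun w => c * w)%C (fun s : R => h (z + s * k)%C)). apply D, Hin, Hs.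
    apply cder_scal, cder_id. ring. }
  destruct (MVT_derive _ _ 0 1 Rle_0_1 Dc) as (s & Hs & E). cbv beta in E.
  replace (z + 1%R * k)%C with (z + k)%C in E by ring.
    replace (z + 0%R * k)%C with z in E by ring.
    replace (Re (c * (h (z + k) - h z - f z * k))%C) with
      (Re (c * h (z + k))%C - Re (c * h z)%C - Re (c * (f z * k))%C) by rring.
    rewrite E.
    replace (Re (c * (f (z + s * k) * k))%C * (1 - 0) - Re (c * (f z * k))%C) with
      (Re (c * ((f (z + s * k) - f z) * k))%C) by rring.
    eapply Rle_trans; [apply Re_le_Cmod|]. rewrite !Cmod_mult, Hc, Rmult_1_l.
    apply Rmult_le_compat_r. apply Cmod_ge_0. apply Hk. eapply Rle_lt_trans; [apply Hin, Hs|exact Hk1].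
Qed.

Lemma cder_zero_const (f : C -> C) (rho : R) :
  (forall z, Cmod z < rho -> cder f z 0%C) -> forall z, Cmod z < rho -> f z = f 0%C.
Proof.
  intros H z Hz.
  assert (M := mean_value_ineq f (fun _ => 0%C) 0%C z 0 (Rle_refl 0)).
  assert (Cmod (f z - f 0)%C <= 0 * Cmod (z - 0)%C).
  { apply M. intros t Ht. apply H. replace (0 + t * (z - 0))%C with (t * z)%C by ring. apply Cmod_scal_le; assumption.
    intros. rewrite Cmod_0; lra. }
  rewrite Rmult_0_l in H0. assert (E : (f z - f 0)%C = 0%C).
  { apply Cmod_eq_0. apply Rle_antisym. exact H0. apply Cmod_ge_0. }
  replace (f z) with ((f z - f 0) + f 0)%C by ring. rewrite E. ring.
Qed.

Lemma exp_of_log_derivative (g q h : C -> C) (rho : R) : h 0%C = 0%C ->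
  (forall z, Cmod z < rho -> cder g z (q z * g z)%C /\ cder h z (q z)) ->
  forall z, Cmod z < rho -> g z = (g 0%C * Cexp (h z))%C.
Proof.
  intros H0 H z Hz.
  assert (E := cder_zero_const (fun z => g z * Cexp (- h z))%C rho).
  assert (E1 : (g z * Cexp (- h z))%C = (g 0%C * Cexp (- h 0%C))%C).
  { apply (E); [|exact Hz]. clear z Hz. intros z Hz. destruct (H z Hz) as [H1 H2].
    eapply cder_eq. apply (cder_mult g (fun z => Cexp (- h z))%C). apply H1.
    apply (cder_comp (fun z => - h z)%C Cexp). apply cder_opp, H2. apply cder_Cexp. cbv beta. ring. }
  rewrite H0 in E1. replace (- 0)%C with (RtoC 0) in E1 by ring. rewrite Cexp_0, Cmult_1_r in E1.
  rewrite <- E1. rewrite <- Cmult_assoc, (Cmult_comm (Cexp (- h z))), Cexp_opp. ring.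
Qed.

Lemma Cmod_outside (s : R) (z k : C) : Cmod k < Cmod z - s -> s < Cmod (z + k)%C.
Proof.
  intros H. generalize (Cmod_triangle_inv z (- k)). rewrite Cmod_opp. replace (z - - k)%C with (z + k)%C by ring. lra.
Qed.

Lemma disc_max (f : C -> C) (s s' M : R) : 0 <= M -> s < s' -> holo (fun z => Cmod z < s') f ->
  (forall z, Cmod z = s -> Cmod (f z) <= M) -> forall z, Cmod z <= s -> Cmod (f z) <= M.
Proof.
  intros HM Hs Hf Hb. apply (max_principle (fun z => Cmod z <= s) f M s HM).
  - auto.
  - intros z Hz. apply Rnot_le_lt in Hz. exists (Cmod z - s). split. lra. intros k Hk.
    apply Rlt_not_le, Cmod_outside, Hk.
  - intros z Hz. apply (holo_ccont _ _ _ Hf). lra.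
  - intros z Hz. destruct (Rle_lt_or_eq_dec _ _ Hz) as [Hlt|E].
    + right. exists (s - Cmod z). split. lra. split.
      * intros k Hk. generalize (Cmod_triangle z k). lra.
      * refine (holo_sub _ _ _ _ Hf). intros w Hw. generalize (Cmod_triangle z (w - z)%C).
        replace (z + (w - z))%C with w by ring. lra.
    + left. apply Hb, E.
Qed.

(** Phragmen-Lindelof for a half disc: [A * (Re z^2 + 2 s Im z) / s^2] is a harmonic majorant of
    the boundary values of [ln |f / M|]. *)
Lemma half_disc_bound (f : C -> C) (s s' M A : R) : 0 < s < s' -> 0 <= M -> 0 <= A ->
  holo (fun z => Cmod z < s') f ->
  (forall x : R, Rabs x <= s -> Cmod (f x) <= M * exp (A * (x / s) ^ 2)) ->
  (forall z, Cmod z = s -> 0 <= Im z -> Cmod (f z) <= M * exp A) ->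
  forall z, Cmod z <= s -> 0 <= Im z -> Cmod (f z) <= M * exp (3 * A * (Cmod z / s)).
Proof.
  intros [Hs Hss] HM HA Hf Hreal Hcirc z0 Hz0 Hi0.
  set (B := A / s ^ 2).
  set (p := fun z : C => ((- B)%R * (z * z - 2 * Ci * s * z))%C).
  assert (Hs2 : 0 < s ^ 2) by (apply pow_lt, Hs).
  assert (HB : 0 <= B). { apply Rmult_le_pos. exact HA. left; apply Rinv_0_lt_compat, Hs2. }
  assert (HBs : B * s ^ 2 = A) by (unfold B; field; lra).
  assert (Rep : forall z, Re (p z) = - (B * ((Re z) ^ 2 - (Im z) ^ 2 + 2 * s * Im z))).
  { intros z. unfold p. rring. }
  assert (Hg : holo (fun z => Cmod z < s') (fun z => f z * Cexp (p z))%C).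
  { apply holo_mult. exact Hf. apply holo_Cexp. unfold p. holo. }
  assert (G : Cmod (f z0 * Cexp (p z0))%C <= M).
  { apply (max_principle (fun z => Cmod z <= s /\ 0 <= Im z) (fun z => f z * Cexp (p z))%C M s HM); [| | | |split; assumption].
    - intros z [H _]; exact H.
    - intros z Hz. destruct (Rle_dec (Cmod z) s) as [H1|H1].
      + assert (H2 : Im z < 0). { apply Rnot_le_lt. intros H2. apply Hz; split; assumption. }
        exists (- Im z). split. lra. intros k Hk [_ H3]. generalize (im_le_Cmod k). simpl in H3.
        intros H4. apply Rabs_le_between in H4. unfold Im in *. lra.
      + apply Rnot_le_lt in H1. exists (Cmod z - s). split. lra. intros k Hk [H2 _].
        generalize (Cmod_outside s z k Hk). lra.
    - intros z [Hz _]. apply (holo_ccont _ _ _ Hg). lra.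
    - intros z [Hz Hi].
      destruct (Rle_lt_or_eq_dec _ _ Hz) as [Hlt|E].
      + destruct (Rle_lt_or_eq_dec _ _ Hi) as [Hil|Ei].
        * right. exists (Rmin (s - Cmod z) (Im z)). split. apply Rmin_pos; lra.
          generalize (Rmin_l (s - Cmod z) (Im z)) (Rmin_r (s - Cmod z) (Im z)). intros M1 M2. split.
          -- intros k Hk. split. generalize (Cmod_triangle z k). lra.
             generalize (im_le_Cmod k). intros H4. apply Rabs_le_between in H4. simpl. unfold Im in *. lra.
          -- refine (holo_sub _ _ _ _ Hg). intros w Hw. generalize (Cmod_triangle z (w - z)%C).
             replace (z + (w - z))%C with w by ring. lra.
        * left. assert (Ez : z = RtoC (Re z)). { apply C_ext; simpl; auto. }
          rewrite Cmod_mult, Cmod_Cexp, Rep, <- Ei.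
          assert (Hx : Rabs (Re z) <= s) by (eapply Rle_trans; [apply re_le_Cmod|exact Hz]).
          specialize (Hreal _ Hx). rewrite <- Ez in Hreal.
          replace (- (B * (Re z ^ 2 - 0 ^ 2 + 2 * s * 0))) with (- (A * (Re z / s) ^ 2)) by (unfold B; field; lra).
          rewrite exp_Ropp. assert (Hp := exp_pos (A * (Re z / s) ^ 2)).
          apply Rmult_le_reg_r with (exp (A * (Re z / s) ^ 2)). exact Hp.
          rewrite Rmult_assoc, Rinv_l by lra. lra.
      + left. rewrite Cmod_mult, Cmod_Cexp, Rep. specialize (Hcirc z E Hi).
        assert (E2 : Re z ^ 2 + Im z ^ 2 = s ^ 2) by (rewrite <- Cmod2_alt, E; reflexivity).
        (* On the circle the bracket equals [s ^ 2 + 2 * Im z * (s - Im z)], and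
           [0 <= Im z <= s]. *)
        assert (Hle : A <= B * (Re z ^ 2 - Im z ^ 2 + 2 * s * Im z)).
        { rewrite <- HBs. apply Rmult_le_compat_l. exact HB.
          assert (Im z <= s). { generalize (im_le_Cmod z) (Rle_abs (Im z)). lra. } nra. }
        assert (exp (- (B * (Re z ^ 2 - Im z ^ 2 + 2 * s * Im z))) <= exp (- A)).
        { destruct (Req_dec A (B * (Re z ^ 2 - Im z ^ 2 + 2 * s * Im z))) as [<-|N]. lra.
          left; apply exp_increasing; lra. }
        assert (exp A * exp (- A) = 1) by (rewrite <- exp_plus, Rplus_opp_r, exp_0; reflexivity).
        generalize (Cmod_ge_0 (f z)) (exp_pos (- A)) (exp_pos A). intros.
        apply Rle_trans with (Cmod (f z) * exp (- A)). apply Rmult_le_compat_l; assumption.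
        apply Rle_trans with (M * exp A * exp (- A)). apply Rmult_le_compat_r; lra.
        rewrite Rmult_assoc, H0. lra. }
  rewrite Cmod_mult, Cmod_Cexp, Rep in G.
  (* The 3 is 1 + 2: the quadratic part is at most [s * Cmod z0] and the linear part at most twice
     that. *)
  assert (Hle : B * (Re z0 ^ 2 - Im z0 ^ 2 + 2 * s * Im z0) <= 3 * A * (Cmod z0 / s)).
  { replace (3 * A * (Cmod z0 / s)) with (B * (3 * s * Cmod z0)) by (rewrite <- HBs; field; lra).
    apply Rmult_le_compat_l. exact HB.
    assert (Im z0 <= Cmod z0). { generalize (im_le_Cmod z0) (Rle_abs (Im z0)). lra. }
    assert (Re z0 ^ 2 + Im z0 ^ 2 = Cmod z0 ^ 2) by (rewrite <- Cmod2_alt; reflexivity).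
    generalize (Cmod_ge_0 z0). nra. }
  set (X := B * (Re z0 ^ 2 - Im z0 ^ 2 + 2 * s * Im z0)) in *.
  rewrite exp_Ropp in G. assert (Hp := exp_pos X).
  apply Rle_trans with (M * exp X).
  { apply Rmult_le_compat_r with (r := exp X) in G; [|lra]. rewrite Rmult_assoc, Rinv_l in G by lra. lra. }
  apply Rmult_le_compat_l. exact HM.
  destruct (Req_dec X (3 * A * (Cmod z0 / s))) as [<-|N]. lra. left; apply exp_increasing; lra.
Qed.

Lemma upper_sqrt (z : C) : exists w, (w * w)%C = z /\ 0 <= Im w /\ Cmod w = sqrt (Cmod z).
Proof.
  set (m := Cmod z). assert (Hm := Cmod_ge_0 z). fold m in Hm.
  assert (Hx := re_le_Cmod z). fold m in Hx. apply Rabs_le_between in Hx.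
  assert (E : Re z ^ 2 + Im z ^ 2 = m ^ 2) by (unfold m; rewrite Cmod2_alt; reflexivity).
  set (x := sqrt ((m + Re z) / 2)). set (y := sqrt ((m - Re z) / 2)).
  assert (Ex : x * x = (m + Re z) / 2) by (apply sqrt_sqrt; lra).
  assert (Ey : y * y = (m - Re z) / 2) by (apply sqrt_sqrt; lra).
  assert (Px : 0 <= x) by apply sqrt_pos. assert (Py : 0 <= y) by apply sqrt_pos.
  assert (Exy : (2 * x * y) ^ 2 = (Im z) ^ 2). { replace ((2 * x * y)^2) with (4 * (x * x) * (y * y)) by ring. rewrite Ex, Ey. nra. }
  assert (Hw : exists w, (w * w)%C = z /\ 0 <= Im w).
  { destruct (Rle_dec 0 (Im z)) as [Hi|Hi].
    - exists (x, y). split; [|exact Py]. apply C_ext; simpl. unfold Re in *; simpl; lra.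
      assert (2 * x * y = Im z); [|unfold Im in *; simpl; lra].
      apply Rsqr_inj. apply Rmult_le_pos; lra. exact Hi. unfold Rsqr. lra.
    - exists (- x, y). split; [|exact Py]. apply C_ext; simpl. unfold Re in *; simpl; lra.
      assert (2 * x * y = - Im z); [|unfold Im in *; simpl; lra].
      apply Rsqr_inj. apply Rmult_le_pos; lra. lra. unfold Rsqr. lra. }
  destruct Hw as (w & Hw & Hi). exists w. split. exact Hw. split. exact Hi.
  unfold m. rewrite <- Hw, Cmod_mult. rewrite sqrt_square. reflexivity. apply Cmod_ge_0.
Qed.

(** * Products with positive zeroes *)

Definition rotated (l : list C) : list C := map (fun b => RtoC (Cmod b)) l.

(* The maximum modulus of [canonical (rotated l)] on [|z| = r], attained at [-r]. *)
Fixpoint growth (l : list C) (r : R) : R :=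
  match l with nil => 1 | b :: l => (1 + r / Cmod b) * growth l r end.

Definition nonzero (l : list C) : Prop := forall b, In b l -> b <> RtoC 0.

Lemma nonzero_rotated l : nonzero l -> nonzero (rotated l).
Proof.
  intros H b Hb. apply in_map_iff in Hb. destruct Hb as (x & <- & Hx). intros E. apply RtoC_inj in E.
  apply Cmod_eq_0 in E. apply (H x Hx E).
Qed.

Lemma growth_ge_1 l r : nonzero l -> 0 <= r -> 1 <= growth l r.
Proof.
  intros H Hr. induction l as [|b l IH]; simpl. lra.
  assert (Hb : 0 < Cmod b) by (apply Cmod_gt_0, H; left; reflexivity).
  assert (0 <= r / Cmod b) by (apply Rmult_le_pos; [lra|left; apply Rinv_0_lt_compat, Hb]).
  assert (1 <= growth l r) by (apply IH; intros x Hx; apply H; right; exact Hx). nra.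
Qed.

Lemma growth_ge l r a : nonzero l -> 0 <= r -> In a l -> 1 + r / Cmod a <= growth l r.
Proof.
  intros H Hr. induction l as [|b l IH]; intros Ha. destruct Ha. simpl.
  assert (Hb : 0 < Cmod b) by (apply Cmod_gt_0, H; left; reflexivity).
  assert (0 <= r / Cmod b) by (apply Rmult_le_pos; [lra|left; apply Rinv_0_lt_compat, Hb]).
  assert (Hl : nonzero l) by (intros x Hx; apply H; right; exact Hx).
  assert (1 <= growth l r) by (apply growth_ge_1; assumption).
  destruct Ha as [->|Ha]. nra. specialize (IH Hl Ha). nra.
Qed.

Lemma growth_rotated l r : growth (rotated l) r = growth l r.
Proof.
  induction l as [|b l IH]; simpl. reflexivity. rewrite IH, Cmod_R, Rabs_pos_eq. reflexivity. apply Cmod_ge_0.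
Qed.

Lemma canonical_le l z : nonzero l -> Cmod (canonical l z) <= growth l (Cmod z).
Proof.
  intros H. induction l as [|b l IH]; simpl. rewrite Cmod_1; lra.
  rewrite Cmod_mult. apply Rmult_le_compat. apply Cmod_ge_0. apply Cmod_ge_0.
  - eapply Rle_trans; [apply Cmod_minus_le|]. rewrite Cmod_1, Cmod_div. lra. apply H; left; reflexivity.
  - apply IH. intros x Hx; apply H; right; exact Hx.
Qed.

Lemma rotated_le l z : nonzero l -> Cmod (canonical (rotated l) (Cmod z)) <= Cmod (canonical l z).
Proof.
  intros H. induction l as [|b l IH]; simpl. lra.
  rewrite !Cmod_mult. apply Rmult_le_compat. apply Cmod_ge_0. apply Cmod_ge_0.
  - assert (Nb : b <> RtoC 0) by (apply H; left; reflexivity).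
    assert (Hb : 0 < Cmod b) by (apply Cmod_gt_0; exact Nb).
    replace (1 - Cmod z / Cmod b)%C with (RtoC (1 - Cmod z / Cmod b)%R).
    2:{ rewrite RtoC_minus, RtoC_div by lra. reflexivity. }
    rewrite Cmod_R, <- (Cmod_div z b Nb). apply Rabs_le. split.
    + generalize (Cmod_triangle_inv (z / b)%C 1%C). rewrite Cmod_1, (Cmod_minus_sym (z/b)%C 1%C). lra.
    + generalize (Cmod_triangle_inv 1%C (z / b)%C). rewrite Cmod_1. lra.
  - apply IH. intros x Hx; apply H; right; exact Hx.
Qed.

Lemma rotated_neg l t : nonzero l -> canonical (rotated l) (RtoC (- t)) = RtoC (growth l t).
Proof.
  intros H. induction l as [|b l IH]; simpl. reflexivity.
  rewrite IH by (intros x Hx; apply H; right; exact Hx).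
  assert (Nb : Cmod b <> 0). { intros E. apply Cmod_eq_0 in E. apply (H b (or_introl eq_refl) E). }
  rewrite RtoC_mult, RtoC_plus, RtoC_div, RtoC_opp by exact Nb. field. intros E. apply RtoC_inj in E. contradiction.
Qed.

(** [half_disc_bound] applied to the product at [z ^ 2], with [A = d * s]: the real diameter covers
    the positive ray twice, and [Ci * sqrt t] lands on [- t]. The factor [s] cancels in the
    conclusion, which depends on the disc through [d] alone. *)
Lemma growth_nonneg_bound l C0 s d : nonzero l -> 0 < s -> 0 <= C0 -> 0 <= d ->
  (forall r, 0 <= r <= s ^ 2 -> Cmod (canonical (rotated l) r) <= exp (C0 + d * r / s)) ->
  growth l (s ^ 2) <= exp (d * s) ->
  forall t, 0 <= t <= s ^ 2 -> growth l t <= exp (C0 + 3 * d * sqrt t).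
Proof.
  intros Hl Hs HC Hd Hreal Hcirc t Ht.
  assert (Hsq : 0 <= sqrt t <= s).
  { split. apply sqrt_pos. rewrite <- (sqrt_pow2 s) by lra. apply sqrt_le_1; lra. }
  assert (HM : 1 <= exp C0). { rewrite <- exp_0. destruct (Req_dec 0 C0) as [<-|N]. lra. left; apply exp_increasing; lra. }
  assert (Ew : Cmod (Ci * sqrt t)%C = sqrt t).
  { rewrite Cmod_mult, Cmod_Ci, Cmod_R, Rabs_pos_eq; lra. }
  assert (Bz : Cmod (canonical (rotated l) (Ci * sqrt t * (Ci * sqrt t))%C) <=
    exp C0 * exp (3 * (d * s) * (Cmod (Ci * sqrt t)%C / s))).
  { apply (half_disc_bound (fun z => canonical (rotated l) (z * z)%C) s (s + 1)); try lra. nra.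
    - apply (holo_comp _ (fun _ => True) (fun z => z * z)%C); [holo|apply holo_canonical|auto].
    - intros x Hx. rewrite <- RtoC_mult. rewrite <- exp_plus.
      replace (C0 + d * s * (x / s) ^ 2) with (C0 + d * (x * x) / s) by (field; lra).
      apply Hreal. assert (Rabs x ^ 2 <= s ^ 2) by (apply pow_incr; split; [apply Rabs_pos|exact Hx]).
      rewrite pow2_abs in H. nra.
    - intros z Hz _. eapply Rle_trans; [apply canonical_le, nonzero_rotated, Hl|].
      rewrite growth_rotated, Cmod_mult, Hz. replace (s * s) with (s ^ 2) by ring.
      generalize (exp_pos (d * s)). nra.
    - simpl. lra. }
  rewrite Ew in Bz.
  replace (Ci * sqrt t * (Ci * sqrt t))%C with (RtoC (- t)) in Bz.
  2:{ rewrite <- (sqrt_sqrt t) at 1 by lra. cring. }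
  rewrite (rotated_neg l t Hl), Cmod_R, Rabs_pos_eq in Bz.
  2:{ generalize (growth_ge_1 l t Hl). lra. }
  rewrite exp_plus. replace (3 * d * sqrt t) with (3 * (d * s) * (sqrt t / s)) by (field; lra). exact Bz.
Qed.

(** * Logarithms of zero free factors *)

Lemma exp_le (x y : R) : x <= y -> exp x <= exp y.
Proof. intros [H| ->]. left; apply exp_increasing, H. lra. Qed.

Lemma exp_le_inv (x y : R) : exp x <= exp y -> x <= y.
Proof. intros H. apply Rnot_lt_le. intros L. apply exp_increasing in L. lra. Qed.

Lemma pow_fact_le_exp (x : R) n : 0 <= x -> x ^ n / INR (fact n) <= exp x.
Proof.
  intros Hx. eapply Rle_trans; [|apply (exp_ge_taylor x n Hx)].
  destruct n. simpl; lra.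
  rewrite tech5. assert (0 <= sum_f_R0 (fun k => x ^ k / INR (fact k)) n); [|lra].
  apply cond_pos_sum. intros k. apply Rmult_le_pos. apply pow_le, Hx.
  left. apply Rinv_0_lt_compat, INR_fact_lt_0.
Qed.

Lemma is_series_exp (x : R) : is_series (fun n => x ^ n / INR (fact n)) (exp x).
Proof.
  generalize (is_exp_Reals x). unfold is_pseries. apply is_series_ext. intros n.
  rewrite pow_n_pow. unfold scal; simpl; unfold mult; simpl. unfold Rdiv. ring.
Qed.

Lemma ex_nat_between (x : R) : 0 <= x -> exists n : nat, x <= INR n <= x + 1.
Proof.
  intros Hx. destruct (archimed x) as [H1 H2].
  assert (Hz : (0 <= up x)%Z). { apply le_IZR. lra. }
  exists (Z.to_nat (up x)). rewrite INR_IZR_INZ, Z2Nat.id by exact Hz. lra.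
Qed.

(** Each term is at most [(1/2) ^ n * exp (2 * r)], so the tail beyond index [4 * r] sums to at most
    1, and the term of index 0 gives [1 <= M]. *)
Lemma exp_le_of_terms (r M : R) : 0 <= r -> (forall n, r ^ n / INR (fact n) <= M) ->
  exp r <= (4 * r + 3) * M.
Proof.
  intros Hr HM.
  assert (H1 : 1 <= M). { specialize (HM O). simpl in HM. lra. }
  (* As [ln 2 > 1/2], having [N >= 4 * r] makes [exp (2 * r) <= 2 ^ N]. At most [4 * r + 2] terms
     have index up to [N]; the tail accounts for the third unit in [4 * r + 3]. *)
  destruct (ex_nat_between (4 * r)) as (N & HN1 & HN2). lra.
  assert (Hpos : forall n x, 0 <= x -> 0 <= x ^ n / INR (fact n)).
  { intros n x Hx. apply Rmult_le_pos. apply pow_le, Hx. left. apply Rinv_0_lt_compat, INR_fact_lt_0. }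
  assert (T : forall n, r ^ n / INR (fact n) <= (1/2) ^ n * exp (2 * r)).
  { intros n. eapply Rle_trans. 2: apply Rmult_le_compat_l; [apply pow_le; lra|apply (pow_fact_le_exp (2 * r) n); lra].
    assert (E : (1/2) ^ n * 2 ^ n = 1). { rewrite <- Rpow_mult_distr. replace (1 / 2 * 2) with 1 by field. apply pow1. }
    rewrite Rpow_mult_distr.
    replace ((1 / 2) ^ n * (2 ^ n * r ^ n / INR (fact n))) with ((1/2) ^ n * 2 ^ n * (r ^ n / INR (fact n))) by (unfold Rdiv; ring).
    rewrite E. lra. }
  assert (P : exp (2 * r) <= 2 ^ N).
  { replace (2 ^ N) with (exp (ln 2) ^ N) by (rewrite exp_ln; lra).
    assert (E : forall n, exp (ln 2) ^ n = exp (INR n * ln 2)).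
    { induction n. simpl. rewrite Rmult_0_l, exp_0; reflexivity.
      rewrite S_INR. simpl pow. rewrite IHn, <- exp_plus. f_equal. ring. }
    rewrite E. apply exp_le. assert (/ 2 * INR N <= INR N * ln 2); [|lra]. rewrite Rmult_comm. apply Rmult_le_compat_l. lra. left; apply ln_lt_2. }
  assert (Q : Rabs (1/2) < 1) by (rewrite Rabs_pos_eq; lra).
  rewrite <- (is_series_unique _ _ (is_series_exp r)).
  rewrite (Series_incr_n _ (S N)); [|lia|exists (exp r); apply is_series_exp].
  simpl pred.
  assert (B1 : sum_f_R0 (fun k => r ^ k / INR (fact k)) N <= (INR N + 1) * M).
  { rewrite <- S_INR. replace (INR (S N) * M) with (sum_f_R0 (fun _ => M) N) by (rewrite sum_cte; ring).
    apply sum_Rle. intros; apply HM. }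
  assert (B2 : Series (fun k => r ^ (S N + k) / INR (fact (S N + k))) <= Series (fun k => exp (2 * r) * (1/2) ^ (S N) * (1/2) ^ k)).
  { apply Series_le.
    - intros n. split. apply Hpos, Hr. eapply Rle_trans; [apply T|]. rewrite pow_add. lra.
    - apply ex_series_mult_l, ex_series_geom, Q. }
  rewrite Series_scal_l, Series_geom in B2 by exact Q.
  assert (B3 : exp (2 * r) * (1/2) ^ (S N) * / (1 - 1/2) <= 1).
  { replace (exp (2 * r) * (1/2) ^ (S N) * / (1 - 1/2)) with (exp (2 * r) * (1/2) ^ N) by (simpl; field).
    apply Rle_trans with (2 ^ N * (1/2) ^ N). apply Rmult_le_compat_r. apply pow_le; lra. exact P.
    rewrite <- Rpow_mult_distr. replace (2 * (1/2)) with 1 by field. rewrite pow1. lra. }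
  nra.
Qed.

Definition exp_like (c K : R) (a : nat -> C) : Prop :=
  0 < c /\ c <= K /\ forall n, c <= Cmod (a n) * INR (fact n) <= K.

Lemma exp_like_fast c K a : exp_like c K a -> fast a.
Proof.
  intros (Hc & HK & H) s Hs. exists (K * exp s). intros n.
  assert (Hf := INR_fact_lt_0 n).
  replace (Cmod (a n) * s ^ n) with (Cmod (a n) * INR (fact n) * (s ^ n / INR (fact n))) by (field; lra).
  apply Rmult_le_compat. apply Rmult_le_pos; [apply Cmod_ge_0|lra].
  apply Rmult_le_pos. apply pow_le; lra. left; apply Rinv_0_lt_compat, Hf.
  apply H. apply pow_fact_le_exp. lra.
Qed.

Lemma exp_like_upper c K a z : exp_like c K a -> Cmod (ps a z) <= K * exp (Cmod z).
Proof.
  intros (Hc & HK & H). rewrite <- (is_series_unique _ _ (is_series_exp (Cmod z))), <- Series_scal_l.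
  apply csum_le.
  - intros n. rewrite Cmod_mult, Cmod_pow. assert (Hf := INR_fact_lt_0 n).
    replace (Cmod (a n) * Cmod z ^ n) with (Cmod (a n) * INR (fact n) * (Cmod z ^ n / INR (fact n))) by (field; lra).
    apply Rmult_le_compat_r. apply Rmult_le_pos. apply pow_le, Cmod_ge_0. left; apply Rinv_0_lt_compat, Hf.
    apply H.
  - apply ex_series_mult_l. eexists. apply is_series_exp.
Qed.

(** Were [Cmod (ps a z)] small on the whole circle, Cauchy's estimates and the lower bound on the
    coefficients would make every term of the exponential series small. The gap between [4 * r + 3]
    and [4 * r + 4] yields the strict inequality. *)
Lemma exp_like_lower c K a r : exp_like c K a -> 0 < r ->
  exists z, Cmod z = r /\ c * exp r < (4 * r + 4) * Cmod (ps a z).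
Proof.
  intros He Hr. assert (Ha := exp_like_fast c K a He). destruct He as (Hc & HK & H).
  apply NNPP. intros Hno.
  set (B := c * exp r / (4 * r + 4)).
  assert (Hep := exp_pos r).
  assert (HB : forall z, Cmod z = r -> Cmod (ps a z) <= B).
  { intros z Hz. apply Rnot_lt_le. intros Hlt. apply Hno. exists z. split. exact Hz.
    unfold B in Hlt. apply Rmult_lt_compat_r with (r := 4 * r + 4) in Hlt; [|lra].
    replace (c * exp r / (4 * r + 4) * (4 * r + 4)) with (c * exp r) in Hlt by (field; lra). lra. }
  assert (HT := cauchy_estimate a r B Ha Hr HB).
  assert (E : exp r <= (4 * r + 3) * (B / c)).
  { apply exp_le_of_terms. lra. intros n. specialize (HT n). specialize (H n). assert (Hf := INR_fact_lt_0 n).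
    apply Rmult_le_reg_l with c. exact Hc. replace (c * (B / c)) with B by (field; lra).
    eapply Rle_trans; [|exact HT].
    replace (Cmod (a n) * r ^ n) with (Cmod (a n) * INR (fact n) * (r ^ n / INR (fact n))) by (field; lra).
    apply Rmult_le_compat_r. apply Rmult_le_pos. apply pow_le; lra. left; apply Rinv_0_lt_compat, Hf. apply H. }
  assert (E2 : B / c * (4 * r + 4) = exp r) by (unfold B; field; lra).
  assert (0 < B / c). { unfold B. replace (c * exp r / (4 * r + 4) / c) with (exp r / (4 * r + 4)) by (field; lra).
    apply Rdiv_lt_0_compat; lra. }
  nra.
Qed.

(** [h] is the logarithm of [ps g / g O] vanishing at 0, and [q], [q'] are its first two
    derivatives. The bounds 64 and [1024 / r] are absolute: they depend neither on the number of
    zeroes divided out nor on [c] and [K], so [r] can be chosen after everything else. *)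
Record log_data (r : R) (g : nat -> C) (h q q' : C -> C) : Prop := {
  log_0 : h 0%C = 0%C;
  log_exp : forall z, Cmod z < r -> ps g z = (g O * Cexp (h z))%C;
  log_der : forall z, Cmod z < r -> cder h z (q z);
  log_der2 : forall z, Cmod z < r -> cder q z (q' z) /\ ccont q' z;
  log_q : forall z, Cmod z <= r / 2 -> Cmod (q z) <= 64;
  log_q' : forall z, Cmod z <= r / 4 -> Cmod (q' z) <= 1024 / r }.

Lemma log_ccont_q r g h q q' : log_data r g h q q' -> forall z, Cmod z < r -> ccont q z.
Proof. intros L z Hz. eapply cder_ccont. apply L. exact Hz. Qed.

Lemma log_exists c K a r l g : exp_like c K a -> ln (K / c) <= r -> 0 < r -> factors a r l g ->
  (forall z, Cmod z <= r -> ps g z <> 0%C) -> exists h q q', log_data r g h q q'.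
Proof.
  intros He Hlr Hr Hf Hnz.
  assert (Eg0 := factors_0 _ _ _ _ Hf). destruct Hf as (Hg & Hl & E).
  assert (Hg1 := fast_dcoef _ Hg). assert (Hg2 := fast_dcoef _ Hg1).
  set (q := fun z => (ps (dcoef g) z * / ps g z)%C).
  set (q' := fun z => (ps (dcoef (dcoef g)) z * / ps g z + ps (dcoef g) z * (- / (ps g z * ps g z) * ps (dcoef g) z))%C).
  assert (Dq : forall z, Cmod z < r -> cder q z (q' z) /\ ccont q' z).
  { intros z Hz. assert (N : ps g z <> 0%C) by (apply Hnz; lra).
    assert (Ci1 : ccont (fun z => / ps g z)%C z) by (apply ccont_inv; [apply ps_ccont, Hg|exact N]).
    split.
    - unfold q, q'. apply (cder_mult (ps (dcoef g)) (fun z => / ps g z)%C). apply ps_cder, Hg1.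
      apply (cder_comp (ps g) (fun x => / x)%C). apply ps_cder, Hg. apply cder_inv, N.
    - unfold q'. apply ccont_plus; apply ccont_mult.
      apply ps_ccont, Hg2. exact Ci1. apply ps_ccont, Hg1.
      apply ccont_mult; [|apply ps_ccont, Hg1]. apply ccont_opp, ccont_inv.
      apply ccont_mult; apply ps_ccont, Hg. apply Cmult_neq_0; exact N. }
  destruct (primitive q q' r Dq) as (h & Hh0 & Hh).
  assert (Hexp : forall z, Cmod z < r -> ps g z = (g O * Cexp (h z))%C).
  { intros z Hz. rewrite <- (ps_0 g). apply (exp_of_log_derivative (ps g) q h r); try assumption.
    intros w Hw. split; [|apply Hh, Hw]. eapply cder_eq. apply ps_cder, Hg. unfold q. field. apply Hnz; lra. }
  destruct He as (Hc & HK & Ha). 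
  assert (Ha0 : c <= Cmod (g O)). { rewrite Eg0. specialize (Ha O). simpl in Ha. lra. }
  (* On [|z| = 3 r] every factor of the product has modulus at least 2. *)
  assert (Gmax : forall z, Cmod z <= 3 * r -> Cmod (ps g z) <= K * exp (3 * r)).
  { apply (disc_max (ps g) _ (3 * r + 1)).
    - apply Rmult_le_pos. lra. left; apply exp_pos.
    - lra.
    - apply holo_ps, Hg.
    - intros z Hz. assert (B := canonical_outer l r Hl Hr z Hz).
      assert (U := exp_like_upper c K a z (conj Hc (conj HK Ha))). rewrite E, Cmod_mult, Hz in U.
      assert (1 <= 2 ^ length l) by (apply pow_R1_Rle; lra).
      generalize (Cmod_ge_0 (ps g z)). nra. }
  (* [ps g] is at most [K * exp (3 * r)] and [g O] at least [c], so [Re h <= ln (K / c) + 3 * r];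
     the hypothesis on [r] absorbs the constant. *)
  set (A := 4 * r).
  assert (HA : forall z, Cmod z < r -> Re (h z) <= A).
  { intros z Hz. assert (G := Gmax z ltac:(lra)). rewrite (Hexp z Hz), Cmod_mult, Cmod_Cexp in G.
    apply exp_le_inv. assert (P := exp_pos (Re (h z))).
    assert (exp (Re (h z)) <= K / c * exp (3 * r)).
    { apply Rmult_le_reg_l with c. exact Hc. replace (c * (K / c * exp (3 * r))) with (K * exp (3 * r)) by (field; lra). nra. }
    eapply Rle_trans; [exact H|]. replace A with (r + 3 * r) by (unfold A; ring). rewrite exp_plus.
    apply Rmult_le_compat_r. left; apply exp_pos.
    rewrite <- (exp_ln (K / c)). apply exp_le, Hlr. apply Rdiv_lt_0_compat; lra. }
  assert (BC : forall z, Cmod z < r -> Cmod (q z) <= 2 * (A - Re (h z)) / (r - Cmod z)).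
  { intros z Hz. apply (borel_caratheodory h q z (r - Cmod z) A). lra.
    - intros w Hw. assert (Cmod w < r). { generalize (Cmod_triangle z (w - z)%C). replace (z + (w - z))%C with w by ring. lra. }
      split. apply Hh; assumption. exact (cder_ccont _ _ _ (proj1 (Dq w H))).
    - intros w Hw. apply HA. generalize (Cmod_triangle z (w - z)%C). replace (z + (w - z))%C with w by ring. lra. }
  (* Harnack: [(A - Re h(tz)) (r - t|z|)^2] decreases in [t]. *)
  assert (Harnack : forall z, Cmod z < r -> (A - Re (h z)) * (r - Cmod z) ^ 2 <= A * r ^ 2).
  { intros z Hz. set (m := Cmod z).
    assert (Hm0 : 0 <= m) by apply Cmod_ge_0.
    destruct (MVT_derive (fun t : R => (A - Re (h (0 + t * z)%C)) * (r - t * m) ^ 2)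
      (fun t : R => - Re (q (0 + t * z) * z)%C * (r - t * m) ^ 2 + (A - Re (h (0 + t * z)%C)) * (- 2 * m * (r - t * m)))
      0 1 Rle_0_1) as (t & Ht & Et).
    - intros t Ht. assert (D1 : is_derive (fun t : R => Re (h (0 + t * z)%C)) t (Re (q (0 + t * z) * z)%C)).
      { apply (rcder_Re (fun t : R => h (0 + t * z)%C)). apply (rcder_comp h). apply rcder_line.
        apply Hh. rewrite Cplus_0_l. apply Cmod_scal_le; assumption. }
      apply (is_derive_mult (fun t : R => A - Re (h (0 + t * z)%C)) (fun t : R => (r - t * m) ^ 2) t);
        [ | auto_derive; [exact I|ring] | intros; apply Rmult_comm ].
      apply is_derive_Reals in D1. apply is_derive_Reals. rewrite <- Rminus_0_l.
      apply (derivable_pt_lim_minus (fun _ => A)); [apply derivable_pt_lim_const|exact D1].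
    - replace (0 + 1%R * z)%C with z in Et by ring. replace (0 + 0%R * z)%C with (RtoC 0) in Et by ring.
      rewrite Hh0 in Et. simpl (Re 0) in Et.
      assert (Hw : Cmod (0 + t * z)%C = t * m). { rewrite Cplus_0_l, Cmod_mult, Cmod_R, Rabs_pos_eq by lra. reflexivity. }
      assert (Htm : t * m <= m) by nra.
      assert (B := BC (0 + t * z)%C ltac:(rewrite Hw; fold m in Hz; lra)). rewrite Hw in B.
      set (w := (0 + t * z)%C) in *. set (v := A - Re (h w)) in *.
      assert (Hrt : 0 < r - t * m) by (fold m in Hz; lra).
      assert (B2 : - Re (q w * z)%C <= 2 * v / (r - t * m) * m).
      { eapply Rle_trans. apply Rle_trans with (Rabs (Re (q w * z)%C)). rewrite <- Rabs_Ropp; apply Rle_abs.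
        apply re_le_Cmod. rewrite Cmod_mult. apply Rmult_le_compat_r; assumption. }
      assert (B3 : - Re (q w * z)%C * (r - t * m) ^ 2 <= 2 * v * m * (r - t * m)).
      { apply Rle_trans with (2 * v / (r - t * m) * m * (r - t * m) ^ 2).
        apply Rmult_le_compat_r. apply pow2_ge_0. exact B2. right; field; lra. }
      fold m. replace (r - 0 * m) with r in Et by ring. replace (r - 1 * m) with (r - m) in Et by ring.
      rewrite Rminus_0_r in Et. nra. }
  (* At [Cmod w <= r / 2] the Harnack inequality gives [A - Re (h w) <= 4 * A], that is [16 * r],
     and then [BC] gives 2 * 16 r / (r / 2) = 64. *)
  assert (Q : forall w, Cmod w <= r / 2 -> Cmod (q w) <= 64).
  { intros w Hw. assert (B := BC w ltac:(lra)). assert (Hk := Harnack w ltac:(lra)).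
    assert (Hv := HA w ltac:(lra)). set (v := A - Re (h w)) in *.
    assert (Hv4 : v <= 4 * A).
    { assert ((r/2) ^ 2 <= (r - Cmod w) ^ 2) by (apply pow_incr; lra).
      assert (v * (r/2)^2 <= A * r ^ 2). { eapply Rle_trans; [|exact Hk]. apply Rmult_le_compat_l; unfold v; lra. }
      assert (0 < r ^ 2) by (apply pow_lt, Hr). nra. }
    eapply Rle_trans; [exact B|].
    apply Rmult_le_reg_r with (r - Cmod w). lra.
    replace (2 * v / (r - Cmod w) * (r - Cmod w)) with (2 * v) by (field; lra). unfold A in Hv4. lra. }
  exists h, q, q'. constructor; try assumption.
  - intros z Hz.
    (* The disc of radius [r / 4] about [z] stays where [q] is bounded by 64; the numerator is then
       at most 2 * (64 + 64). *)
    assert (B := borel_caratheodory q q' z (r / 4) 64 ltac:(lra)).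
    assert (Hw : forall w, Cmod (w - z)%C < r / 4 -> Cmod w <= r / 2).
    { intros w Hw. generalize (Cmod_triangle z (w - z)%C). replace (z + (w - z))%C with w by ring. lra. }
    eapply Rle_trans. apply B.
    + intros w Hwz. apply Dq. specialize (Hw w Hwz). lra.
    + intros w Hwz. eapply Rle_trans; [apply Re_le_Cmod|]. apply Q, Hw, Hwz.
    + assert (Hq := Q z ltac:(lra)). generalize (re_le_Cmod (q z)). intros Hre. apply Rabs_le_between in Hre.
      replace (1024 / r) with (2 * 128 / (r / 4)) by (field; lra).
      apply Rmult_le_compat_r. left; apply Rinv_0_lt_compat; lra. lra.
Qed.

Lemma segment_0 (z : C) (t : R) : (0 + t * (z - 0))%C = (t * z)%C.
Proof. ring. Qed.

Lemma Cmod_segment (z : C) (t : R) : 0 <= t <= 1 -> Cmod (t * z)%C <= Cmod z.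
Proof. intros Ht. rewrite Cmod_mult, Cmod_R, Rabs_pos_eq by lra. generalize (Cmod_ge_0 z). nra. Qed.

Lemma log_q_lip r g h q q' : log_data r g h q q' -> 0 < r ->
  forall z, Cmod z <= r / 4 -> Cmod (q z - q 0)%C <= 1024 / r * Cmod z.
Proof.
  intros L Hr z Hz.
  replace (Cmod z) with (Cmod (z - 0)%C) by (f_equal; ring).
  assert (0 < 1024 / r) by (apply Rdiv_lt_0_compat; lra).
  apply (mean_value_ineq q q'). lra.
  - intros t Ht. rewrite segment_0. apply L. generalize (Cmod_segment z t Ht). lra.
  - intros t Ht. rewrite segment_0. apply (log_q' _ _ _ _ _ L). generalize (Cmod_segment z t Ht). lra.
Qed.

Lemma log_linear r g h q q' : log_data r g h q q' -> 0 < r ->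
  forall z, Cmod z <= r / 4 -> Cmod (h z - q 0 * z)%C <= 1024 / r * Cmod z ^ 2.
Proof.
  intros L Hr z Hz.
  assert (0 < 1024 / r) by (apply Rdiv_lt_0_compat; lra).
  assert (M := mean_value_ineq (fun z => h z - q 0 * z)%C (fun z => q z - q 0)%C 0%C z (1024 / r * Cmod z)).
  cbv beta in M. rewrite (log_0 _ _ _ _ _ L) in M.
  replace (h z - q 0 * z - (0 - q 0 * 0))%C with (h z - q 0 * z)%C in M by ring.
  replace (1024 / r * Cmod z ^ 2) with (1024 / r * Cmod z * Cmod (z - 0)%C).
  2:{ replace (z - 0)%C with z by ring. ring. }
  apply M.
  - generalize (Cmod_ge_0 z). nra.
  - intros t Ht. rewrite segment_0. apply cder_minus. apply L. generalize (Cmod_segment z t Ht). lra.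
    eapply cder_eq. apply cder_scal, cder_id. ring.
  - intros t Ht. rewrite segment_0. assert (S := Cmod_segment z t Ht).
    eapply Rle_trans. apply (log_q_lip _ _ _ _ _ L Hr). lra. apply Rmult_le_compat_l; lra.
Qed.

Lemma log_lip r g h q q' : log_data r g h q q' -> 0 < r ->
  forall z, Cmod z <= r / 2 -> Cmod (h z) <= 64 * Cmod z.
Proof.
  intros L Hr z Hz.
  assert (M := mean_value_ineq h q 0%C z 64 ltac:(lra)).
  rewrite (log_0 _ _ _ _ _ L) in M. replace (h z - 0)%C with (h z) in M by ring.
  replace (z - 0)%C with z in M by ring. apply M.
  - intros t Ht. replace (0 + t * z)%C with (t * z)%C by ring. apply L. generalize (Cmod_segment z t Ht). lra.
  - intros t Ht. replace (0 + t * z)%C with (t * z)%C by ring. apply (log_q _ _ _ _ _ L).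
    generalize (Cmod_segment z t Ht). lra.
Qed.

(** The left side depends on [Cmod z] only, so [z] may be taken where [Re h] is nearly maximal on
    its circle. *)
Lemma rotated_bound c K a r l g h q q' z : exp_like c K a -> factors a r l g -> log_data r g h q q' ->
  Cmod z < r -> Cmod (canonical (rotated l) (Cmod z)) <= K / c * exp (Cmod z - Re (h z)).
Proof.
  intros He Hf L Hz.
  assert (U := exp_like_upper c K a z He). assert (Eg0 := factors_0 _ _ _ _ Hf).
  destruct Hf as (Hg & Hl & E). destruct He as (Hc & HK & Ha).
  assert (Ha0 : c <= Cmod (g O)). { rewrite Eg0. specialize (Ha O). simpl in Ha. lra. }
  eapply Rle_trans. apply rotated_le. intros b Hb. apply Hl, Hb.
  rewrite E, (log_exp _ _ _ _ _ L z Hz), !Cmod_mult, Cmod_Cexp in U.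
  unfold Rminus. rewrite exp_plus, exp_Ropp.
  assert (P := exp_pos (Re (h z))). assert (P2 := exp_pos (Cmod z)). assert (P3 := Cmod_ge_0 (canonical l z)).
  apply Rmult_le_reg_r with (c * exp (Re (h z))). nra.
  replace (K / c * (exp (Cmod z) * / exp (Re (h z))) * (c * exp (Re (h z)))) with (K * exp (Cmod z)) by (field; lra).
  eapply Rle_trans; [|exact U]. apply Rmult_le_compat_l. exact P3. apply Rmult_le_compat_r; lra.
Qed.

Lemma log_lower c K a r l g h q q' t : exp_like c K a -> factors a r l g -> log_data r g h q q' ->
  0 < t < r -> exists z, Cmod z = t /\ t - ln (K / c * (4 * t + 4) * growth l t) <= Re (h z).
Proof.
  intros He Hf L Ht. destruct (exp_like_lower c K a t He ltac:(lra)) as (z & Hz & Hlow).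
  exists z. split. exact Hz. assert (Eg0 := factors_0 _ _ _ _ Hf).
  destruct Hf as (Hg & Hl & E). destruct He as (Hc & HK & Ha).
  assert (Ha0 : Cmod (g O) <= K). { rewrite Eg0. specialize (Ha O). simpl in Ha. lra. }
  assert (Hnl : nonzero l) by (intros b Hb; apply Hl, Hb).
  assert (G1 := growth_ge_1 l t Hnl ltac:(lra)).
  rewrite E, (log_exp _ _ _ _ _ L z ltac:(lra)), !Cmod_mult, Cmod_Cexp in Hlow.
  assert (CL := canonical_le l z Hnl). rewrite Hz in CL.
  assert (P := exp_pos (Re (h z))). assert (P2 := exp_pos t). assert (P3 := Cmod_ge_0 (canonical l z)).
  assert (P4 := Cmod_ge_0 (g O)).
  assert (Hkc : 0 < K / c) by (apply Rdiv_lt_0_compat; lra).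
  set (X := K / c * (4 * t + 4) * growth l t).
  assert (HX : 0 < X). { unfold X. apply Rmult_lt_0_compat. apply Rmult_lt_0_compat. exact Hkc. lra. lra. }
  apply exp_le_inv. unfold Rminus. rewrite exp_plus, exp_Ropp, exp_ln by exact HX.
  apply Rmult_le_reg_r with X. exact HX. rewrite Rmult_assoc, Rinv_l, Rmult_1_r by lra.
  apply Rmult_le_reg_l with c. exact Hc.
  replace (c * (exp (Re (h z)) * X)) with ((4 * t + 4) * (growth l t * (K * exp (Re (h z))))) by (unfold X; field; lra).
  eapply Rle_trans. left; exact Hlow. apply Rmult_le_compat_l. lra.
  apply Rmult_le_compat. exact P3. apply Rmult_le_pos; lra. exact CL. apply Rmult_le_compat_r; lra.
Qed.

(** * Growth of canonical products *)

Lemma ln_le_sub1 (x : R) : 0 < x -> ln x <= x - 1.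
Proof.
  intros Hx. apply exp_le_inv. rewrite exp_ln by exact Hx. generalize (exp_ineq1_le (x - 1)). lra.
Qed.

Lemma sqrt_ge_1 (x : R) : 1 <= x -> 1 <= sqrt x.
Proof. intros H. rewrite <- sqrt_1 at 1. apply sqrt_le_1_alt, H. Qed.

(* The increments of [potential x] at integers dominate [ln (1 + (x/j)^2)], and [potential x <= 32 x]:
   a telescoping bound for the product of the [1 + (x/j)^2]. *)
Definition potential (x y : R) : R := 32 * x * sqrt (y / (y + x)).

(** With [u = x / j] and [s = sqrt (1 + u)], the quantity [16 * u ^ 2 / s ^ 3] is the derivative at
    [j] of the concave function [potential x], hence at most its increment over the preceding unit
    interval. It also dominates [ln (1 + u ^ 2)]. *)
Lemma potential_step (x j : R) : 0 < x -> 1 <= j ->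
  1 + (x / j) ^ 2 <= exp (potential x j - potential x (j - 1)).
Proof.
  intros Hx Hj. set (u := x / j). assert (Hu : 0 < u) by (apply Rdiv_lt_0_compat; lra).
  set (s := sqrt (1 + u)).
  assert (Hs2 : s * s = 1 + u) by (apply sqrt_sqrt; lra).
  assert (Hs1 : 1 <= s). { apply sqrt_ge_1. lra. }
  assert (Pow : 0 < s ^ 3) by (apply pow_lt; lra).
  assert (Main : 1 + u ^ 2 <= exp (16 * u ^ 2 / s ^ 3)).
  { rewrite <- (exp_ln (1 + u ^ 2)) by nra. apply exp_le.
    (* For small [u] the logarithm is at most [u ^ 2] and [s] is bounded; for large [u] it is at
       most [4 * ln s], while [s ^ 4 <= 4 * u ^ 2]. *)
    destruct (Rle_dec u 1) as [Hu1|Hu1].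
    - apply Rle_trans with (u ^ 2). eapply Rle_trans. apply ln_le_sub1. nra. lra.
      apply Rmult_le_reg_r with (s ^ 3). exact Pow.
      replace (16 * u ^ 2 / s ^ 3 * s ^ 3) with (16 * u ^ 2) by (field; lra).
      assert (s ^ 3 <= 16). { assert (s <= 2) by nra. simpl. nra. }
      assert (0 <= u ^ 2) by nra. nra.
    - apply Rle_trans with (4 * (s - 1)).
      + apply Rle_trans with (ln ((s ^ 4))).
        * apply ln_le. nra. replace (s ^ 4) with ((s * s) ^ 2) by ring. rewrite Hs2. nra.
        * rewrite ln_pow by lra. replace (INR 4) with 4 by (simpl; ring). generalize (ln_le_sub1 s). lra.
      + apply Rle_trans with (4 * s). lra.
        apply Rmult_le_reg_r with (s ^ 3). exact Pow.
        replace (16 * u ^ 2 / s ^ 3 * s ^ 3) with (16 * u ^ 2) by (field; lra).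
        replace (4 * s * s ^ 3) with (4 * (s * s) ^ 2) by ring. rewrite Hs2. nra. }
  eapply Rle_trans; [exact Main|]. apply exp_le. unfold potential.
  set (P := j / (j + x)). set (Q := (j - 1) / (j - 1 + x)).
  assert (HP : P = / (s * s)). { unfold P. rewrite Hs2. unfold u. field. lra. }
  assert (HsP : sqrt P = / s).
  { rewrite HP. rewrite sqrt_inv, sqrt_square by lra. reflexivity. }
  assert (HQ0 : 0 <= Q). { apply Rmult_le_pos. lra. left; apply Rinv_0_lt_compat; lra. }
  assert (HPQ : P - Q = x / ((j + x) * (j - 1 + x))) by (unfold P, Q; field; lra).
  assert (HPQ0 : 0 < P - Q). { rewrite HPQ. apply Rdiv_lt_0_compat. lra. apply Rmult_lt_0_compat; lra. }
  assert (HQP : sqrt Q <= sqrt P) by (apply sqrt_le_1; lra).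
  assert (Hdiff : P - Q <= (sqrt P - sqrt Q) * (2 * / s)).
  { assert (E1 : sqrt P * sqrt P = P) by (apply sqrt_sqrt; lra).
    assert (E2 : sqrt Q * sqrt Q = Q) by (apply sqrt_sqrt; lra).
    replace (P - Q) with ((sqrt P - sqrt Q) * (sqrt P + sqrt Q)) by (ring_simplify; nra).
    apply Rmult_le_compat_l. lra. rewrite <- HsP. lra. }
  assert (Hlow : x / ((j + x) * (j + x)) <= P - Q).
  { rewrite HPQ. apply Rmult_le_compat_l. lra. apply Rinv_le_contravar. apply Rmult_lt_0_compat; lra.
    apply Rmult_le_compat_l; lra. }
  assert (Hjx : (j + x) = j * (s * s)). { rewrite Hs2. unfold u. field. lra. }
  assert (Hxj : x = u * j) by (unfold u; field; lra).
  assert (Hfin : 16 * u ^ 2 / s ^ 3 = 32 * x * (x / ((j + x) * (j + x)) * (s / 2))).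
  { rewrite Hjx. rewrite Hxj. field. lra. }
  rewrite Hfin.
  replace (32 * x * sqrt P - 32 * x * sqrt Q) with (32 * x * (sqrt P - sqrt Q)) by ring.
  apply Rmult_le_compat_l. lra.
  apply Rle_trans with ((sqrt P - sqrt Q) * (2 * / s) * (s / 2)).
  - apply Rmult_le_compat_r; lra.
  - right. field. lra.
Qed.

Lemma list_max_split (l : list C) : l <> nil ->
  exists l1 b l2, l = l1 ++ b :: l2 /\ forall x, In x l -> Cmod x <= Cmod b.
Proof.
  induction l as [|a l IH]; intros Hn. congruence.
  destruct l as [|a' l].
  - exists nil, a, nil. split. reflexivity. intros x [<-|[]]. lra.
  - destruct IH as (l1 & b & l2 & E & Hm). discriminate.
    destruct (Rle_dec (Cmod a) (Cmod b)) as [H|H].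
    + exists (a :: l1), b, l2. split. rewrite E. reflexivity.
      intros x [<-|Hx]. exact H. apply Hm, Hx.
    + exists nil, a, (a' :: l). split. reflexivity. intros x [<-|Hx]. lra. specialize (Hm x Hx). lra.
Qed.

Lemma growth_app l1 l2 r : growth (l1 ++ l2) r = growth l1 r * growth l2 r.
Proof. induction l1; simpl. ring. rewrite IHl1. ring. Qed.

Definition count (t : R) (l : list C) : R := INR (length (filter (in_disc t) l)).

Lemma count_app t l1 l2 : count t (l1 ++ l2) = count t l1 + count t l2.
Proof. unfold count. rewrite filter_app, length_app, plus_INR. reflexivity. Qed.

Lemma count_pos t l : 0 <= count t l.
Proof. apply pos_INR. Qed.

Lemma count_all t l : (forall b, In b l -> Cmod b <= t) -> count t l = INR (length l).
Proof.
  intros H. unfold count. do 2 f_equal. induction l as [|b l IH]; simpl. reflexivity.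
  unfold in_disc at 1. destruct (Rle_dec (Cmod b) t) as [_|N].
  rewrite IH. reflexivity. intros x Hx; apply H; right; exact Hx. elim N. apply H; left; reflexivity.
Qed.

(* Induction by removing a zero [b] of largest modulus: counting at [|b|] gives [|b| >= (n/D)^2]. *)
Lemma growth_count (n : nat) : forall l A D, length l = n -> nonzero l -> 0 < A -> 0 < D ->
  (forall t, 0 < t -> count t l <= D * sqrt t) ->
  growth l A <= exp (potential (D * sqrt A) (INR n)).
Proof.
  induction n as [|n IH]; intros l A D Hn Hl HA HD Hc.
  - destruct l; [|discriminate]. simpl. rewrite <- exp_0. apply exp_le. unfold potential.
    apply Rmult_le_pos; [|apply sqrt_pos]. generalize (sqrt_pos A). nra.
  - destruct (list_max_split l) as (l1 & b & l2 & E & Hm). intros ->; discriminate.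
    assert (Hb : 0 < Cmod b). { apply Cmod_gt_0, Hl. rewrite E. apply in_elt. }
    assert (HsA : 0 < sqrt A) by (apply sqrt_lt_R0, HA).
    assert (Hx : 0 < D * sqrt A) by nra.
    assert (Hlen : INR (S n) <= D * sqrt (Cmod b)). { rewrite <- Hn, <- (count_all (Cmod b) l Hm). apply Hc, Hb. }
    assert (HSn : 1 <= INR (S n)). { rewrite S_INR. generalize (pos_INR n). lra. }
    assert (G : growth l A = (1 + A / Cmod b) * growth (l1 ++ l2) A).
    { rewrite E, !growth_app. simpl. ring. }
    rewrite G.
    replace (potential (D * sqrt A) (INR (S n))) with
      (potential (D * sqrt A) (INR (S n)) - potential (D * sqrt A) (INR (S n) - 1) + potential (D * sqrt A) (INR n)).
    2:{ replace (INR (S n) - 1) with (INR n) by (rewrite S_INR; ring). ring. }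
    rewrite exp_plus.
    assert (Hnl : nonzero (l1 ++ l2)).
    { intros y Hy. apply Hl. rewrite E. apply in_or_app. apply in_app_or in Hy. destruct Hy; [left|right; right]; assumption. }
    apply Rmult_le_compat.
    + assert (0 < A / Cmod b) by (apply Rdiv_lt_0_compat; lra). lra.
    + generalize (growth_ge_1 (l1 ++ l2) A Hnl). lra.
    + eapply Rle_trans. 2: apply potential_step; assumption.
      apply Rplus_le_compat_l.
      apply Rmult_le_reg_r with (Cmod b). exact Hb. replace (A / Cmod b * Cmod b) with A by (field; lra).
      assert (Hsb : sqrt (Cmod b) * sqrt (Cmod b) = Cmod b) by (apply sqrt_sqrt; lra).
      assert (HsA2 : sqrt A * sqrt A = A) by (apply sqrt_sqrt; lra).
      assert (Hsq : INR (S n) * INR (S n) <= D * D * Cmod b).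
      { rewrite <- Hsb. replace (D * D * (sqrt (Cmod b) * sqrt (Cmod b))) with ((D * sqrt (Cmod b)) * (D * sqrt (Cmod b))) by ring.
        apply Rmult_le_compat; lra. }
      apply Rmult_le_reg_r with (INR (S n) * INR (S n)). nra.
      replace ((D * sqrt A / INR (S n)) ^ 2 * Cmod b * (INR (S n) * INR (S n))) with (sqrt A * sqrt A * (D * D * Cmod b)) by (field; lra).
      rewrite HsA2. apply Rmult_le_compat_l; lra.
    + apply IH; try assumption.
      * rewrite E, length_app in Hn. simpl in Hn. rewrite length_app. lia.
      * intros t Ht. eapply Rle_trans; [|apply Hc, Ht]. rewrite E, !count_app.
        change (b :: l2) with ((b :: nil) ++ l2). rewrite count_app. generalize (count_pos t (b :: nil)). lra.
Qed.

Lemma potential_le x y : 0 <= x -> 0 <= y -> potential x y <= 32 * x.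
Proof.
  intros Hx Hy. unfold potential. apply Rle_trans with (32 * x * 1); [|lra]. apply Rmult_le_compat_l. lra.
  destruct (Req_dec (y + x) 0) as [E|N].
  (* Here the quotient is 0 / 0, which evaluates to 0. *)
  - assert (E2 : y = 0) by lra. rewrite E2. unfold Rdiv. rewrite Rmult_0_l, sqrt_0. lra.
  - apply Rle_trans with (sqrt 1); [|rewrite sqrt_1; lra]. apply sqrt_le_1_alt. apply Rmult_le_reg_r with (y + x). lra.
    unfold Rdiv. rewrite Rmult_assoc, Rinv_l by lra. lra.
Qed.

Lemma growth_split l r p : growth l r = growth (filter p l) r * growth (filter (fun b => negb (p b)) l) r.
Proof. induction l as [|b l IH]; simpl. ring. destruct (p b); simpl; rewrite IH; ring. Qed.

Lemma growth_crude l A x0 m : 0 < x0 -> 0 <= A -> (forall b, In b l -> x0 <= Cmod b) -> (length l <= m)%nat ->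
  0 <= growth l A <= (1 + A / x0) ^ m.
Proof.
  intros Hx HA. revert m. induction l as [|b l IH]; intros m Hl Hm; simpl.
  - assert (0 <= A / x0) by (apply Rmult_le_pos; [lra|left; apply Rinv_0_lt_compat, Hx]).
    split. lra. apply pow_R1_Rle. lra.
  - destruct m as [|m]; simpl in Hm; [lia|].
    assert (Hb : x0 <= Cmod b) by (apply Hl; left; reflexivity).
    destruct (IH m) as [I1 I2]. intros y Hy; apply Hl; right; exact Hy. lia.
    assert (0 <= A / Cmod b) by (apply Rmult_le_pos; [lra|left; apply Rinv_0_lt_compat; lra]).
    assert (A / Cmod b <= A / x0). { apply Rmult_le_compat_l. exact HA. apply Rinv_le_contravar; lra. }
    simpl. split. nra. apply Rmult_le_compat; lra.
Qed.

Lemma filter_far T t (l : list C) : (forall b, In b l -> T < Cmod b) -> t <= T -> count t l = 0.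
Proof.
  intros Hl Ht. unfold count. induction l as [|b l IH]; simpl. reflexivity.
  unfold in_disc at 1. destruct (Rle_dec (Cmod b) t) as [N|_].
  specialize (Hl b (or_introl eq_refl)). lra. apply IH. intros y Hy; apply Hl; right; exact Hy.
Qed.

(** The square root bound on the counts is available from [T] on only. The zeroes up to [T], at most
    [m] of them, cost a factor polynomial in [A]; for the others the bound holds at every radius, as
    none is counted before [T]. *)
Lemma growth_sqrt l A D T x0 m : nonzero l -> 0 < A -> 0 < D -> 0 < T -> 0 < x0 ->
  (forall b, In b l -> x0 <= Cmod b) -> (forall t, T <= t -> count t l <= D * sqrt t) ->
  D * sqrt T <= INR m -> growth l A <= (1 + A / x0) ^ m * exp (32 * (D * sqrt A)).
Proof.
  intros Hl HA HD HT Hx Hb Hc Hm. rewrite (growth_split l A (in_disc T)).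
  set (l1 := filter (in_disc T) l). set (l2 := filter (fun b => negb (in_disc T b)) l).
  assert (Hl2 : forall b, In b l2 -> In b l /\ T < Cmod b).
  { intros b H. apply filter_In in H. destruct H as [H1 H2]. split. exact H1.
    unfold in_disc in H2. destruct (Rle_dec (Cmod b) T). discriminate. apply Rnot_le_lt; assumption. }
  assert (Hn2 : nonzero l2) by (intros b H; apply Hl, Hl2, H).
  assert (HDA : 0 <= D * sqrt A) by (generalize (sqrt_pos A); nra).
  apply Rmult_le_compat.
  - apply (growth_crude l1 A x0 (length l1)); try lra. intros b H. apply filter_In in H. apply Hb, H. lia.
  - generalize (growth_ge_1 l2 A Hn2). lra.
  - apply growth_crude; try lra. intros b H. apply filter_In in H. apply Hb, H.
    apply INR_le. eapply Rle_trans; [|exact Hm]. apply (Hc T). lra.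
  - eapply Rle_trans. apply (growth_count (length l2) l2 A D eq_refl Hn2 HA HD).
    + intros t Ht. destruct (Rle_dec T t) as [H|H].
      * eapply Rle_trans; [|apply Hc, H]. unfold count. apply le_INR.
        unfold l2. clear. induction l as [|b l IH]; simpl. lia.
        destruct (in_disc T b); simpl; destruct (in_disc t b); simpl; lia.
      * rewrite (filter_far T t l2). generalize (sqrt_pos t). nra. intros b H1. apply Hl2, H1. lra.
    + apply exp_le, potential_le. exact HDA. apply pos_INR.
Qed.

Lemma exp_beats_square (M eps : R) : 0 < eps -> exists Y, 1 <= Y /\ forall y, Y <= y -> M * (1 + y) ^ 2 <= exp (eps * y).
Proof.
  intros He. assert (He3 : 0 < eps ^ 3) by (apply pow_lt, He).
  (* The cubic term of the exponential series has denominator 6, and [(1 + y) ^ 2 <= 4 * y ^ 2] for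
     [y >= 1]; 24 = 6 * 4. *)
  exists (1 + 24 * Rabs M / eps ^ 3).
  assert (H0 : 0 <= 24 * Rabs M / eps ^ 3). { apply Rmult_le_pos. generalize (Rabs_pos M); lra. left; apply Rinv_0_lt_compat, He3. }
  split. lra. intros y Hy.
  assert (T := pow_fact_le_exp (eps * y) 3 ltac:(nra)). replace (INR (fact 3)) with 6 in T by (simpl; ring).
  eapply Rle_trans; [|exact T].
  assert (HM : 24 * Rabs M <= eps ^ 3 * y).
  { apply Rmult_le_compat_l with (r := eps ^ 3) in Hy; [|lra].
    replace (eps ^ 3 * (1 + 24 * Rabs M / eps ^ 3)) with (eps ^ 3 + 24 * Rabs M) in Hy by (field; lra). lra. }
  apply Rle_trans with (Rabs M * (1 + y) ^ 2). apply Rmult_le_compat_r. apply pow2_ge_0. apply Rle_abs.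
  apply Rle_trans with (Rabs M * (4 * y ^ 2)). apply Rmult_le_compat_l. apply Rabs_pos. nra.
  replace ((eps * y) ^ 3 / 6) with (eps ^ 3 * y * y ^ 2 / 6) by field.
  assert (0 <= y ^ 2) by apply pow2_ge_0. nra.
Qed.

Lemma log_negligible B d : 0 < d -> exists S, 1 <= S /\ forall s, S <= s -> B * (1 + ln (1 + s)) <= d * s.
Proof.
  (* To be used at [y = ln (1 + s)]; the 2 pays for [1 + s <= 2 * s]. *)
  intros Hd. destruct (exp_beats_square (2 * Rabs B / d) 1 Rlt_0_1) as (Y & HY & H).
  exists (exp Y). split. generalize (exp_ineq1_le Y). lra. intros s Hs.
  assert (Hs0 := exp_pos Y). assert (E := exp_ineq1_le Y).
  assert (HYs : Y <= ln (1 + s)). { rewrite <- (ln_exp Y). apply ln_le; lra. }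
  specialize (H _ HYs). rewrite Rmult_1_l, exp_ln in H by lra. set (y := ln (1 + s)) in *.
  apply Rmult_le_compat_l with (r := d) in H; [|lra].
  replace (d * (2 * Rabs B / d * (1 + y) ^ 2)) with (2 * (Rabs B * (1 + y) ^ 2)) in H by (field; lra).
  assert (B * (1 + y) <= Rabs B * (1 + y)) by (apply Rmult_le_compat_r; [lra|apply Rle_abs]).
  assert (Rabs B * (1 + y) <= Rabs B * (1 + y) ^ 2) by (apply Rmult_le_compat_l; [apply Rabs_pos|nra]).
  nra.
Qed.

(** * Absence of zeroes under condition (i) *)

Lemma zero_in_factors a r l g z0 : factors a r l g -> (forall z, Cmod z <= r -> ps g z <> 0%C) ->
  Cmod z0 <= r -> ps a z0 = 0%C -> In z0 l.
Proof.
  intros (Hg & Hl & E) Hnz Hz0 H0. apply NNPP. intros Hn.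
  rewrite E in H0. revert H0. apply Cmult_neq_0. 2: apply Hnz, Hz0.
  apply canonical_nz. intros b Hb; apply Hl, Hb. exact Hn.
Qed.

Lemma factor_is_zero a r l g b : factors a r l g -> In b l -> ps a b = 0%C.
Proof.
  intros (Hg & Hl & E) Hb. rewrite E. replace (canonical l b) with (RtoC 0). ring.
  symmetry. destruct (Hl b Hb) as [Nb _]. clear - Hb Nb. induction l as [|x l IH]; simpl. destruct Hb.
  destruct Hb as [->|Hb]. replace (1 - b / b)%C with (RtoC 0) by (field; exact Nb). ring. rewrite IH by exact Hb. ring.
Qed.

Lemma zeroes_away a : fast a -> a O <> 0%C -> exists x0, 0 < x0 /\ forall b, ps a b = 0%C -> x0 <= Cmod b.
Proof.
  intros Ha H0. assert (Hp : 0 < Cmod (a O)) by (apply Cmod_gt_0; exact H0).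
  destruct (ps_ccont a 0%C Ha (Cmod (a O) / 2)) as (d & Hd & Hk). lra.
  exists d. split. exact Hd. intros b Hb. apply Rnot_lt_le. intros Hlt. specialize (Hk b Hlt).
  rewrite Cplus_0_l, Hb, ps_0 in Hk. replace (0 - a O)%C with (- a O)%C in Hk by ring. rewrite Cmod_opp in Hk. lra.
Qed.

Lemma exp_like_0 c K a : exp_like c K a -> a O <> 0%C.
Proof. intros (Hc & _ & H). specialize (H O). simpl in H. apply Cmod_gt_0. lra. Qed.

(** The order of the quantifiers is the point: [C0] is fixed first, then [t], and the list, hence
    the disc, may depend on [t]. At [t = exp C0 * Cmod z0] the factor of [z0] alone is
    [1 + exp C0]. *)
Lemma unbounded_growth (z0 : C) (C0 : R) : z0 <> 0%C ->
  ~ (forall t, 0 < t -> exists l, nonzero l /\ In z0 l /\ growth l t <= exp C0).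
Proof.
  intros Hz H. assert (Hp : 0 < Cmod z0) by (apply Cmod_gt_0; exact Hz).
  assert (He := exp_pos C0). assert (Ht : 0 < exp C0 * Cmod z0) by nra.
  destruct (H _ Ht) as (l & Hl & Hin & G).
  assert (B := growth_ge l _ z0 Hl (Rlt_le _ _ Ht) Hin).
  replace (exp C0 * Cmod z0 / Cmod z0) with (exp C0) in B by (field; lra). lra.
Qed.

Lemma unit_phase (al : C) : exists e, Cmod e = 1 /\ (al * e)%C = RtoC (Cmod al).
Proof.
  destruct (Ceq_dec al 0%C) as [->|N].
  - exists 1%C. rewrite Cmod_1, Cmod_0. split. reflexivity. ring.
  - assert (Hp : 0 < Cmod al) by (apply Cmod_gt_0; exact N).
    assert (Nm : RtoC (Cmod al) <> 0%C) by (intros E; apply RtoC_inj in E; lra).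
    exists (Cconj al / Cmod al)%C. split.
    rewrite Cmod_div, Cmod_conj, Cmod_R, Rabs_pos_eq by (lra || assumption). field; lra.
    replace (al * (Cconj al / Cmod al))%C with ((al * Cconj al) / Cmod al)%C by (field; exact Nm).
    rewrite <- Cmod2_conj, RtoC_pow. field. exact Nm.
Qed.

Lemma ln_ge_0 (x : R) : 1 <= x -> 0 <= ln x.
Proof. intros H. rewrite <- ln_1. apply ln_le; lra. Qed.

Lemma ln_pow2 (x : R) : 0 < x -> ln (x ^ 2) = 2 * ln x.
Proof. intros H. rewrite ln_pow by exact H. simpl. ring. Qed.

Lemma exp_like_ratio c K a : exp_like c K a -> 1 <= K / c.
Proof.
  intros (Hc & HK & _). apply Rmult_le_reg_r with c. exact Hc. replace (K / c * c) with K by (field; lra). lra.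
Qed.

Lemma no_zero_upper c K a F : exp_like c K a -> (forall z, F z = ps a z) ->
  (forall d, 0 < d -> exists T, forall r, T <= r -> Rbar_le (zero_count F r) (Finite (d * sqrt r))) ->
  forall z0, ps a z0 <> 0%C.
Proof.
  intros He HF Hcount z0 Hz0.
  assert (Ha := exp_like_fast _ _ _ He). assert (Ha0 := exp_like_0 _ _ _ He).
  assert (Nz0 : z0 <> 0%C). { intros ->. rewrite ps_0 in Hz0. contradiction. }
  destruct (zeroes_away a Ha Ha0) as (x0 & Hx0 & Haway).
  assert (HKc := exp_like_ratio _ _ _ He).
  assert (HlKc := ln_ge_0 _ HKc).
  (* 1024 bounds the deviation of [h] from linearity on the disc used below, and the last 1 is the
     Phragmen-Lindelof term at the fixed [t]. *)
  apply (unbounded_growth z0 (ln (K / c) + 1024 + 1) Nz0). intros t Ht.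
  (* The bound on the ray will have slope parameter [2 * d], so its contribution at [t] is
     [3 * (2 * d) * sqrt t <= 1]. *)
  set (d := / (6 * sqrt t + 1)).
  assert (Hst := sqrt_pos t).
  assert (Hd : 0 < d) by (apply Rinv_0_lt_compat; lra).
  assert (Hdt : 6 * d * sqrt t <= 1).
  { apply Rmult_le_reg_r with (6 * sqrt t + 1). lra.
    replace (6 * d * sqrt t * (6 * sqrt t + 1)) with (6 * sqrt t) by (unfold d; field; lra). lra. }
  destruct (Hcount (d / 64)) as (T0 & HT0). lra.
  assert (HD : 0 < d / 64) by lra. assert (HDd : 32 * (d / 64) = d / 2) by field.
  set (D := d / 64) in *. clearbody D. set (T := Rmax T0 1).
  assert (HT1 : 1 <= T) by apply Rmax_r. assert (HT : T0 <= T) by apply Rmax_l. clearbody T.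
  destruct (ex_nat_between (D * sqrt T)) as (m & Hm & _). { apply Rmult_le_pos. lra. apply sqrt_pos. }
  assert (Hix : 0 < / x0) by (apply Rinv_0_lt_compat, Hx0).
  assert (Hlx : 0 <= ln (1 + / x0)) by (apply ln_ge_0; lra).
  (* From [S1] on, the zeroes within [T] add at most [d / 2 * s] to the logarithm of the growth; the
     others add [32 * D * s], again [d / 2 * s]. From [S2] on, the polynomial factor of [log_lower]
     and the constant 1024 together stay below [d * s]; 1026 is 1024 plus the exponent 2 of
     [1 + s]. *)
  destruct (log_negligible (INR m * (2 + ln (1 + / x0))) (d / 2)) as (S1 & HS1 & HS1'). lra.
  destruct (log_negligible (ln (4 * (K / c)) + 1026) d Hd) as (S2 & HS2 & HS2').
  assert (Hz00 := Cmod_ge_0 z0).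
  assert (Hs : exists s, 2 <= s /\ S1 <= s /\ S2 <= s /\ sqrt t <= s /\ T <= s /\ ln (K / c) <= s /\ Cmod z0 <= s).
  { exists (2 + S1 + S2 + sqrt t + T + ln (K / c) + Cmod z0). repeat split; lra. }
  destruct Hs as (s & Hs2 & Hs_1 & Hs_2 & Hs_t & Hs_T & Hs_K & Hs_z).
  assert (Hlns : 0 <= ln (1 + s)) by (apply ln_ge_0; lra).
  (* The Phragmen-Lindelof disc has radius [s ^ 2], the square root of [r]: there the error
     [1024 / r * Cmod z ^ 2] of the linear approximation is at most 1024. *)
  set (r := s ^ 4).
  assert (Hr2 : r = s ^ 2 * s ^ 2) by (unfold r; ring). clearbody r.
  assert (Hs4 : 4 <= s ^ 2) by nra.
  assert (Hss : s <= s ^ 2) by nra.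
  assert (Hsr : s ^ 2 <= r / 4) by (rewrite Hr2; nra).
  assert (Hrs : s <= r) by lra.
  destruct (factorization a r Ha Ha0) as (l & g & Hf & Hnz). lra.
  destruct (log_exists c K a r l g He) as (h & q & q' & L); try assumption. lra. lra.
  assert (Hl : forall b, In b l -> b <> 0%C /\ Cmod b <= r) by apply Hf.
  assert (Hnl : nonzero l) by (intros b Hb; apply Hl, Hb).
  (* [l] exhausts the zeroes up to [r] only; beyond [r] its count is constant while the bound keeps
     growing. *)
  assert (Hcnt : forall u, T <= u -> count u l <= D * sqrt u).
  { assert (K1 : forall u, T <= u -> u <= r -> count u l <= D * sqrt u).
    { intros u Hu Hur. assert (Z := zero_count_ge a r l g u Hf Hnz Hur F HF).
      assert (Z2 := HT0 u ltac:(lra)). apply (Rbar_le_trans _ _ _ Z) in Z2. exact Z2. }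
    intros u Hu. destruct (Rle_dec u r) as [Hur|Hur]. apply K1; assumption.
    assert (Hru : r <= u) by lra.
    rewrite (count_all u l). 2: intros b Hb; destruct (Hl b Hb); lra.
    rewrite <- (count_all r l). 2: intros b Hb; apply Hl, Hb.
    eapply Rle_trans. apply K1; lra.
    apply Rmult_le_compat_l. lra. apply sqrt_le_1_alt, Hru. }
  assert (Hsqs : sqrt (s ^ 2) = s) by (apply sqrt_pow2; lra).
  assert (G : growth l (s ^ 2) <= exp (d * s)).
  { eapply Rle_trans. apply (growth_sqrt l (s ^ 2) D T x0 m Hnl); try assumption; try lra.
    intros b Hb. apply Haway, (factor_is_zero _ _ _ _ _ Hf Hb).
    rewrite Hsqs. replace (d * s) with (d / 2 * s + 32 * D * s) by (rewrite HDd; field).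
    rewrite exp_plus, Rmult_assoc. apply Rmult_le_compat_r. left; apply exp_pos.
    assert (Hb : 1 + s ^ 2 / x0 <= (1 + s) ^ 2 * (1 + / x0)) by (unfold Rdiv; nra).
    assert (Hb0 : 0 < 1 + s ^ 2 / x0) by (unfold Rdiv; nra).
    rewrite <- (exp_ln ((1 + s ^ 2 / x0) ^ m)) by (apply pow_lt, Hb0). apply exp_le.
    rewrite ln_pow by exact Hb0.
    eapply Rle_trans; [|apply (HS1' s Hs_1)]. rewrite Rmult_assoc. apply Rmult_le_compat_l. apply pos_INR.
    eapply Rle_trans. apply ln_le; [exact Hb0|exact Hb].
    rewrite ln_mult, ln_pow2 by (try apply pow_lt; lra). nra. }
  destruct (log_lower c K a r l g h q q' (s ^ 2) He Hf L) as (z1 & Hz1 & Hlow). lra.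
  set (al := q 0%C).
  assert (Hup : Re (h z1) <= Cmod al * s ^ 2 + 1024).
  { assert (Lin := log_linear r g h q q' L ltac:(lra) z1 ltac:(lra)). fold al in Lin.
    replace (h z1) with ((h z1 - al * z1) + al * z1)%C by ring. rewrite re_plus.
    generalize (Re_le_Cmod (h z1 - al * z1)%C) (Re_le_Cmod (al * z1)%C). rewrite Cmod_mult, Hz1.
    rewrite Hz1 in Lin. replace (1024 / r * (s ^ 2) ^ 2) with 1024 in Lin by (rewrite Hr2; field; lra). lra. }
  assert (Hal : s ^ 2 - 2 * d * s <= Cmod al * s ^ 2).
  { assert (ln (K / c * (4 * s ^ 2 + 4) * growth l (s ^ 2)) <= d * s - 1024 + d * s); [|lra].
    assert (G1 := growth_ge_1 l (s ^ 2) Hnl ltac:(lra)).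
    assert (P1 : 0 < K / c * (4 * s ^ 2 + 4)) by (apply Rmult_lt_0_compat; lra).
    rewrite ln_mult by lra.
    assert (ln (growth l (s ^ 2)) <= d * s). { rewrite <- (ln_exp (d * s)). apply ln_le; lra. }
    assert (ln (K / c * (4 * s ^ 2 + 4)) <= d * s - 1024); [|lra].
    apply Rle_trans with (ln (4 * (K / c) * (1 + s) ^ 2)). { apply ln_le. exact P1.
      replace (4 * (K / c) * (1 + s) ^ 2) with (K / c * (4 * (1 + s) ^ 2)) by ring. apply Rmult_le_compat_l. lra. nra. }
    rewrite ln_mult, ln_pow2 by (try apply pow_lt; lra).
    specialize (HS2' s Hs_2). assert (0 <= ln (4 * (K / c))) by (apply ln_ge_0; lra). nra. }
  (* In the direction [e] the linear part of [h] is real and grows at the full rate [Cmod al], so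
     [Re h] is within a constant of its maximum on the circle. *)
  destruct (unit_phase al) as (e & He1 & Hee).
  exists l. split. exact Hnl. split.
  { apply (zero_in_factors a r l g z0 Hf Hnz); [|exact Hz0]. lra. }
  eapply Rle_trans. apply (growth_nonneg_bound l (ln (K / c) + 1024) s (2 * d) Hnl); try lra.
  - intros u Hu.
    assert (Hzu : Cmod (u * e)%C = u). { rewrite Cmod_mult, He1, Cmod_R, Rabs_pos_eq; lra. }
    assert (B := rotated_bound c K a r l g h q q' (u * e)%C He Hf L ltac:(lra)). rewrite Hzu in B.
    eapply Rle_trans; [exact B|].
    rewrite Rplus_assoc, (exp_plus (ln (K / c))), exp_ln by lra. apply Rmult_le_compat_l. lra. apply exp_le.
    assert (Lin := log_linear r g h q q' L ltac:(lra) (u * e)%C ltac:(lra)). fold al in Lin. rewrite Hzu in Lin.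
    assert (1024 / r * u ^ 2 <= 1024).
    { apply Rmult_le_reg_r with r. lra. replace (1024 / r * u ^ 2 * r) with (1024 * u ^ 2) by (field; lra).
      apply Rmult_le_compat_l. lra. rewrite Hr2. replace (s ^ 2 * s ^ 2) with ((s ^ 2) ^ 2) by ring. apply pow_incr, Hu. }
    assert (Re (h (u * e)%C) >= Cmod al * u - 1024).
    { replace (h (u * e)%C) with ((h (u * e) - al * (u * e)) + u * (al * e))%C by ring. rewrite re_plus, Hee, re_scal_l.
      simpl (Re (Cmod al)). generalize (re_le_Cmod (h (u * e) - al * (u * e))%C). intros A1. apply Rabs_le_between in A1. lra. }
    assert (u - Cmod al * u <= 2 * d * u / s); [|lra].
    apply Rmult_le_reg_r with (s ^ 2). lra. replace (2 * d * u / s * s ^ 2) with (2 * d * s * u) by (field; lra). nra.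
  - eapply Rle_trans; [exact G|]. apply exp_le. nra.
  - split. lra. replace t with (sqrt t ^ 2) by (simpl; rewrite Rmult_1_r; apply sqrt_sqrt; lra).
    apply pow_incr. split. exact Hst. lra.
  - apply exp_le. lra.
Qed.

(** * Maximum modulus on complex circles *)

(** (4/3)^4 = 256/81 exceeds 3, which bounds e. *)
Lemma exp_quarter : exp (1/4) <= 4/3.
Proof.
  apply Rnot_lt_le. intros H. assert (E : exp (1/4) ^ 4 = exp 1).
  { simpl. rewrite Rmult_1_r, <- !exp_plus. f_equal. field. }
  assert ((4/3) ^ 4 <= exp (1/4) ^ 4) by (apply pow_incr; lra).
  assert (3 < (4/3) ^ 4) by lra. generalize exp_le_3. lra.
Qed.

Lemma Cmod_Cexp_small v : Cmod v <= 1/4 -> Cmod (Cexp v) <= 4/3.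
Proof.
  intros H. rewrite Cmod_Cexp. eapply Rle_trans; [|apply exp_quarter]. apply exp_le.
  generalize (Re_le_Cmod v). lra.
Qed.

Lemma Cexp_sub_1 v : Cmod v <= 1/4 -> Cmod (Cexp v - 1)%C <= 1/3.
Proof.
  intros H. rewrite <- Cexp_0.
  apply Rle_trans with (4/3 * Cmod (v - 0)%C).
  - apply (mean_value_ineq Cexp Cexp). lra. intros; apply cder_Cexp.
    intros t Ht. rewrite segment_0. apply Cmod_Cexp_small. generalize (Cmod_segment v t Ht). lra.
  - replace (v - 0)%C with v by ring. lra.
Qed.

(** The angle of maximal modulus on a circle is the fixed point of [u => - Im (angle_defect x u)];
    both the fixed point iteration and the maximum are continued to complex radii [x]. *)
Section MaximumCurve.

Variables (r A : R) (g : nat -> C) (h q q' : C -> C).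
Hypothesis Hr : 0 < r.
Hypothesis L : log_data r g h q q'.
Hypothesis HA : 1/2 <= A.
Hypothesis Hq0 : q 0%C = RtoC A.

(* [2^18] makes both [defect_lip] and the comparison of directions in [near_max] work. *)
Let r0 := r / 262144.

(** At [v = Ci * u] the derivative of [h (x * Cexp v)] in [u] is
    [Ci * x * A * (1 + v + angle_defect x v)]. Its real part is
    [- (x * A * (u + Im (angle_defect x v)))], whence the fixed point equation for the critical
    angle. *)
Definition angle_defect (x v : C) : C := (Cexp v * q (x * Cexp v) / A - 1 - v)%C.

Lemma curve_arg x v : Cmod x <= r0 -> Cmod v <= 1/4 ->
  Cmod (x * Cexp v)%C <= 4/3 * Cmod x /\ Cmod (x * Cexp v)%C <= r / 4 /\ Cmod (x * Cexp v)%C < r.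
Proof.
  intros Hx Hv. rewrite Cmod_mult. assert (H := Cmod_Cexp_small v Hv). assert (H2 := Cmod_ge_0 x).
  assert (Cmod x * Cmod (Cexp v) <= 4/3 * Cmod x). { rewrite Rmult_comm. apply Rmult_le_compat_r; lra. }
  unfold r0 in Hx. repeat split; lra.
Qed.

Lemma A_nz : RtoC A <> 0%C.
Proof. intros E. apply RtoC_inj in E. lra. Qed.

(** The derivative in [v] is [Cexp v - 1], at most 1/3, plus two terms measuring how far [q] is from
    the constant [A]. Each of these is at most 1/36, thanks to the size of [r0] and [A >= 1/2]. *)
Lemma defect_lip x v w : Cmod x <= r0 -> Cmod v <= 1/4 -> Cmod w <= 1/4 ->
  Cmod (angle_defect x v - angle_defect x w)%C <= 1/2 * Cmod (v - w)%C.
Proof.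
  intros Hx Hv Hw.
  assert (Hseg : forall t : R, 0 <= t <= 1 -> Cmod (w + t * (v - w))%C <= 1/4).
  { intros t Ht. replace (w + t * (v - w))%C with ((1 - t)%R * w + t * v)%C by (rewrite RtoC_minus; ring).
    eapply Rle_trans; [apply Cmod_triangle|]. rewrite !Cmod_mult, !Cmod_R, !Rabs_pos_eq by lra. nra. }
  apply (mean_value_ineq (angle_defect x) (fun v => (Cexp v * q (x * Cexp v) + Cexp v * (q' (x * Cexp v) * (x * Cexp v))) / A - 1)%C).
  lra.
  - intros t Ht. specialize (Hseg t Ht). set (u := (w + t * (v - w))%C) in *.
    destruct (curve_arg x u Hx Hseg) as (C1 & C2 & C3).
    unfold angle_defect. eapply cder_eq. apply cder_minus. apply cder_minus.
    apply (cder_mult (fun v => Cexp v * q (x * Cexp v))%C (fun _ => / A)%C).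
    apply (cder_mult Cexp (fun v => q (x * Cexp v))%C). apply cder_Cexp.
    apply (cder_comp (fun v => x * Cexp v)%C q). apply cder_scal, cder_Cexp. apply (log_der2 _ _ _ _ _ L), C3.
    apply cder_const. apply cder_const. apply cder_id. cbv beta. unfold Cdiv. ring.
  - intros t Ht. specialize (Hseg t Ht). set (u := (w + t * (v - w))%C) in *.
    destruct (curve_arg x u Hx Hseg) as (C1 & C2 & C3).
    assert (B1 := Cexp_sub_1 u Hseg). assert (B2 := Cmod_Cexp_small u Hseg).
    assert (B3 := log_q_lip _ _ _ _ _ L Hr _ C2). rewrite Hq0 in B3.
    assert (B4 := log_q' _ _ _ _ _ L _ C2).
    set (E := Cexp u) in *. set (y := (x * E)%C) in *.
    replace ((E * q y + E * (q' y * y)) / A - 1)%C with ((E - 1) + (E * (q y - A) / A + E * (q' y * y) / A))%C.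
    2:{ field. apply A_nz. }
    assert (Hinv : / A <= 2). { apply Rmult_le_reg_r with A. lra. rewrite Rinv_l by lra. lra. }
    assert (Hinv0 : 0 < / A) by (apply Rinv_0_lt_compat; lra).
    assert (Hy : Cmod y <= r / 196608). { unfold r0 in Hx. lra. }
    assert (Hr1 : 0 < 1024 / r) by (apply Rdiv_lt_0_compat; lra).
    assert (D1 : Cmod (q y - A)%C <= 1/192).
    { eapply Rle_trans; [exact B3|]. apply Rle_trans with (1024 / r * (r / 196608)). apply Rmult_le_compat_l; lra. right; field; lra. }
    assert (D2 : Cmod (q' y * y)%C <= 1/192).
    { rewrite Cmod_mult. apply Rle_trans with (1024 / r * (r / 196608)). apply Rmult_le_compat; try apply Cmod_ge_0; assumption. right; field; lra. }
    eapply Rle_trans; [apply Cmod_triangle|].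
    assert (Cmod (E * (q y - A) / A)%C <= 1/36).
    { unfold Cdiv. rewrite !Cmod_mult, Cmod_inv, Cmod_R, (Rabs_pos_eq A) by (lra || apply A_nz).
      apply Rle_trans with (4/3 * (1/192) * 2); [|lra].
      apply Rmult_le_compat; try lra. apply Rmult_le_pos; apply Cmod_ge_0.
      apply Rmult_le_compat; try apply Cmod_ge_0; assumption. }
    assert (Cmod (E * (q' y * y) / A)%C <= 1/36).
    { unfold Cdiv. rewrite (Cmod_mult (E * (q' y * y))), (Cmod_mult E), Cmod_inv, Cmod_R, (Rabs_pos_eq A) by (lra || apply A_nz).
      apply Rle_trans with (4/3 * (1/192) * 2); [|lra].
      apply Rmult_le_compat; try lra. apply Rmult_le_pos; apply Cmod_ge_0.
      apply Rmult_le_compat; try apply Cmod_ge_0; assumption. }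
    generalize (Cmod_triangle (E * (q y - A) / A)%C (E * (q' y * y) / A)%C). lra.
Qed.

(** The defect is at most 1/8 at [v = 0], and the contraction adds at most 1/2 * 1/4; so the
    iteration stays in the disc of radius 1/4. *)
Lemma defect_bound x v : Cmod x <= r0 -> Cmod v <= 1/4 -> Cmod (angle_defect x v) <= 1/4.
Proof.
  intros Hx Hv. assert (H := defect_lip x v 0%C Hx Hv ltac:(rewrite Cmod_0; lra)).
  replace (v - 0)%C with v in H by ring.
  assert (H0 : Cmod (angle_defect x 0%C) <= 1/8).
  { unfold angle_defect. rewrite Cexp_0.
    replace (1 * q (x * 1) / A - 1 - 0)%C with ((q (x * 1) - A) / A)%C by (field; apply A_nz).
    rewrite Cmult_1_r. rewrite Cmod_div, Cmod_R, Rabs_pos_eq by (lra || apply A_nz).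
    assert (B3 := log_q_lip _ _ _ _ _ L Hr x ltac:(unfold r0 in Hx; lra)). rewrite Hq0 in B3.
    assert (Hr1 : 0 < 1024 / r) by (apply Rdiv_lt_0_compat; lra).
    apply Rmult_le_reg_r with A. lra. unfold Rdiv at 1. rewrite Rmult_assoc, Rinv_l by lra.
    apply Rle_trans with (1024 / r * r0). rewrite Rmult_1_r. eapply Rle_trans; [exact B3|]. apply Rmult_le_compat_l; lra.
    unfold r0. replace (1024 / r * (r / 262144)) with (1/256) by (field; lra). lra. }
  replace (angle_defect x v) with ((angle_defect x v - angle_defect x 0) + angle_defect x 0)%C by ring.
  eapply Rle_trans; [apply Cmod_triangle|]. lra.
Qed.

(** For real arguments this is - Im w = (i/2) (w - conj w) with [w = angle_defect x (Ci * u)].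
    Conjugating the arguments as well as the value makes the second term holomorphic in [x] and
    [u]. *)
Definition rotate (x u : C) : C := ((1/2)%R * Ci * (angle_defect x (Ci * u) - Cconj (angle_defect (Cconj x) (Ci * Cconj u))))%C.

(** The iteration starts at angle 0, where the real part of the linear term [A * z] is maximal. *)
Fixpoint angle (n : nat) (x : C) : C :=
  match n with O => 0%C | S n => rotate x (angle n x) end.

Lemma Cmod_Ci_mult u : Cmod (Ci * u)%C = Cmod u.
Proof. rewrite Cmod_mult, Cmod_Ci. ring. Qed.

Lemma angle_bound n x : Cmod x <= r0 -> Cmod (angle n x) <= 1/4.
Proof.
  intros Hx. induction n as [|n IH]; simpl. rewrite Cmod_0; lra.
  unfold rotate. rewrite Cmod_mult.
  rewrite Cmod_mult, Cmod_Ci, Cmod_R, Rabs_pos_eq by lra.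
  assert (B1 := defect_bound x (Ci * angle n x)%C Hx ltac:(rewrite Cmod_Ci_mult; exact IH)).
  assert (B2 := defect_bound (Cconj x) (Ci * Cconj (angle n x))%C ltac:(rewrite Cmod_conj; exact Hx)
    ltac:(rewrite Cmod_Ci_mult, Cmod_conj; exact IH)).
  rewrite <- Cmod_conj in B2.
  generalize (Cmod_minus_le (angle_defect x (Ci * angle n x)) (Cconj (angle_defect (Cconj x) (Ci * Cconj (angle n x))))). lra.
Qed.

Lemma angle_conj n x : angle n (Cconj x) = Cconj (angle n x).
Proof.
  induction n as [|n IH]; simpl. cring.
  rewrite IH. unfold rotate. rewrite !Cconj_conj.
  set (a := angle_defect (Cconj x) _). set (b := angle_defect x _).
  cring.
Qed.

Let disc (z : C) : Prop := Cmod z < r0.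

Lemma disc_conj z : disc z -> disc (Cconj z).
Proof. unfold disc. rewrite Cmod_conj. auto. Qed.

Lemma curve_holo f n : holo (fun z => Cmod z < r) f -> holo disc (angle n) ->
  holo disc (fun x => f (x * Cexp (Ci * angle n x))%C).
Proof.
  intros Hf Ha. apply (holo_comp disc (fun z => Cmod z < r) (fun x => x * Cexp (Ci * angle n x))%C); [|exact Hf|].
  - holo.
  - intros x Hx. apply curve_arg. left; exact Hx. rewrite Cmod_Ci_mult. apply angle_bound. left; exact Hx.
Qed.

Lemma angle_holo n : holo disc (angle n).
Proof.
  induction n as [|n IH]. apply (holo_const disc 0%C).
  assert (Hq : holo disc (fun x => q (x * Cexp (Ci * angle n x)))%C).
  { apply curve_holo; [|exact IH]. exists q'. apply (log_der2 _ _ _ _ _ L). }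
  assert (Hb : holo disc (fun x => angle_defect x (Ci * angle n x)%C)).
  { unfold angle_defect, Cdiv. holo. }
  apply holo_ext with (fun x => (1/2)%R * Ci * (angle_defect x (Ci * angle n x) -
     Cconj (angle_defect (Cconj x) (Ci * angle n (Cconj x)))))%C.
  { intros x. simpl. unfold rotate. rewrite angle_conj. reflexivity. }
  assert (Hc := holo_conj disc _ disc_conj Hb). cbv beta in Hc. holo.
Qed.

(** Holomorphic extension of [x - Re h] along the curve of approximate maxima: the real part is
    replaced by the half sum of a function and its reflection in the real axis. *)
Definition defect (n : nat) (x : C) : C :=
  (x - (h (x * Cexp (Ci * angle n x)) + Cconj (h (Cconj x * Cexp (Ci * angle n (Cconj x))))) / 2)%C.

Lemma defect_holo n : holo disc (defect n).
Proof.
  assert (Hp : holo disc (fun x => h (x * Cexp (Ci * angle n x)))%C).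
  { apply curve_holo; [|apply angle_holo]. exists q. intros z Hz. split. apply (log_der _ _ _ _ _ L), Hz.
    apply (log_ccont_q _ _ _ _ _ L), Hz. }
  assert (Hc := holo_conj disc _ disc_conj Hp). cbv beta in Hc. unfold defect, Cdiv. holo.
Qed.

Lemma defect_size n x : Cmod x <= r0 -> Cmod (defect n x) <= 87 * Cmod x.
Proof.
  intros Hx. unfold defect.
  (* [h] has Lipschitz constant 64 and the point has modulus at most 4/3 of [Cmod y]; 86 rounds up
     64 * 4/3. *)
  assert (B : forall y, Cmod y <= r0 -> Cmod (h (y * Cexp (Ci * angle n y))%C) <= 86 * Cmod y).
  { intros y Hy. destruct (curve_arg y (Ci * angle n y)%C Hy ltac:(rewrite Cmod_Ci_mult; apply angle_bound, Hy)) as (C1 & C2 & _).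
    eapply Rle_trans. apply (log_lip _ _ _ _ _ L Hr). lra. generalize (Cmod_ge_0 y). lra. }
  assert (B1 := B x Hx). assert (B2 := B (Cconj x) ltac:(rewrite Cmod_conj; exact Hx)).
  rewrite Cmod_conj, <- (Cmod_conj (h _)) in B2.
  eapply Rle_trans; [apply Cmod_minus_le|].
  rewrite Cmod_div, Cmod_R, (Rabs_pos_eq 2) by (lra || (intros E; apply RtoC_inj in E; lra)).
  generalize (Cmod_triangle (h (x * Cexp (Ci * angle n x))%C) (Cconj (h (Cconj x * Cexp (Ci * angle n (Cconj x)))))%C). lra.
Qed.

Lemma Cconj_R (x : R) : Cconj (RtoC x) = RtoC x.
Proof. cring. Qed.

Lemma angle_real n (x : R) : angle n x = RtoC (Re (angle n x)).
Proof.
  assert (H := angle_conj n x). rewrite Cconj_R in H.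
  apply C_ext. reflexivity. simpl. apply (f_equal Im) in H. simpl in H. unfold Im in *. lra.
Qed.

Lemma defect_real n (x : R) : defect n x = RtoC (x - Re (h (x * Cexp (Ci * angle n x))%C))%R.
Proof.
  unfold defect. rewrite Cconj_R. set (w := h _). apply C_ext; simpl; unfold Re, Im; field.
Qed.

Definition next (x u : R) : R := - Im (angle_defect x (Ci * u)%C).

Lemma rotate_real (x u : R) : rotate x u = RtoC (next x u).
Proof.
  unfold rotate, next. rewrite !Cconj_R. set (w := angle_defect _ _). apply C_ext; simpl; unfold Re, Im; lra.
Qed.

Lemma next_lip (x u v : R) : 0 <= x <= r0 -> Rabs u <= 1/4 -> Rabs v <= 1/4 ->
  Rabs (next x u - next x v) <= 1/2 * Rabs (u - v).
Proof.
  intros Hx Hu Hv. unfold next.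
  replace (- Im (angle_defect x (Ci * u)%C) - - Im (angle_defect x (Ci * v)%C)) with
    (- Im (angle_defect x (Ci * u) - angle_defect x (Ci * v))%C) by rring.
  rewrite Rabs_Ropp. eapply Rle_trans; [apply im_le_Cmod|].
  eapply Rle_trans. apply defect_lip. rewrite Cmod_R, Rabs_pos_eq; lra.
  rewrite Cmod_Ci_mult, Cmod_R; exact Hu. rewrite Cmod_Ci_mult, Cmod_R; exact Hv.
  replace (Ci * u - Ci * v)%C with (Ci * (u - v)%R)%C by (rewrite RtoC_minus; ring).
  rewrite Cmod_Ci_mult, Cmod_R. lra.
Qed.

Let an (n : nat) (x : R) : R := Re (angle n x).

Lemma an_bound n (x : R) : 0 <= x <= r0 -> Rabs (an n x) <= 1/4.
Proof.
  intros Hx. unfold an. eapply Rle_trans; [apply re_le_Cmod|]. apply angle_bound. rewrite Cmod_R, Rabs_pos_eq; lra.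
Qed.

Lemma an_next n (x : R) : an (S n) x = next x (an n x).
Proof. unfold an. change (angle (S n) x) with (rotate x (angle n x)). rewrite (angle_real n x) at 1. rewrite rotate_real. reflexivity. Qed.

Lemma an_conv n (x : R) : 0 <= x <= r0 -> Rabs (an n x - next x (an n x)) <= (1/2) ^ n.
Proof.
  intros Hx. rewrite <- an_next. induction n as [|n IH].
  - unfold an at 1. simpl Re. replace (0 - an 1 x) with (- an 1 x) by ring. rewrite Rabs_Ropp. simpl pow.
    generalize (an_bound 1 x Hx). lra.
  - rewrite (an_next (S n)), (an_next n) at 1. 
    eapply Rle_trans. apply next_lip; try apply an_bound; exact Hx. simpl pow. lra.
Qed.

Let W (x u : R) : R := Re (h (x * Cexp (Ci * u))%C).

Lemma W_der (x u : R) : 0 <= x <= r0 -> Rabs u <= 1/4 ->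
  is_derive (W x) u (- (x * A * (u - next x u))).
Proof.
  intros Hx Hu.
  assert (Ha : Cmod (Ci * u)%C <= 1/4) by (rewrite Cmod_Ci_mult, Cmod_R; exact Hu).
  destruct (curve_arg x (Ci * u)%C ltac:(rewrite Cmod_R, Rabs_pos_eq; lra) Ha) as (_ & _ & C3).
  replace (- (x * A * (u - next x u))) with (Re (q (x * Cexp (Ci * u)) * (x * (Cexp (Ci * u) * Ci)) * 1)%C).
  - apply (rcder_Re (fun u : R => h (x * Cexp (Ci * u))%C)).
    apply (rcder_comp (fun u => h (x * Cexp (Ci * u))%C) RtoC). apply rcder_fst.
    apply (cder_comp (fun u => x * Cexp (Ci * u))%C h). apply cder_scal.
    apply (cder_comp (fun u => Ci * u)%C Cexp). eapply cder_eq. apply cder_scal, cder_id. ring. apply cder_Cexp.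
    apply (log_der _ _ _ _ _ L), C3.
  - assert (E : (Cexp (Ci * u) * q (x * Cexp (Ci * u)))%C = (A * (1 + Ci * u + angle_defect x (Ci * u)))%C).
    { unfold angle_defect. field. apply A_nz. }
    replace (q (x * Cexp (Ci * u)) * (x * (Cexp (Ci * u) * Ci)) * 1)%C with
      (x * (Ci * (Cexp (Ci * u) * q (x * Cexp (Ci * u)))))%C by ring.
    rewrite E. unfold next. set (w := angle_defect _ _). rring.
Qed.

(** The contraction makes [y - next x y] increase in [y], and at [an n x] it is at most [(1/2) ^ n]
    in absolute value. So moving away from [an n x] increases [W] at a rate of at most
    [x * A * (1/2) ^ n]. *)
Lemma W_near_max n (x u : R) : 0 <= x <= r0 -> Rabs u <= 1/4 -> W x u <= W x (an n x) + x * A * (1/2) ^ n.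
Proof.
  intros Hx Hu. set (v := an n x). assert (Hv : Rabs v <= 1/4) by (apply an_bound, Hx).
  assert (Hc := an_conv n x Hx). fold v in Hc.
  assert (Hxa : 0 <= x * A) by (apply Rmult_le_pos; lra).
  apply Rabs_le_between in Hu. apply Rabs_le_between in Hv.
  assert (Hin : forall y, Rmin v u <= y <= Rmax v u -> -(1/4) <= y <= 1/4).
  { intros y Hy. unfold Rmin, Rmax in Hy. destruct (Rle_dec v u); lra. }
  destruct (MVT_gen (W x) v u (fun u => - (x * A * (u - next x u)))) as (y & Hy & E).
  1,2: intros y Hy; assert (K := Hin y ltac:(lra)).
  - apply W_der. exact Hx. apply Rabs_le. lra.
  - apply derivable_continuous_pt. eexists. apply is_derive_Reals, W_der. exact Hx. apply Rabs_le. lra.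
  - assert (Hy4 := Hin y Hy).
    assert (Hl := next_lip x y v Hx ltac:(apply Rabs_le; lra) ltac:(apply Rabs_le; lra)).
    apply Rabs_le_between in Hc.
    assert (Key : - ((y - next x y) * (u - v)) <= (1/2) ^ n).
    { destruct (Rle_dec v u) as [Hvu|Hvu].
      - rewrite Rmin_left, Rmax_right in Hy by lra.
        rewrite (Rabs_pos_eq (y - v)) in Hl by lra. apply Rabs_le_between in Hl. nra.
      - rewrite Rmin_right, Rmax_left in Hy by lra.
        rewrite (Rabs_left1 (y - v)) in Hl by lra. apply Rabs_le_between in Hl. nra. }
    assert (x * A * - ((y - next x y) * (u - v)) <= x * A * (1/2) ^ n) by (apply Rmult_le_compat_l; assumption).
    lra.
Qed.

Lemma near_max n (x : R) z : 0 <= x <= r0 -> Cmod z = x ->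
  Re (h z) <= Re (h (x * Cexp (Ci * angle n x))%C) + x * A * (1/2) ^ n.
Proof.
  intros Hx Hz. rewrite (angle_real n x). fold (an n x). fold (W x (an n x)).
  (* Away from the positive axis the linear term decides: it loses at least [A * x / 50], hence
     [x / 100], against angle 0, while the two approximation errors are at most [x / 256] each. *)
  destruct (Rle_dec (Re z) (98/100 * x)) as [Hre|Hre].
  - apply Rle_trans with (W x 0). 2: apply W_near_max; [exact Hx|rewrite Rabs_R0; lra].
    assert (Hx4 : x <= r / 4) by (unfold r0 in Hx; lra).
    assert (Hrx : 1024 / r * x ^ 2 <= x / 256).
    { replace (x / 256) with (1024 / r * (x * r0)) by (unfold r0; field; lra).
      apply Rmult_le_compat_l. left; apply Rdiv_lt_0_compat; lra. nra. }
    assert (L1 := log_linear _ _ _ _ _ L Hr z ltac:(lra)). rewrite Hz, Hq0 in L1.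
    assert (L2 := log_linear _ _ _ _ _ L Hr x ltac:(rewrite Cmod_R, Rabs_pos_eq; lra)).
    rewrite Hq0, Cmod_R, Rabs_pos_eq in L2 by lra.
    assert (R1 := Re_le_Cmod (h z - A * z)%C).
    assert (R2 := re_le_Cmod (h x - A * x)%C). apply Rabs_le_between in R2.
    replace (Re (h z - A * z)%C) with (Re (h z) - A * Re z) in R1 by rring.
    replace (Re (h x - A * x)%C) with (Re (h x) - A * x) in R2 by rring.
    assert (EW : W x 0 = Re (h x)).
    { unfold W. do 2 f_equal. replace (Ci * 0)%C with (RtoC 0) by ring. rewrite Cexp_0. ring. }
    rewrite EW. nra.
  - assert (Hx0 : 0 < x). { destruct (Rle_lt_or_eq_dec 0 x) as [H|H]. lra. exact H.
      exfalso. apply Hre. rewrite <- H in *. apply Cmod_eq_0 in Hz. rewrite Hz. simpl. lra. }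
    apply Rnot_le_lt in Hre.
    assert (E : Re z ^ 2 + Im z ^ 2 = x ^ 2) by (rewrite <- Cmod2_alt, Hz; reflexivity).
    (* The tangent of the argument of [z]. In this sector [t ^ 2 <= 1/16], so the angle lies in the
       range of [W_near_max]. *)
    set (t := Im z / Re z). assert (Hrz : 0 < Re z) by lra.
    assert (Ht2 : (1 + t ^ 2) * (Re z) ^ 2 = x ^ 2) by (unfold t; rewrite <- E; field; lra).
    assert (Hs : sqrt (1 + t ^ 2) = x / Re z).
    { replace (1 + t ^ 2) with ((x / Re z) ^ 2). apply sqrt_pow2. left; apply Rdiv_lt_0_compat; lra.
      apply Rmult_eq_reg_r with (Re z ^ 2). rewrite Ht2. field. lra. apply pow_nonzero. lra. }
    set (u := atan t).
    assert (Hu : Rabs u <= 1/4).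
    { assert (Ht : Rabs t <= 1/4).
      { rewrite <- (Rabs_pos_eq (1/4)) by lra. apply Rsqr_le_abs_0.
        unfold Rsqr. assert (t ^ 2 * Re z ^ 2 <= 1/16 * Re z ^ 2). { nra. }
        assert (0 < Re z ^ 2) by (apply pow_lt; lra). nra. }
      eapply Rle_trans; [|exact Ht].
      assert (Hat : forall y, 0 <= y -> atan y <= y).
      { intros y Hy. destruct (Req_dec y 0) as [->|N]. rewrite atan_0; lra.
        destruct (MVT_derive atan (fun x => / (1 + x ^ 2)) 0 y Hy) as (w & Hw & Ew).
        { intros w _. apply is_derive_Reals, derivable_pt_lim_atan. }
        rewrite atan_0 in Ew. assert (/ (1 + w ^ 2) <= / 1).
        { apply Rinv_le_contravar. lra. generalize (pow2_ge_0 w). lra. }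
        rewrite Rinv_1 in H. nra. }
      unfold u. destruct (Rle_dec 0 t) as [H0|H0].
      - rewrite (Rabs_pos_eq t), Rabs_pos_eq. apply Hat, H0. 2: exact H0.
        rewrite <- atan_0. destruct (Req_dec 0 t) as [<-|N]. lra. left; apply atan_increasing; lra.
      - rewrite (Rabs_left1 t) by lra. rewrite <- (Ropp_involutive t) at 1. rewrite atan_opp, Rabs_Ropp, Rabs_pos_eq.
        apply Hat; lra. rewrite <- atan_0. left; apply atan_increasing; lra. }
    assert (Ez : z = (x * Cexp (Ci * u))%C).
    { unfold Cexp. replace (Re (Ci * u)%C) with 0 by rring. replace (Im (Ci * u)%C) with u by rring.
      rewrite exp_0. unfold u. rewrite cos_atan, sin_atan.
      replace (t²) with (t ^ 2) by (unfold Rsqr; ring). rewrite Hs.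
      apply C_ext; simpl; unfold t; unfold Re, Im in *; field; lra. }
    rewrite Ez at 1. fold (W x u). apply W_near_max; assumption.
Qed.

Lemma maximum_curve n : exists m : C -> C, holo (fun x => Cmod x < r / 262144) m /\
  (forall x, Cmod x <= r / 262144 -> Cmod (m x) <= 87 * Cmod x) /\
  (forall x : R, 0 <= x <= r / 262144 -> exists z, Cmod z = x /\ m x = RtoC (x - Re (h z))%R /\
     forall z', Cmod z' = x -> Re (h z') <= Re (h z) + x * A * (1/2) ^ n).
Proof.
  exists (defect n). split; [|split].
  - apply defect_holo.
  - intros x Hx. apply defect_size, Hx.
  - intros x Hx. exists (x * Cexp (Ci * angle n x))%C. split; [|split].
    + rewrite (angle_real n x), Cmod_mult, Cmod_Cexp, Cmod_R, Rabs_pos_eq by lra.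
      replace (Re (Ci * Re (angle n x))%C) with 0 by rring. rewrite exp_0. ring.
    + apply defect_real.
    + intros z' Hz'. apply near_max; assumption.
Qed.

End MaximumCurve.

(** * Sparse zeroes on a sequence of discs *)

Lemma Rdiv_le_cross (a b x : R) : 0 < x -> a <= b * x -> a / x <= b.
Proof.
  intros Hx H. apply Rmult_le_reg_r with x. exact Hx.
  unfold Rdiv. rewrite Rmult_assoc, Rinv_l by lra. lra.
Qed.

(** After the square root substitution the small bound [L] holds on the diameter of a half disc, and
    a bound [L * exp (ln r)] on its arc. At relative distance 1 / (3 ln r) from the center the arc
    costs a factor of at most 3; squaring that distance produces the [ln r ^ 2]. *)
Lemma two_constants (m : C -> C) (r L : R) : 1 <= L -> 1 <= ln r -> 0 < r ->
  holo (fun x => Cmod x < r / 262144) m ->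
  (forall x, Cmod x <= r / 262144 -> Cmod (m x) <= 87 * Cmod x) ->
  (forall x : R, 0 <= x <= r / 262144 -> Cmod (m x) <= L) ->
  forall u : R, 0 <= u <= r / 262144 / (36 * ln r ^ 2) ->
  Cmod (m u) <= 12 * L * u / (r / 262144 / (36 * ln r ^ 2)).
Proof.
  intros HL Hln Hr Hm Hsize Hreal.
  set (r0 := r / 262144) in *. assert (Hr0 : 0 < r0) by (unfold r0; lra).
  set (s := sqrt (r0 / 2)).
  assert (Hs : 0 < s) by (apply sqrt_lt_R0; lra).
  assert (Hs2 : s * s = r0 / 2) by (apply sqrt_sqrt; lra).
  set (y := ln r) in *.
  assert (Hy2 : 0 < 36 * y ^ 2) by (assert (0 < y ^ 2) by (apply pow_lt; lra); lra).
  set (rho := r0 / (36 * y ^ 2)).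
  assert (Hrho : 0 < rho) by (apply Rdiv_lt_0_compat; lra).
  assert (Hrr : rho * (36 * y ^ 2) = r0) by (unfold rho; field; lra).
  assert (Hrho0 : 2 * rho <= r0 / 2). { assert (1 <= y ^ 2) by (apply pow_R1_Rle; lra). nra. }
  assert (HD : forall z, Cmod z <= s -> Cmod (z * z)%C <= r0 / 2).
  { intros z Hz. rewrite Cmod_mult, <- Hs2. apply Rmult_le_compat; try apply Cmod_ge_0; assumption. }
  (* [2 * rho] is [s ^ 2 / (9 * y ^ 2)], which is what makes [3 * y * Cmod w <= s]; this is the
     origin of the 36. *)
  assert (B : forall z, Cmod z <= 2 * rho -> Cmod (m z) <= 3 * L).
  { intros z Hz. destruct (upper_sqrt z) as (w & Hw & Hi & Hmw).
    assert (Hw2 : Cmod w * Cmod w <= 2 * rho) by (rewrite <- Cmod_mult, Hw; exact Hz).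
    assert (Hws : 3 * y * Cmod w <= s).
    { apply Rsqr_incr_0_var; [|lra]. unfold Rsqr. rewrite Hs2, <- Hrr. nra. }
    assert (Hws1 : Cmod w <= s) by nra.
    rewrite <- Hw. eapply Rle_trans.
    apply (half_disc_bound (fun z => m (z * z)%C) s (sqrt r0) L y); try assumption; try lra.
    - split. exact Hs. apply sqrt_lt_1; lra.
    - apply (holo_comp _ _ (fun z => z * z)%C m) with (2 := Hm). holo.
      intros x Hx. rewrite Cmod_mult, <- (sqrt_sqrt r0) by lra. generalize (Cmod_ge_0 x). nra.
    - intros x Hx. assert (Hx2 := HD (RtoC x) ltac:(rewrite Cmod_R; exact Hx)).
      rewrite <- RtoC_mult in Hx2 |- *. rewrite Cmod_R, Rabs_pos_eq in Hx2 by nra.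
      apply Rle_trans with L. apply Hreal. split; [nra|lra].
      assert (1 <= exp (y * (x / s) ^ 2)); [|nra]. rewrite <- exp_0. apply exp_le.
      apply Rmult_le_pos. lra. apply pow2_ge_0.
    - intros x Hx _. assert (Hx2 := HD x ltac:(lra)). eapply Rle_trans. apply Hsize; lra.
      unfold y. rewrite exp_ln by exact Hr. unfold r0 in Hx2. nra.
    - rewrite Rmult_comm. apply Rmult_le_compat_r. lra. eapply Rle_trans; [|apply exp_le_3]. apply exp_le.
      replace (3 * y * (Cmod w / s)) with (3 * y * Cmod w / s) by (unfold Rdiv; ring).
      apply Rdiv_le_cross. exact Hs. lra. }
  destruct Hm as (m' & Hm). intros u Hu. fold rho in Hu |- *.
  assert (H0 : m 0%C = 0%C).
  { apply Cmod_eq_0. apply Rle_antisym; [|apply Cmod_ge_0]. eapply Rle_trans. apply Hsize. rewrite Cmod_0; lra. rewrite Cmod_0; lra. }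
  assert (Hseg : forall t : R, 0 <= t <= 1 -> Cmod (t * u)%C <= rho).
  { intros t Ht. eapply Rle_trans. apply Cmod_segment, Ht. rewrite Cmod_R, Rabs_pos_eq; lra. }
  assert (M := mean_value_ineq m m' 0%C (RtoC u) (12 * L / rho)).
  rewrite H0 in M. replace (m u - 0)%C with (m u) in M by ring.
  replace (Cmod (u - 0)%C) with u in M. 2:{ replace (u - 0)%C with (RtoC u) by ring. rewrite Cmod_R, Rabs_pos_eq; lra. }
  replace (12 * L * u / rho) with (12 * L / rho * u) by (field; lra). apply M.
  - apply Rmult_le_pos. lra. left; apply Rinv_0_lt_compat, Hrho.
  - intros t Ht. rewrite segment_0. apply Hm. generalize (Hseg t Ht). lra.
  - intros t Ht. rewrite segment_0. specialize (Hseg t Ht). set (v := (t * u)%C) in *.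
    assert (Hball : forall z, Cmod (z - v)%C < rho -> Cmod z <= 2 * rho).
    { intros z Hz. generalize (Cmod_triangle v (z - v)%C). replace (v + (z - v))%C with z by ring. lra. }
    (* The numerator is at most 2 * (3 L + 3 L), which gives the 12. Integration from [m 0 = 0]
       turns the bound on [m'] into the linear one. *)
    eapply Rle_trans. apply (borel_caratheodory m m' v rho (3 * L) Hrho).
    + intros z Hz. apply Hm. specialize (Hball z Hz). lra.
    + intros z Hz. eapply Rle_trans; [apply Re_le_Cmod|]. apply B, Hball, Hz.
    + apply Rmult_le_compat_r. left; apply Rinv_0_lt_compat, Hrho.
      generalize (re_le_Cmod (m v)) (B v ltac:(lra)). intros R1 R2. apply Rabs_le_between in R1. lra.
Qed.

(** Each [b] is closer than [w / 2] to at most one of the points, so it eliminates at most one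
    index. *)
Lemma pigeonhole_spaced (y : nat -> R) (w : R) : (forall i j, i <> j -> w <= Rabs (y i - y j)) ->
  forall (l : list R) (is : list nat), NoDup is -> (length l < length is)%nat ->
  exists i, In i is /\ forall b, In b l -> w / 2 <= Rabs (y i - b).
Proof.
  intros Hy. induction l as [|b l IH]; intros is Hnd Hlen; simpl in Hlen.
  - destruct is as [|i is]; simpl in Hlen; [lia|]. exists i. split. left; reflexivity. intros b [].
  - destruct (classic (exists i, In i is /\ Rabs (y i - b) < w / 2)) as [(i & Hi & Hib)|Hno].
    + apply in_split in Hi. destruct Hi as (i1 & i2 & ->).
      destruct (NoDup_remove _ _ _ Hnd) as [Hnd' Hni].
      destruct (IH (i1 ++ i2) Hnd') as (j & Hj & Hjl). rewrite length_app in *; simpl in Hlen; lia.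
      exists j. split. apply in_or_app. apply in_app_or in Hj. destruct Hj; [left|right; right]; assumption.
      intros x [<-|Hx]; [|apply Hjl, Hx]. apply Rnot_lt_le. intros Hlt.
      assert (Hij : i <> j) by congruence. specialize (Hy i j Hij).
      assert (Rabs (y i - y j) <= Rabs (y i - b) + Rabs (y j - b)).
      { replace (y i - y j) with ((y i - b) - (y j - b)) by ring. eapply Rle_trans; [apply Rabs_triang|]. rewrite Rabs_Ropp. lra. }
      lra.
    + destruct (IH is Hnd) as (j & Hj & Hjl). lia.
      exists j. split. exact Hj. intros x [<-|Hx]; [|apply Hjl, Hx]. apply Rnot_lt_le. intros Hlt.
      apply Hno. exists j. auto.
Qed.

Lemma good_radius (l : list R) (x : R) : exists y, x <= y <= x + 1 /\
  forall b, In b l -> / (2 * (INR (length l) + 1)) <= Rabs (y - b).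
Proof.
  set (n := length l). set (w := / (INR n + 1)).
  assert (Hn := pos_INR n). assert (Hw : 0 < w) by (apply Rinv_0_lt_compat; lra).
  assert (Hwn : w * (INR n + 1) = 1) by (unfold w; field; lra).
  destruct (pigeonhole_spaced (fun i => x + w * INR i) w) with (l := l) (is := seq 0 (S n)) as (i & Hi & Hil).
  - intros i j Hij. replace (x + w * INR i - (x + w * INR j)) with (w * (INR i - INR j)) by ring.
    rewrite Rabs_mult, (Rabs_pos_eq w) by lra. rewrite <- (Rmult_1_r w) at 1. apply Rmult_le_compat_l. lra.
    destruct (Nat.lt_total i j) as [H|[H|H]]; [| contradiction |].
    + rewrite Rabs_left1; apply le_INR in H; rewrite S_INR in H; lra.
    + rewrite Rabs_pos_eq; apply le_INR in H; rewrite S_INR in H; lra.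
  - apply seq_NoDup.
  - rewrite length_seq. fold n. lia.
  - apply in_seq in Hi. exists (x + w * INR i). assert (Hi2 : INR i <= INR n) by (apply le_INR; lia).
    assert (0 <= INR i) by apply pos_INR. split. split; nra.
    intros b Hb. replace (/ (2 * (INR n + 1))) with (w / 2) by (unfold w; field; lra). apply Hil, Hb.
Qed.

Lemma rotated_lower l r y w : 0 < r -> 0 < w -> (forall b, In b l -> b <> RtoC 0 /\ Cmod b <= r) ->
  (forall b, In b l -> w <= Rabs (y - Cmod b)) -> (w / r) ^ length l <= Cmod (canonical (rotated l) y).
Proof.
  intros Hr Hw Hl Hy. assert (Hwr : 0 < w / r) by (apply Rdiv_lt_0_compat; assumption).
  induction l as [|b l IH]; simpl. rewrite Cmod_1; lra.
  destruct (Hl b (or_introl eq_refl)) as [Nb Hb].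
  assert (Hb0 : 0 < Cmod b) by (apply Cmod_gt_0; exact Nb).
  rewrite Cmod_mult. apply Rmult_le_compat. lra. apply pow_le; lra.
  - replace (1 - y / Cmod b)%C with (RtoC ((Cmod b - y) / Cmod b)).
    2:{ rewrite RtoC_div, RtoC_minus by lra. field. intros E. apply RtoC_inj in E. lra. }
    rewrite Cmod_R. unfold Rdiv. rewrite Rabs_mult, (Rabs_pos_eq (/ Cmod b)) by (left; apply Rinv_0_lt_compat, Hb0).
    rewrite Rabs_minus_sym. apply Rmult_le_compat. lra. left; apply Rinv_0_lt_compat, Hr.
    apply Hy. left; reflexivity. apply Rinv_le_contravar; lra.
  - apply IH; intros x Hx; [apply Hl | apply Hy]; right; exact Hx.
Qed.

(* The maximum principle on a circle [|z| = y] that stays away from the moduli of all the zeroes. *)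
Lemma log_upper c K a r l g h q q' x z : exp_like c K a -> factors a r l g -> log_data r g h q q' ->
  0 < r -> Cmod z <= x -> Cmod z < r ->
  Re (h z) <= x + 1 + ln (K / c) + INR (length l) * ln (2 * (INR (length l) + 1) * r).
Proof.
  intros He Hf L Hr Hzx Hzr. set (n := length l).
  assert (Eg0 := factors_0 _ _ _ _ Hf). destruct Hf as (Hg & Hl & E).
  assert (Hnl : nonzero l) by (intros b Hb; apply Hl, Hb).
  destruct (good_radius (map Cmod l) x) as (y & Hy & Hyb). rewrite length_map in Hyb. fold n in Hyb.
  assert (Hn := pos_INR n).
  set (D := 2 * (INR n + 1) * r). assert (HD : 0 < D) by (unfold D; nra).
  assert (Low : (/ D) ^ n <= Cmod (canonical (rotated l) y)).
  { replace (/ D) with (/ (2 * (INR n + 1)) / r) by (unfold D; field; lra).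
    apply rotated_lower. exact Hr. apply Rinv_0_lt_compat; lra. exact Hl.
    intros b Hb. apply Hyb, in_map, Hb. }
  assert (HP : 0 < (/ D) ^ n) by (apply pow_lt, Rinv_0_lt_compat, HD).
  destruct He as (Hc & HK & Ha).
  assert (Ha0 : c <= Cmod (g O)). { rewrite Eg0. specialize (Ha O). simpl in Ha. lra. }
  assert (G : Cmod (ps g z) <= K * exp y / (/ D) ^ n).
  { apply (disc_max (ps g) y (y + 1)).
    - apply Rmult_le_pos. generalize (exp_pos y). nra. left; apply Rinv_0_lt_compat, HP.
    - lra.
    - apply holo_ps, Hg.
    - intros w Hw. assert (U := exp_like_upper c K a w (conj Hc (conj HK Ha))). rewrite E, Cmod_mult, Hw in U.
      assert (Rl := rotated_le l w Hnl). rewrite Hw in Rl.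
      apply Rmult_le_reg_r with ((/ D) ^ n). exact HP.
      unfold Rdiv. rewrite (Rmult_assoc (K * exp y)), Rinv_l by lra. generalize (Cmod_ge_0 (ps g w)). nra.
    - lra. }
  rewrite (log_exp _ _ _ _ _ L z Hzr), Cmod_mult, Cmod_Cexp in G.
  assert (HKc : 0 < K / c) by (apply Rdiv_lt_0_compat; lra).
  assert (G2 : exp (Re (h z)) <= K / c * exp y / (/ D) ^ n).
  { apply Rmult_le_reg_l with c. exact Hc. replace (c * (K / c * exp y / (/ D) ^ n)) with (K * exp y / (/ D) ^ n) by (field; lra).
    eapply Rle_trans; [|exact G]. apply Rmult_le_compat_r. left; apply exp_pos. exact Ha0. }
  apply Rle_trans with (y + ln (K / c) + INR n * ln D); [|lra].
  apply exp_le_inv. eapply Rle_trans; [exact G2|]. right.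
  rewrite !exp_plus, exp_ln by exact HKc. rewrite <- ln_pow by exact HD. rewrite exp_ln by (apply pow_lt, HD).
  rewrite pow_inv. field. split. lra. apply pow_nonzero. lra.
Qed.

(** Serves to make the derivative of the logarithm at 0 real and positive, as the section on the
    maximum curve assumes. *)
Lemma log_data_rotate r g h q q' e : fast g -> Cmod e = 1 -> log_data r g h q q' ->
  log_data r (fun n => g n * e ^ n)%C (fun z => h (e * z)%C) (fun z => e * q (e * z))%C (fun z => e * (q' (e * z) * e))%C.
Proof.
  intros Hg He L.
  assert (Em : forall z, Cmod (e * z)%C = Cmod z) by (intros z; rewrite Cmod_mult, He; ring).
  assert (De : forall z, cder (fun z => e * z)%C z e).
  { intros z. eapply cder_eq. apply cder_scal, cder_id. ring. }
  constructor.
  - replace (e * 0)%C with (RtoC 0) by ring. apply (log_0 _ _ _ _ _ L).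
  - intros z Hz. replace (ps (fun n => g n * e ^ n)%C z) with (ps g (e * z)%C).
    rewrite (log_exp _ _ _ _ _ L). simpl. ring. rewrite Em. exact Hz.
    unfold ps. apply csum_ext. intros n. rewrite Cpow_mult_l. ring.
  - intros z Hz. eapply cder_eq. apply (cder_comp (fun z => e * z)%C h). apply De.
    apply (log_der _ _ _ _ _ L). rewrite Em. exact Hz. ring.
  - intros z Hz. destruct (log_der2 _ _ _ _ _ L (e * z)%C) as [D1 D2]. rewrite Em. exact Hz. split.
    + apply cder_scal. apply (cder_comp (fun z => e * z)%C q). apply De. exact D1.
    + apply ccont_mult. apply ccont_const. apply ccont_mult; [|apply ccont_const].
      apply (ccont_comp (fun z => e * z)%C q'). eapply cder_ccont, De. exact D2.
  - intros z Hz. rewrite Cmod_mult, He, Rmult_1_l. apply (log_q _ _ _ _ _ L). rewrite Em. exact Hz.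
  - intros z Hz. rewrite !Cmod_mult, He, Rmult_1_l, Rmult_1_r. apply (log_q' _ _ _ _ _ L). rewrite Em. exact Hz.
Qed.

Lemma ex_pow2_ge (x : R) : exists n : nat, x <= 2 ^ n.
Proof.
  destruct (ex_nat_between (Rmax 0 x)) as (n & Hn & _). apply Rmax_l.
  exists n. generalize (INR_le_pow2 n) (Rmax_r 0 x). lra.
Qed.

(** The count is controlled at the single radius [r]. At smaller radii monotonicity alone is
    available, so the logarithm of the growth is estimated crudely by [N] times [ln r] plus a
    constant. The power [eps] to spare pays for the logarithms. *)
Lemma no_zero_lower c K a F eps : exp_like c K a -> (forall z, F z = ps a z) -> 0 < eps ->
  (forall T, exists r, T <= r /\ Rbar_le (zero_count F r) (Finite (Rpower r (1 / 2 - eps)))) ->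
  forall z0, ps a z0 <> 0%C.
Proof.
  intros He HF Heps Hcount z0 Hz0.
  assert (Ha := exp_like_fast _ _ _ He). assert (Ha0 := exp_like_0 _ _ _ He).
  assert (Nz0 : z0 <> 0%C). { intros ->. rewrite ps_0 in Hz0. contradiction. }
  destruct (zeroes_away a Ha Ha0) as (x0 & Hx0 & Haway).
  assert (HKc := exp_like_ratio _ _ _ He).
  assert (HlKc := ln_ge_0 _ HKc).
  assert (Hix : 0 < / x0) by (apply Rinv_0_lt_compat, Hx0).
  assert (Hlx : 0 <= ln (1 + / x0)) by (apply ln_ge_0; lra).
  assert (Hl8 : 0 <= ln 8) by (apply ln_ge_0; lra).
  assert (Hl4 : 0 <= ln 4) by (apply ln_ge_0; lra).
  apply (unbounded_growth z0 (ln (K / c) + 1) Nz0). intros t Ht.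
  assert (Hst := sqrt_pos t).
  (* Collects the constants of the growth bound and of the lower and upper bounds for [Re h]. As
     [B >= 7], the product [B * (1 + y)] also absorbs the multiples of [y = ln r], so that a single
     [LL = B * N * (1 + y)] dominates all three. *)
  set (B := 7 + ln (K / c) + ln 8 + ln 4 + ln (1 + / x0)).
  (* [Y1] will give [LL <= r / 16384], [Y2] will bound the Phragmen-Lindelof term at [t] by 1, and
     [Y3] will give [t <= s ^ 2], where 9437184 = 36 * 262144. *)
  destruct (exp_beats_square (16384 * B) (1/2)) as (Y1 & HY1 & HY1'). lra.
  destruct (exp_beats_square (36 * 3072 * B * sqrt t) eps Heps) as (Y2 & HY2 & HY2').
  destruct (exp_beats_square (9437184 * t) 1) as (Y3 & HY3 & HY3'). lra.
  destruct (Hcount (exp (Y1 + Y2 + Y3) + Cmod z0 + ln (K / c))) as (r & Hrbig & Hcnt).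
  assert (Hz00 := Cmod_ge_0 z0). assert (HpY := exp_pos (Y1 + Y2 + Y3)).
  assert (Hr : 0 < r) by lra.
  set (y := ln r).
  assert (Hry : exp y = r) by (apply exp_ln, Hr).
  assert (Hy : Y1 + Y2 + Y3 <= y). { apply exp_le_inv. rewrite Hry. lra. }
  specialize (HY1' y ltac:(lra)). specialize (HY2' y ltac:(lra)). specialize (HY3' y ltac:(lra)).
  assert (Hy1 : 1 <= y) by lra.
  destruct (factorization a r Ha Ha0 Hr) as (l & g & Hf & Hnz).
  destruct (log_exists c K a r l g He) as (h & q & q' & L); try assumption. lra.
  assert (Hl : forall b, In b l -> b <> 0%C /\ Cmod b <= r) by apply Hf.
  assert (Hnl : nonzero l) by (intros b Hb; apply Hl, Hb).
  assert (Hin : In z0 l) by (apply (zero_in_factors a r l g z0 Hf Hnz); [lra|exact Hz0]).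
  set (N := INR (length l)).
  assert (HN1 : 1 <= N). { unfold N. destruct l as [|b l']. destruct Hin. simpl length. rewrite S_INR. generalize (pos_INR (length l')). lra. }
  assert (HNr : N <= exp ((1/2 - eps) * y)).
  { assert (Z := zero_count_ge a r l g r Hf Hnz (Rle_refl r) F HF).
    assert (Z2 := Rbar_le_trans _ _ _ Z Hcnt). simpl in Z2.
    unfold N. rewrite <- (count_all r l). exact Z2. intros b Hb; apply Hl, Hb. }
  assert (HNr2 : N <= r). { eapply Rle_trans; [exact HNr|]. rewrite <- Hry. apply exp_le. nra. }
  assert (HBB : 7 <= B) by (unfold B; lra).
  set (LL := B * N * (1 + y)).
  assert (HLL1 : 1 <= LL). { unfold LL. assert (1 <= B * N) by nra. nra. }
  assert (HLLe : LL <= B * (1 + y) * exp ((1/2 - eps) * y)).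
  { unfold LL. replace (B * N * (1 + y)) with (B * (1 + y) * N) by ring. apply Rmult_le_compat_l. nra. exact HNr. }
  assert (HLLN : forall u, u <= B * (1 + y) -> N * u <= LL).
  { intros u Hu. unfold LL. replace (B * N * (1 + y)) with (N * (B * (1 + y))) by ring. apply Rmult_le_compat_l; lra. }
  assert (HBy : B + 7 * y <= B * (1 + y)) by nra.
  assert (Hgrowth : forall x, 0 <= x <= r -> growth l x <= exp (N * (y + ln (1 + / x0)))).
  { intros x Hx. destruct (growth_crude l x x0 (length l) Hx0) as [_ G]. lra.
    intros b Hb. apply Haway, (factor_is_zero _ _ _ _ _ Hf Hb). lia.
    eapply Rle_trans; [exact G|].
    assert (Hq : 0 <= x / x0 <= r * / x0). { unfold Rdiv. split. nra. apply Rmult_le_compat_r; lra. }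
    rewrite <- (exp_ln ((1 + x / x0) ^ length l)) by (apply pow_lt; lra). apply exp_le.
    rewrite ln_pow by lra. apply Rmult_le_compat_l. apply pos_INR.
    unfold y. rewrite <- ln_mult by lra. apply ln_le. lra. nra. }
  assert (HgL : forall x, 0 <= x <= r -> growth l x <= exp LL).
  { intros x Hx. eapply Rle_trans; [apply Hgrowth, Hx|]. apply exp_le, HLLN. unfold B in HBy |- *. lra. }
  assert (Hlo : forall x, 0 < x <= r -> ln (K / c * (4 * x + 4) * growth l x) + 1 <= LL).
  { intros x Hx. assert (G1 := growth_ge_1 l x Hnl ltac:(lra)).
    assert (P1 : 0 < K / c * (4 * x + 4)) by (apply Rmult_lt_0_compat; lra).
    rewrite !ln_mult by lra.
    assert (ln (growth l x) <= N * (y + ln (1 + / x0))).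
    { rewrite <- (ln_exp (N * (y + ln (1 + / x0)))). apply ln_le. lra. apply Hgrowth. lra. }
    assert (ln (4 * x + 4) <= ln 8 + y). { unfold y. rewrite <- ln_mult by lra. apply ln_le; lra. }
    assert (N * (1 + ln (K / c) + ln 8 + y + (y + ln (1 + / x0))) <= LL). { apply HLLN. unfold B in HBy |- *. lra. }
    assert (1 + ln (K / c) + ln 8 + y <= N * (1 + ln (K / c) + ln 8 + y)).
    { rewrite <- (Rmult_1_l (1 + ln (K / c) + ln 8 + y)) at 1. apply Rmult_le_compat_r; lra. }
    lra. }
  assert (Hup : 1 + ln (K / c) + N * ln (2 * (N + 1) * r) <= LL).
  { assert (ln (2 * (N + 1) * r) <= ln 4 + 2 * y).
    { unfold y. rewrite <- ln_pow2, <- ln_mult by (try apply pow_lt; lra). apply ln_le.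
      apply Rmult_lt_0_compat; lra. simpl. nra. }
    assert (N * (1 + ln (K / c) + (ln 4 + 2 * y)) <= LL). { apply HLLN. unfold B in HBy |- *. lra. }
    assert (1 + ln (K / c) <= N * (1 + ln (K / c))).
    { rewrite <- (Rmult_1_l (1 + ln (K / c))) at 1. apply Rmult_le_compat_r; lra. }
    nra. }
  assert (Hhalf : LL <= r / 16384).
  { apply Rmult_le_reg_l with 16384. lra. replace (16384 * (r / 16384)) with (exp (1/2 * y) * exp (1/2 * y)).
    2:{ rewrite <- exp_plus. replace (1/2 * y + 1/2 * y) with y by field. rewrite Hry. field. }
    apply Rle_trans with (16384 * B * (1 + y) ^ 2 * exp (1/2 * y)).
    2: apply Rmult_le_compat_r; [left; apply exp_pos|exact HY1'].
    apply Rle_trans with (16384 * (B * (1 + y) * exp ((1/2 - eps) * y))). apply Rmult_le_compat_l; lra.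
    replace (16384 * (B * (1 + y) * exp ((1 / 2 - eps) * y))) with (16384 * B * (1 + y) * exp ((1 / 2 - eps) * y)) by ring.
    apply Rmult_le_compat. nra. left; apply exp_pos.
    apply Rmult_le_compat_l; nra. apply exp_le. nra. }
  set (al := q 0%C).
  (* At radius [r / 4096] both the nonlinear error of [h] and [LL] are at most [r / 16384], a
     quarter of that radius, so half of it remains for the linear term. *)
  assert (HA : 1/2 <= Cmod al).
  { destruct (log_lower c K a r l g h q q' (r / 4096) He Hf L) as (z1 & Hz1 & Hlow). lra.
    assert (Lin := log_linear r g h q q' L Hr z1 ltac:(lra)). fold al in Lin. rewrite Hz1 in Lin.
    replace (1024 / r * (r / 4096) ^ 2) with (r / 16384) in Lin by (field; lra).
    assert (R1 := Re_le_Cmod (h z1 - al * z1)%C). assert (R2 := Re_le_Cmod (al * z1)%C).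
    rewrite Cmod_mult, Hz1 in R2.
    assert (R3 : Re (h z1) = Re (h z1 - al * z1)%C + Re (al * z1)%C) by rring.
    assert (Hlo1 := Hlo (r / 4096) ltac:(lra)).
    apply Rmult_le_reg_r with (r / 4096). lra. lra. }
  destruct (unit_phase al) as (e & He1 & Hee).
  assert (LR := log_data_rotate r g h q q' e (proj1 Hf) He1 L).
  assert (HQ0 : (e * q (e * 0))%C = RtoC (Cmod al)).
  { replace (e * 0)%C with (RtoC 0) by ring. fold al. rewrite <- Hee. ring. }
  assert (HA64 : Cmod al <= 64). { apply (log_q _ _ _ _ _ L). rewrite Cmod_0. lra. }
  (* Enough iterations for the loss [x * Cmod al * (1/2) ^ n] to be at most 1, since
     [Cmod al <= 64]. The [+ 1] in [Hlo] has reserved room for it. *)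
  destruct (ex_pow2_ge (64 * r)) as (n & Hn).
  destruct (maximum_curve r (Cmod al) _ _ _ _ Hr LR HA HQ0 n) as (m & Hm1 & Hm2 & Hm3).
  assert (Hsmall : forall x, 0 <= x <= r / 262144 -> x * Cmod al * (1/2) ^ n <= 1).
  { intros x Hx. assert (Hp : 0 < 2 ^ n) by (apply pow_lt; lra).
    replace ((1/2) ^ n) with (/ 2 ^ n) by (unfold Rdiv; rewrite Rmult_1_l, pow_inv; reflexivity).
    apply Rdiv_le_cross. exact Hp. rewrite Rmult_1_l. eapply Rle_trans; [|exact Hn].
    rewrite (Rmult_comm 64). apply Rmult_le_compat; lra. }
  assert (Hree : (e * Cconj e)%C = 1%C). { rewrite <- Cmod2_conj, He1. cring. }
  (* Two sides: [log_upper] keeps [Re h] from exceeding [x] by more than [LL], and [log_lower] at an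
     unknown point of the circle passes to the curve by near maximality. *)
  assert (Hreal : forall x : R, 0 <= x <= r / 262144 -> Cmod (m x) <= LL).
  { intros x Hx. destruct (Rle_lt_or_eq_dec 0 x (proj1 Hx)) as [Hx1|<-].
    2:{ eapply Rle_trans. apply Hm2. rewrite Cmod_0; lra. rewrite Cmod_0; lra. }
    destruct (Hm3 x Hx) as (z & Hz & Ez & Hmax). rewrite Ez, Cmod_R.
    assert (Hez : Cmod (e * z)%C = x) by (rewrite Cmod_mult, He1, Hz; ring).
    apply Rabs_le. split.
    - assert (U := log_upper c K a r l g h q q' x (e * z)%C He Hf L Hr ltac:(lra) ltac:(lra)). fold N in U. lra.
    - destruct (log_lower c K a r l g h q q' x He Hf L) as (z1 & Hz1 & Hlow). lra.
      specialize (Hmax (Cconj e * z1)%C ltac:(rewrite Cmod_mult, Cmod_conj, He1, Hz1; ring)).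
      replace (e * (Cconj e * z1))%C with z1 in Hmax by (rewrite Cmult_assoc, Hree; ring).
      assert (Hs := Hsmall x Hx). assert (Hlo1 := Hlo x ltac:(lra)). lra. }
  assert (TC := two_constants m r LL HLL1 Hy1 Hr Hm1 Hm2 Hreal). fold y in TC.
  (* Chosen so that [s ^ 2] is the radius of validity of [two_constants]; 3072^2 = 36 * 262144. *)
  set (s := exp (1/2 * y) / (3072 * y)).
  assert (Hs : 0 < s). { apply Rdiv_lt_0_compat. apply exp_pos. lra. }
  assert (Hs2 : s ^ 2 = r / 262144 / (36 * y ^ 2)).
  { unfold s. rewrite <- Hry at 1. replace y with (1/2 * y + 1/2 * y) at 3 by field. rewrite exp_plus. field. lra. }
  assert (Hsr0 : s ^ 2 <= r / 262144).
  { rewrite Hs2. assert (1 <= y ^ 2) by (apply pow_R1_Rle; lra). apply Rdiv_le_cross. lra. nra. }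
  rewrite <- Hs2 in TC.
  exists l. split. exact Hnl. split. exact Hin.
  (* With [d = 12 * LL / s] the linear bound of [two_constants] is exactly [d * u / s], and on the
     circle [d * s = 12 * LL] exceeds the crude bound [LL]. *)
  eapply Rle_trans. apply (growth_nonneg_bound l (ln (K / c)) s (12 * LL / s) Hnl Hs HlKc).
  - apply Rmult_le_pos. lra. left; apply Rinv_0_lt_compat, Hs.
  - intros u Hu. destruct (Hm3 u ltac:(lra)) as (z & Hz & Ez & _).
    assert (Hez : Cmod (e * z)%C = u) by (rewrite Cmod_mult, He1, Hz; ring).
    assert (RB := rotated_bound c K a r l g h q q' (e * z)%C He Hf L ltac:(lra)). rewrite Hez in RB.
    eapply Rle_trans; [exact RB|]. rewrite exp_plus, exp_ln by lra. apply Rmult_le_compat_l. lra. apply exp_le.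
    assert (T := TC u Hu). rewrite Ez, Cmod_R in T.
    replace (12 * LL / s * u / s) with (12 * LL * u / s ^ 2) by (field; lra).
    eapply Rle_trans; [apply Rle_abs|exact T].
  - replace (12 * LL / s * s) with (12 * LL) by (field; lra).
    eapply Rle_trans. apply HgL. split. apply pow2_ge_0. lra. apply exp_le. lra.
  - split. lra. rewrite Hs2. replace (r / 262144 / (36 * y ^ 2)) with (r / (9437184 * y ^ 2)) by (field; lra).
    assert (Hyy : 0 < y ^ 2) by (apply pow_lt; lra).
    apply Rmult_le_reg_r with (9437184 * y ^ 2). lra.
    replace (r / (9437184 * y ^ 2) * (9437184 * y ^ 2)) with r by (field; lra).
    rewrite Rmult_1_l, Hry in HY3'. nra.
  - apply exp_le. apply Rplus_le_compat_l.
    replace (3 * (12 * LL / s) * sqrt t) with (36 * LL * sqrt t / s) by (field; lra).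
    apply Rdiv_le_cross. exact Hs. rewrite Rmult_1_l. unfold s.
    apply Rmult_le_reg_r with (3072 * y). lra.
    replace (exp (1/2 * y) / (3072 * y) * (3072 * y)) with (exp (1/2 * y)) by (field; lra).
    apply Rle_trans with (36 * 3072 * B * sqrt t * (1 + y) ^ 2 * exp ((1/2 - eps) * y)).
    + apply Rle_trans with (36 * (B * (1 + y) * exp ((1/2 - eps) * y)) * sqrt t * (3072 * y)).
      * apply Rmult_le_compat_r. lra. apply Rmult_le_compat_r. exact Hst. lra.
      * assert (P := exp_pos ((1/2 - eps) * y)).
        assert (0 <= 36 * 3072 * B * sqrt t * exp ((1/2 - eps) * y) * (1 + y)).
        { repeat apply Rmult_le_pos; lra. }
        nra.
    + replace (1/2 * y) with (eps * y + (1/2 - eps) * y) by field. rewrite exp_plus.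
      apply Rmult_le_compat_r. left; apply exp_pos. exact HY2'.
Qed.

(** * The zero free case and the passage to limits *)

Lemma cder_unique f z l l' : cder f z l -> cder f z l' -> l = l'.
Proof.
  intros H H'. assert (E : (l - l')%C = 0%C).
  { apply C_eq_small. intros eps He.
    destruct (H (eps/2) ltac:(lra)) as (d & Hd & Hk). destruct (H' (eps/2) ltac:(lra)) as (d' & Hd' & Hk').
    assert (Hm : 0 < Rmin d d') by (apply Rmin_pos; assumption).
    set (k := RtoC (Rmin d d' / 2)).
    assert (Hkm : Cmod k = Rmin d d' / 2) by (unfold k; rewrite Cmod_R, Rabs_pos_eq; lra).
    specialize (Hk k ltac:(generalize (Rmin_l d d'); lra)). specialize (Hk' k ltac:(generalize (Rmin_r d d'); lra)).
    apply Rmult_le_reg_r with (Cmod k). lra. rewrite <- Cmod_mult.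
    replace ((l - l') * k)%C with ((f (z + k)%C - f z - l' * k) - (f (z + k)%C - f z - l * k))%C by ring.
    eapply Rle_trans; [apply Cmod_minus_le|]. lra. }
  replace l with ((l - l') + l')%C by ring. rewrite E. ring.
Qed.

(** With the empty list of zeroes, [a] is its own cofactor on every disc. The logarithm is
    constructed anew for each [r], but its derivative at 0 is always [a 1 / a 0], and its deviation
    from linearity at a fixed [z] is O(1/r). *)
Lemma zero_free_exponential c K a : exp_like c K a -> (forall z, ps a z <> 0%C) ->
  exists Theta alpha : C, Theta <> RtoC 0 /\ alpha <> RtoC 0 /\
    forall z, ps a z = (Theta * Cexp (alpha * z))%C.
Proof.
  intros He Hnz. assert (Ha := exp_like_fast _ _ _ He). assert (Ha0 := exp_like_0 _ _ _ He).
  set (al := (a 1%nat / a O)%C). exists (a O), al. split. exact Ha0. split.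
  { assert (H1 : a 1%nat <> 0%C). { destruct He as (Hc & _ & H). specialize (H 1%nat). simpl in H. apply Cmod_gt_0. lra. }
    unfold al. apply Cmult_neq_0. exact H1. intros E. apply Ha0.
    replace (a O) with (a O * a O * / a O)%C by (field; exact Ha0). rewrite E. ring. }
  intros z.
  assert (E : (ps a z - a O * Cexp (al * z))%C = 0%C).
  { apply C_eq_small. intros eps Heps.
    assert (Hcont : ccont (fun w => a O * Cexp w)%C (al * z)%C).
    { apply ccont_mult. apply ccont_const. eapply cder_ccont, cder_Cexp. }
    destruct (Hcont eps Heps) as (d & Hd & Hk).
    set (m := Cmod z). assert (Hm : 0 <= m) by apply Cmod_ge_0.
    assert (HlKc := ln_ge_0 _ (exp_like_ratio _ _ _ He)).
    assert (Hmd : 0 <= m ^ 2 / d) by (apply Rmult_le_pos; [apply pow2_ge_0|left; apply Rinv_0_lt_compat, Hd]).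
    (* The first terms meet the hypotheses of [log_exists], [4 * m] puts [z] in the disc of
       [log_linear], and the last one pushes the error there below [d]. *)
    set (r := 1 + ln (K / c) + 4 * m + 1024 * (m ^ 2 / d)).
    assert (Hr : 0 < r) by (unfold r; lra).
    destruct (log_exists c K a r nil a He) as (h & q & q' & L).
    { unfold r; lra. } { exact Hr. } { split. exact Ha. split. intros b []. intros w; simpl; ring. } { intros; apply Hnz. }
    assert (Hq0 : q 0%C = al).
    { assert (D1 : cder (ps a) 0%C (a O * (Cexp (h 0%C) * q 0%C))%C).
      { apply cder_ext_loc with (fun z => a O * Cexp (h z))%C r. exact Hr.
        intros k Hkr. rewrite Cplus_0_l. symmetry. apply (log_exp _ _ _ _ _ L). exact Hkr.
        apply cder_scal. apply (cder_comp h Cexp). apply (log_der _ _ _ _ _ L). rewrite Cmod_0; exact Hr. apply cder_Cexp. }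
      assert (D2 := ps_cder a 0%C Ha). assert (U := cder_unique _ _ _ _ D1 D2).
      rewrite (log_0 _ _ _ _ _ L), Cexp_0, ps_0 in U. unfold dcoef in U. simpl INR in U.
      unfold al. replace (a 1%nat) with (1 * a 1%nat)%C by ring. rewrite <- U. field. exact Ha0. }
    assert (Lin := log_linear r a h q q' L Hr z ltac:(fold m; unfold r; lra)). rewrite Hq0 in Lin. fold m in Lin.
    assert (Hlt : 1024 / r * m ^ 2 < d).
    { apply Rmult_lt_reg_r with (r / d). apply Rdiv_lt_0_compat; lra.
      replace (1024 / r * m ^ 2 * (r / d)) with (1024 * (m ^ 2 / d)) by (field; lra).
      replace (d * (r / d)) with r by (field; lra). unfold r. lra. }
    specialize (Hk (h z - al * z)%C ltac:(lra)).
    replace (al * z + (h z - al * z))%C with (h z) in Hk by ring.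
    rewrite <- (log_exp _ _ _ _ _ L z) in Hk. exact Hk. fold m. unfold r; lra. }
  replace (ps a z) with ((ps a z - a O * Cexp (al * z)) + a O * Cexp (al * z))%C by ring. rewrite E. ring.
Qed.

Lemma Rbar_div_le (x : Rbar) (y d : R) : 0 < y -> Rbar_le (Rbar_div x (Finite y)) (Finite d) -> Rbar_le x (Finite (d * y)).
Proof.
  intros Hy H. assert (Hi : 0 < / y) by (apply Rinv_0_lt_compat, Hy).
  destruct x as [x| |]; simpl in H |- *.
  - apply Rmult_le_reg_r with (/ y). exact Hi. rewrite (Rmult_assoc d), Rinv_r by lra. lra.
  - unfold Rbar_div, Rbar_mult in H. simpl in H.
    destruct (Rle_dec 0 (/ y)) as [H1|H1]; [|lra]. destruct (Rle_lt_or_eq_dec 0 (/ y) H1) as [H2|H2]; [|lra]. exact H.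
  - exact I.
Qed.

(** Otherwise every supremum over a half line exceeds [d], and so their infimum 0 is at least
    [d]. *)
Lemma LimSup_infty_le (u : R -> Rbar) d : LimSup_infty u = Finite 0 -> 0 < d ->
  exists T, forall r, T <= r -> Rbar_le (u r) (Finite d).
Proof.
  intros H Hd. apply NNPP. intros Hno. unfold LimSup_infty, Rbar_glb in H.
  destruct (Rbar_ex_glb _) as (l & Hl1 & Hl2). simpl in H. subst l.
  assert (Hle : Rbar_le (Finite d) (Finite 0)); [|simpl in Hle; lra].
  apply Hl2. intros s (A & ->). unfold Rbar_lub. destruct (Rbar_ex_lub _) as (v & Hv1 & Hv2). cbn [proj1_sig].
  apply Rbar_not_lt_le. intros Hlt. apply Hno. exists A. intros r Hr.
  apply Rbar_le_trans with v. apply Hv1. exists r. auto. apply Rbar_lt_le, Hlt.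
Qed.

Lemma LimInf_infty_le (u : R -> Rbar) d T : LimInf_infty u = Finite 0 -> 0 < d ->
  exists r, T <= r /\ Rbar_le (u r) (Finite d).
Proof.
  intros H Hd. apply NNPP. intros Hno. unfold LimInf_infty, Rbar_lub in H.
  destruct (Rbar_ex_lub _) as (l & Hl1 & Hl2). simpl in H. subst l.
  assert (Hle : Rbar_le (Finite d) (Finite 0)); [|simpl in Hle; lra].
  eapply Rbar_le_trans; [|apply Hl1; exists T; reflexivity].
  unfold Rbar_glb. destruct (Rbar_ex_glb _) as (v & Hv1 & Hv2). cbn [proj1_sig].
  apply Hv2. intros s (r & Hr & ->). apply Rbar_not_lt_le. intros Hlt. apply Hno. exists r. split. exact Hr.
  apply Rbar_lt_le, Hlt.
Qed.

Theorem theorem2 (c K : R) (omega : nat -> C) (F : C -> C)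
  (c_pos : 0 < c) (c_le_K : c <= K)
  (omega_bounds : forall n : nat, c <= Cmod (omega n) <= K)
  (F_series : forall z : C,
     @is_series C_AbsRing C_NormedModule
       (fun n : nat => (omega n * (z ^ n / RtoC (INR (fact n))))%C) (F z))
  (few_zeroes :
     LimSup_infty (fun r : R => Rbar_div (zero_count F r) (Finite (sqrt r)))
       = Finite 0
     \/
     exists eps : R, 0 < eps /\
       LimInf_infty (fun r : R =>
         Rbar_div (zero_count F r) (Finite (Rpower r (1 / 2 - eps))))
         = Finite 0) :
  exists Theta alpha : C,
    Theta <> RtoC 0 /\ alpha <> RtoC 0 /\
    (forall z : C, F z = (Theta * Cexp (alpha * z))%C).
Proof.
  set (a := fun n => (omega n / RtoC (INR (fact n)))%C).
  assert (Hfact : forall n, 0 < INR (fact n)) by (intros n; apply INR_fact_lt_0).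
  assert (Nfact : forall n, RtoC (INR (fact n)) <> RtoC 0).
  { intros n E. apply RtoC_inj in E. specialize (Hfact n). lra. }
  assert (HF : forall z, F z = ps a z).
  { intros z. rewrite (is_series_csum _ _ (F_series z)). apply csum_ext. intros n. unfold a. field. apply Nfact. }
  assert (He : exp_like c K a).
  { split. exact c_pos. split. exact c_le_K. intros n. unfold a. specialize (Hfact n).
    rewrite Cmod_div, Cmod_R, Rabs_pos_eq by (lra || apply Nfact).
    replace (Cmod (omega n) / INR (fact n) * INR (fact n)) with (Cmod (omega n)) by (field; lra). apply omega_bounds. }
  assert (Hnz : forall z, ps a z <> 0%C).
  { destruct few_zeroes as [H|(eps & Heps & H)].
    - apply (no_zero_upper c K a F He HF). intros d Hd.
      (* The maximum with 1 keeps the divisor [sqrt r] positive. *)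
      destruct (LimSup_infty_le _ d H Hd) as (T & HT). exists (Rmax T 1). intros r Hr.
      apply Rbar_div_le. apply sqrt_lt_R0. generalize (Rmax_r T 1). lra.
      apply HT. generalize (Rmax_l T 1). lra.
    - apply (no_zero_lower c K a F eps He HF Heps). intros T.
      destruct (LimInf_infty_le _ 1 T H Rlt_0_1) as (r & Hr & Hle). exists r. split. exact Hr.
      rewrite <- (Rmult_1_l (Rpower r (1 / 2 - eps))). apply Rbar_div_le. apply exp_pos. exact Hle. }
  destruct (zero_free_exponential c K a He Hnz) as (Theta & alpha & H1 & H2 & H3).
  exists Theta, alpha. split. exact H1. split. exact H2. intros z. rewrite HF. apply H3.
Qed.
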